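(* Let $d,n\geq1$ be integers and let $\vartheta:\mathbb{C}[q,q^{-1}]\rightarrow\mathbb{C}$ be a ring homomorphism such that $\vartheta(q)=\bar q\in\mathbb{C}\setminus\{0\}$. Consider the specialised Yokonuma--Hecke algebra ${\rm Y}_{d,n}(\bar q):=\mathbb{C}\otimes_{\mathbb{C}[q,q^{-1}]}{\rm Y}_{d,n}(q)$, defined via $\vartheta$. The algebra ${\rm Y}_{d,n}(\bar q)$ is split semisimple if and only if $\vartheta(P(q))\neq0$, where $$P(q)=\prod_{m=1}^{n}\left(q^{2(m-1)}+q^{2(m-2)}+\cdots+q^2+1\right).$$
   Context: Let $q$ be an indeterminate. The Yokonuma--Hecke algebra ${\rm Y}_{d,n}(q)$ is the associative unital $\mathbb{C}[q,q^{-1}]$-algebra generated by $g_1,\dots,g_{n-1},t_1,\dots,t_n$ subject to: $g_ig_j=g_jg_i$ for $|i-j|>1$; $g_ig_{i+1}g_i=g_{i+1}g_ig_{i+1}$ for $i=1,\dots,n-2$; $t_it_j=t_jt_i$ for all $i,j$; $t_jg_i=g_it_{s_i(j)}$ for all $i,j$, where $s_i$ is the transposition $(i,i+1)$; $t_j^d=1$ for all $j$; and $g_i^2=1+(q-q^{-1})e_ig_i$ for all $i$, where $e_i=\frac1d\sum_{s=0}^{d-1}t_i^st_{i+1}^{-s}$. *)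

(* Defs.v *)
From HB Require Import structures.
From mathcomp Require Import all_boot all_order all_algebra all_fingroup.
From mathcomp Require Import ring_quotient generic_quotient fraction.
From mathcomp Require Import boolp reals.
From mathcomp Require Import complex.
From mathcomp Require Import finmap monalg.

Set Implicit Arguments.
Unset Strict Implicit.
Unset Printing Implicit Defensive.

Import GRing.Theory.
Local Open Scope ring_scope.
Local Open Scope quotient_scope.

(* Laurent polynomials F[q, q^-1], realised inside the fraction field of F[X]
   as the fractions p / X^k. *)
Section Laurent.
Variable F : fieldType.

Definition laurent_pred : {pred {fraction {poly F}}} :=
  fun f => `[< exists p k, f = tofrac p / tofrac ('X ^+ k) >].

Lemma laurentP f :
  reflect (exists p k, f = tofrac p / tofrac ('X ^+ k)) (f \in laurent_pred).
Proof. by rewrite unfold_in; apply: asboolP. Qed.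

Lemma tofracX_neq0 k : tofrac ('X ^+ k : {poly F}) != 0.
Proof. by rewrite tofrac_eq0 -size_poly_eq0 size_polyXn. Qed.

Lemma laurent_subring_closed : subring_closed laurent_pred.
Proof.
split.
- by apply/laurentP; exists 1, 0%N; rewrite expr0 divr1 rmorph1.
- move=> _ _ /laurentP[p [k ->]] /laurentP[r [l ->]]; apply/laurentP.
  exists (p * 'X^l - r * 'X^k), (k + l)%N.
  by rewrite -mulNr addf_div ?tofracX_neq0 // exprD rmorphB !rmorphM mulNr.
- move=> _ _ /laurentP[p [k ->]] /laurentP[r [l ->]]; apply/laurentP.
  by exists (p * r), (k + l)%N; rewrite exprD !rmorphM /= mulf_div.
Qed.

HB.instance Definition _ :=
  GRing.isSubringClosed.Build _ laurent_pred laurent_subring_closed.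

Record laurent := Laurent { laurent_val : {fraction {poly F}};
                            laurent_valP : laurent_val \in laurent_pred }.
HB.instance Definition _ := [isSub for laurent_val].
HB.instance Definition _ := [Choice of laurent by <:].
HB.instance Definition _ := [SubChoice_isSubComNzRing of laurent by <:].

Definition laurent_unit : {pred laurent} :=
  fun x => (val x != 0) && ((val x)^-1 \in laurent_pred).
Definition laurent_inv (x : laurent) : laurent :=
  if x \in laurent_unit then insubd x (val x)^-1 else x.

Lemma val_laurent_inv x : x \in laurent_unit -> val (laurent_inv x) = (val x)^-1.
Proof. by move=> ux; rewrite /laurent_inv ux insubdK //; case/andP: ux. Qed.

Lemma laurent_mulVx : {in laurent_unit, left_inverse 1 laurent_inv *%R}.
Proof.
move=> x ux; apply: val_inj; rewrite rmorphM rmorph1 /= (val_laurent_inv ux).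
by rewrite mulVf //; case/andP: ux.
Qed.

Lemma laurent_unitPl (x y : laurent) : y * x = 1 -> laurent_unit x.
Proof.
move/(congr1 val); rewrite rmorphM rmorph1 /= => yx1.
have x0 : laurent_val x != 0.
  by apply: contra_eq_neq yx1 => ->; rewrite mulr0 eq_sym oner_eq0.
apply/andP; split=> //.
by have -> : (laurent_val x)^-1 = laurent_val y; [rewrite -[LHS]mul1r -yx1 mulfK|exact: valP].
Qed.

Lemma laurent_inv_out : {in [predC laurent_unit], laurent_inv =1 id}.
Proof. by move=> x /negbTE /= ux; rewrite /laurent_inv ux. Qed.

HB.instance Definition _ := GRing.ComNzRing_hasMulInverse.Build laurent
  laurent_mulVx laurent_unitPl laurent_inv_out.

Lemma laurent_polyP (p : {poly F}) : tofrac p \in laurent_pred.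
Proof. by apply/laurentP; exists p, 0%N; rewrite expr0 rmorph1 divr1. Qed.

Definition laurent_poly (p : {poly F}) : laurent := Laurent (laurent_polyP p).

Lemma laurent_poly_is_zmod_morphism : zmod_morphism laurent_poly.
Proof. by move=> p r; apply: val_inj; rewrite [RHS]rmorphB; exact: rmorphB. Qed.
Lemma laurent_poly_is_monoid_morphism : monoid_morphism laurent_poly.
Proof.
split; first by apply: val_inj; rewrite [RHS]rmorph1; exact: rmorph1.
by move=> p r; apply: val_inj; rewrite [RHS]rmorphM; exact: rmorphM.
Qed.
HB.instance Definition _ := GRing.isZmodMorphism.Build {poly F} laurent
  laurent_poly laurent_poly_is_zmod_morphism.
HB.instance Definition _ := GRing.isMonoidMorphism.Build {poly F} laurent
  laurent_poly laurent_poly_is_monoid_morphism.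

Definition laurentq : laurent := laurent_poly 'X.

Lemma laurentq_unit : laurentq \is a GRing.unit.
Proof.
apply/andP; split; first by have:= tofracX_neq0 1; rewrite expr1.
by apply/laurentP; exists 1, 1%N; rewrite rmorph1 div1r expr1.
Qed.

Lemma laurent_nat_unit d : d%:R != 0 :> F -> d%:R \is a @GRing.unit laurent.
Proof.
move=> d0; apply/unitrP; exists (laurent_poly (d%:R^-1)%:P).
have -> : d%:R = laurent_poly d%:R%:P by rewrite polyC_natr rmorph_nat.
by rewrite -!rmorphM divff // mulVf // !rmorph1.
Qed.

End Laurent.

(* The quotient of a ring by a two-sided ideal I, not assumed proper. *)
HB.mixin Record isTwoSided (R : nzRingType) (S : R -> bool) := {
  twosided_mull : forall a x : R, S x -> S (a * x);
  twosided_mulr : forall a x : R, S x -> S (x * a)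
}.
HB.structure Definition TwoSidedIdeal (R : nzRingType) :=
  {S of GRing.ZmodClosed R S & isTwoSided R S}.

Section RingQuot.
Variables (R : nzRingType) (I : TwoSidedIdeal.type R).

Definition ring_quot : Type := (Quotient.quot I).

HB.instance Definition _ := GRing.Zmodule.on ring_quot.
HB.instance Definition _ : EqQuotient R (Quotient.equiv I) ring_quot :=
  EqQuotient.on ring_quot.
HB.instance Definition _ := isZmodQuotient.Build R (Quotient.equiv I) 0 -%R +%R
  ring_quot (@pi_zeror _ _ _ _ _ (Quotient.quot I)) (@pi_oppr _ _ _ _ _ (Quotient.quot I))
  (@pi_addr _ _ _ _ _ (Quotient.quot I)).

Lemma ring_quot_eq (x y : R) : (\pi_ring_quot x == \pi_ring_quot y) = (x - y \in I).
Proof. by rewrite Quotient.idealrBE. Qed.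

Definition ring_quot_one : ring_quot := \pi_ring_quot 1.
Definition ring_quot_mul : ring_quot -> ring_quot -> ring_quot :=
  locked (fun x y => \pi_ring_quot (repr x * repr y)).

Lemma pi_ring_quot_mul x y :
  ring_quot_mul (\pi_ring_quot x) (\pi_ring_quot y) = \pi_ring_quot (x * y).
Proof.
rewrite /ring_quot_mul -lock; have reprB z : z - repr (\pi_ring_quot z) \in I.
  by rewrite -ring_quot_eq reprK.
apply/esym/eqP; rewrite ring_quot_eq.
set x' := repr _; set y' := repr _.
have -> : x * y - x' * y' = (x - x') * y + x' * (y - y').
  by rewrite mulrBl mulrBr addrA subrK.
by rewrite rpredD //; [apply: twosided_mulr|apply: twosided_mull]; apply: reprB.
Qed.

Lemma ring_quot_mulA : associative ring_quot_mul.
Proof.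
by elim/quotW=> x; elim/quotW=> y; elim/quotW=> z;
  rewrite !pi_ring_quot_mul mulrA.
Qed.
Lemma ring_quot_mul1q : left_id ring_quot_one ring_quot_mul.
Proof. by elim/quotW=> x; rewrite pi_ring_quot_mul mul1r. Qed.
Lemma ring_quot_mulq1 : right_id ring_quot_one ring_quot_mul.
Proof. by elim/quotW=> x; rewrite pi_ring_quot_mul mulr1. Qed.
Lemma ring_quot_mulDl : left_distributive ring_quot_mul +%R.
Proof.
by elim/quotW=> x; elim/quotW=> y; elim/quotW=> z;
  rewrite -raddfD !pi_ring_quot_mul mulrDl raddfD.
Qed.
Lemma ring_quot_mulDr : right_distributive ring_quot_mul +%R.
Proof.
by elim/quotW=> x; elim/quotW=> y; elim/quotW=> z;
  rewrite -raddfD !pi_ring_quot_mul mulrDr raddfD.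
Qed.

HB.instance Definition _ := GRing.Zmodule_isPzRing.Build ring_quot
  ring_quot_mulA ring_quot_mul1q ring_quot_mulq1 ring_quot_mulDl ring_quot_mulDr.

Definition ring_pi (x : R) : ring_quot := \pi_ring_quot x.

Lemma ring_pi_is_zmod_morphism : zmod_morphism ring_pi.
Proof. by move=> x y; rewrite /ring_pi raddfB. Qed.
Lemma ring_pi_is_monoid_morphism : monoid_morphism ring_pi.
Proof. by split=> // x y; rewrite /ring_pi -pi_ring_quot_mul. Qed.
HB.instance Definition _ := GRing.isZmodMorphism.Build R ring_quot ring_pi
  ring_pi_is_zmod_morphism.
HB.instance Definition _ := GRing.isMonoidMorphism.Build R ring_quot ring_pi
  ring_pi_is_monoid_morphism.

Lemma ring_piW (P : ring_quot -> Prop) : (forall x, P (ring_pi x)) -> forall y, P y.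
Proof. by move=> Ppi; elim/quotW. Qed.

Lemma ring_pi_eq (x y : R) : ring_pi x = ring_pi y <-> x - y \in I.
Proof. by rewrite -ring_quot_eq; split=> /eqP. Qed.

End RingQuot.

(* Free associative algebras A<X> are {malg A[{fmonom X}]}; the library stops
   at the left algebra structure. *)
Notation "{ 'freealg' A [ X ] }" := {malg A[{fmonom X}]}
  (at level 0, A, X at level 2, format "{ 'freealg'  A [ X ] }") : type_scope.

Section FreeAlg.
Variables (A : comNzRingType) (X : choiceType).
Implicit Types (x y : {freealg A[X]}) (a : A).

Definition freegen (i : X) : {freealg A[X]} := << fmu i >>.

Lemma freealg_scalerAr a x y : a *: (x * y) = x * (a *: y).
Proof.
have Ca : x * a%:MP = a%:MP * x.
  rewrite !malgM_def fgmulgU fgmulUg; apply: eq_bigr => k _.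
  by rewrite mulm1 mul1m mulrC.
by rewrite -!mul_malgC mulrA -Ca mulrA.
Qed.

Variables (S : comNzRingType) (v : X -> S).

Definition freemon_eval (m : {fmonom X}) : S := \prod_(i <- (m : seq X)) v i.

Lemma freemon_eval_mmorphism : mmorphism freemon_eval.
Proof.
split=> [m n|]; first by rewrite /freemon_eval fmM big_cat.
by rewrite /freemon_eval fm1 big_nil.
Qed.
HB.instance Definition _ := monalg.isMultiplicative.Build {fmonom X} S
  freemon_eval freemon_eval_mmorphism.

End FreeAlg.

Section FreeEval.
Variables (A : comNzRingType) (X : choiceType) (v : X -> A).

Definition free_eval : {freealg A[X]} -> A := mmap idfun (freemon_eval v).
HB.instance Definition _ := GRing.RMorphism.on free_eval.

Lemma free_evalZ a x : free_eval (a *: x) = a * free_eval x.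
Proof. exact: mmapZ. Qed.

Lemma free_eval_gen i : free_eval (freegen A i) = v i.
Proof.
by rewrite /free_eval /freegen mmapU mul1r /= /freemon_eval fmU big_seq1.
Qed.
End FreeEval.

Section Presented.
Variables (A : comNzRingType) (X : choiceType) (rel : {freealg A[X]} -> Prop).

Inductive relator_ideal : {freealg A[X]} -> Prop :=
| RelatorGen x of rel x : relator_ideal x
| RelatorZero : relator_ideal 0
| RelatorAdd x y of relator_ideal x & relator_ideal y : relator_ideal (x + y)
| RelatorMull a x of relator_ideal x : relator_ideal (a * x)
| RelatorMulr a x of relator_ideal x : relator_ideal (x * a).

Definition relatorI : {pred {freealg A[X]}} := fun x => `[< relator_ideal x >].

Lemma relatorIP x : reflect (relator_ideal x) (x \in relatorI).
Proof. by rewrite unfold_in; apply: asboolP. Qed.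

Lemma relatorI_zmod_closed : zmod_closed relatorI.
Proof.
split=> [|x y /relatorIP Ix /relatorIP Iy]; apply/relatorIP.
  exact: RelatorZero.
by rewrite -mulN1r; apply: RelatorAdd => //; apply: RelatorMull.
Qed.
HB.instance Definition _ := GRing.isZmodClosed.Build {freealg A[X]} relatorI
  relatorI_zmod_closed.

Lemma relatorI_mull (a x : {freealg A[X]}) : relatorI x -> relatorI (a * x).
Proof. by move/relatorIP=> Ix; apply/relatorIP/RelatorMull. Qed.
Lemma relatorI_mulr (a x : {freealg A[X]}) : relatorI x -> relatorI (x * a).
Proof. by move/relatorIP=> Ix; apply/relatorIP/RelatorMulr. Qed.
HB.instance Definition _ := isTwoSided.Build {freealg A[X]} relatorI
  relatorI_mull relatorI_mulr.

(* The A-algebra generated by X subject to r = 0 for every r satisfying rel. *)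
Definition presented : Type := ring_quot relatorI.
HB.instance Definition _ := GRing.PzRing.on presented.

Definition presented_pi : {freealg A[X]} -> presented := @ring_pi _ relatorI.
HB.instance Definition _ := GRing.RMorphism.on presented_pi.

Lemma presentedW (P : presented -> Prop) :
  (forall x, P (presented_pi x)) -> forall y, P y.
Proof. exact: ring_piW. Qed.

Lemma presented_eq x y :
  presented_pi x = presented_pi y <-> relator_ideal (x - y).
Proof. by rewrite /presented_pi ring_pi_eq; split=> /relatorIP. Qed.

Definition presented_scale (a : A) (u : presented) : presented :=
  presented_pi (a%:A) * u.

Lemma presented_scale_pi a x : presented_scale a (presented_pi x) = presented_pi (a *: x).
Proof. by rewrite /presented_scale -rmorphM -scalerAl mul1r. Qed.

Lemma presented_scalerA a b u :
  presented_scale a (presented_scale b u) = presented_scale (a * b) u.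
Proof.
by rewrite /presented_scale mulrA -rmorphM -scalerAl mul1r scalerA.
Qed.
Lemma presented_scale1r : left_id 1 presented_scale.
Proof. by move=> u; rewrite /presented_scale scale1r rmorph1 mul1r. Qed.
Lemma presented_scalerDr : right_distributive presented_scale +%R.
Proof. by move=> a u v; rewrite /presented_scale mulrDr. Qed.
Lemma presented_scalerDl u : {morph presented_scale^~ u : a b / a + b}.
Proof. by move=> a b; rewrite /presented_scale scalerDl rmorphD mulrDl. Qed.
HB.instance Definition _ := GRing.Zmodule_isLmodule.Build A presented
  presented_scalerA presented_scale1r presented_scalerDr presented_scalerDl.

Lemma presented_piZ a x : presented_pi (a *: x) = a *: presented_pi x.
Proof. by rewrite -presented_scale_pi. Qed.

Lemma presented_scalerAl (a : A) (u v : presented) : a *: (u * v) = (a *: u) * v.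
Proof. exact: mulrA. Qed.
Lemma presented_scalerAr (a : A) (u v : presented) : a *: (u * v) = u * (a *: v).
Proof.
elim/presentedW: u => x; elim/presentedW: v => y.
by rewrite -(presented_piZ a y) -!rmorphM -(presented_piZ a (x * y)) freealg_scalerAr.
Qed.

End Presented.

Section YokonumaHecke.
Variables (A : comUnitRingType) (q : A) (d n : nat).

(* Indices are 0-based: inl i is g_(i+1), inr j is t_(j+1), and ord_left i,
   ord_right i are the two points exchanged by s_(i+1). *)
Definition ygen : Type := ('I_n.-1 + 'I_n)%type.
HB.instance Definition _ := Choice.on ygen.

Let g (i : 'I_n.-1) : {freealg A[ygen]} := freegen A (inl i : ygen).
Let t (j : 'I_n) : {freealg A[ygen]} := freegen A (inr j : ygen).

Lemma ord_right_subproof (i : 'I_n.-1) : (i.+1 < n)%N.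
Proof. by rewrite -ltn_predRL. Qed.
Definition ord_left (i : 'I_n.-1) : 'I_n := widen_ord (leq_pred n) i.
Definition ord_right (i : 'I_n.-1) : 'I_n := Ordinal (ord_right_subproof i).

(* For 0 <= s < d the inverse power t^(-s) is written t^(d - s), since t^d = 1. *)
Definition yok_e (i : 'I_n.-1) : {freealg A[ygen]} :=
  (d%:R : A)^-1 *:
    \sum_(0 <= s < d) t (ord_left i) ^+ s * t (ord_right i) ^+ (d - s).

Inductive yok_rel : {freealg A[ygen]} -> Prop :=
| YokComm (i j : 'I_n.-1) of (i.+1 < j)%N || (j.+1 < i)%N : yok_rel (g i * g j - g j * g i)
| YokBraid (i j : 'I_n.-1) of j = i.+1 :> nat :
    yok_rel (g i * g j * g i - g j * g i * g j)
| YokTT i j : yok_rel (t i * t j - t j * t i)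
| YokTG i j :
    yok_rel (t j * g i - g i * t (tperm (ord_left i) (ord_right i) j))
| YokOrder j : yok_rel (t j ^+ d - 1)
| YokQuad i :
    yok_rel (g i ^+ 2
             - (1 + (q - q^-1) *: (yok_e i * g i))).

Lemma yok_ideal_vanish (chi : {rmorphism {freealg A[ygen]} -> A}) (c : A) :
  (forall a x, chi (a *: x) = a * chi x) ->
  (forall i, chi (g i) = c) -> (forall j, chi (t j) = 1) ->
  c ^+ 2 = 1 + (q - q^-1) * (d%:R^-1 * d%:R * c) ->
  forall x, relator_ideal yok_rel x -> chi x = 0.
Proof.
move=> chiZ chig chit c2.
have chi_e i : chi (yok_e i) = d%:R^-1 * d%:R.
  rewrite chiZ rmorph_sum; congr (_ * _).
  transitivity (\sum_(0 <= s < d) (1 : A)); last by rewrite sumr_const_nat subn0.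
  by apply: eq_bigr => s _; rewrite rmorphM !rmorphXn /= !chit !expr1n mulr1.
move=> x; elim=> {x}[x rx||x y _ x0 _ y0|a x _ x0|a x _ x0];
  rewrite ?rmorph0 ?rmorphD ?rmorphM /= ?x0 ?y0 ?addr0 ?mulr0 ?mul0r //.
have chiB y z : chi y = chi z -> chi (y - z) = 0 by rewrite rmorphB => ->; rewrite subrr.
have chiM y z b1 b2 : chi y = b1 -> chi z = b2 -> chi (y * z) = b1 * b2.
  by rewrite rmorphM => -> ->.
have chiX y b m : chi y = b -> chi (y ^+ m) = b ^+ m by rewrite rmorphXn => ->.
case: rx => [i j _|i j _|i j|i j|j|i]; apply: chiB.
- exact: etrans (chiM _ _ _ _ (chig i) (chig j))
                (esym (chiM _ _ _ _ (chig j) (chig i))).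
- exact: etrans (chiM _ _ _ _ (chiM _ _ _ _ (chig i) (chig j)) (chig i))
          (esym (chiM _ _ _ _ (chiM _ _ _ _ (chig j) (chig i)) (chig j))).
- exact: etrans (chiM _ _ _ _ (chit i) (chit j))
                (esym (chiM _ _ _ _ (chit j) (chit i))).
- exact: etrans (chiM _ _ _ _ (chit j) (chig i))
          (etrans (mulrC _ _) (esym (chiM _ _ _ _ (chig i) (chit _)))).
- by rewrite (chiX _ _ d (chit j)) expr1n rmorph1.
rewrite (chiX _ _ 2 (chig i)) c2 rmorphD rmorph1 chiZ.
by rewrite (chiM _ _ _ _ (chi_e i) (chig i)).
Qed.
End YokonumaHecke.

Section GenericYokonumaHecke.
Variables (F : fieldType) (d n : nat).
Let rel := @yok_rel (laurent F) (laurentq F) d n.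

Definition yokonuma : Type := presented rel.
HB.instance Definition _ := GRing.PzRing.on yokonuma.
HB.instance Definition _ := GRing.Lmodule.on yokonuma.

Lemma yokonuma_character : exists chi : yokonuma -> laurent F,
  [/\ chi 1 = 1, {morph chi : u v / u + v} & forall a u, chi (a *: u) = a * chi u].
Proof.
pose c : laurent F := if d%:R == 0 :> laurent F then 1 else laurentq F.
pose ev := @free_eval (laurent F) (ygen n) (fun x => if x is inl _ then c else 1).
have ev0 x : relator_ideal rel x -> ev x = 0.
  apply: (yok_ideal_vanish (chi := ev) (c := c)) => [a y|i|j|].
  - exact: free_evalZ.
  - exact: free_eval_gen.
  - exact: free_eval_gen.
  rewrite /c; case: ifP => [/eqP->|/negbT d0].
    by rewrite mulr0 mul0r mulr0 addr0 expr1n.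
  have ud : (d%:R : laurent F) \is a GRing.unit.
    apply: laurent_nat_unit; apply: contraNneq d0 => d0.
    by rewrite -(rmorph_nat (@laurent_poly F)) -polyC_natr d0 !rmorph0.
  by rewrite mulVr // mul1r mulrBl mulVr ?laurentq_unit // expr2 addrC subrK.
pose chi (u : yokonuma) := ev (repr (u : presented rel)).
have chi_pi x : chi (presented_pi rel x) = ev x.
  apply/eqP; rewrite -subr_eq0 -rmorphB; apply/eqP/ev0/presented_eq.
  exact: reprK.
exists chi; split.
- by transitivity (ev 1); [rewrite -chi_pi rmorph1|apply: rmorph1].
- elim/presentedW=> x; elim/presentedW=> y.
  by rewrite -(rmorphD (presented_pi rel)) !chi_pi; exact: rmorphD.
- move=> a; elim/presentedW=> x.
  by rewrite -[a *: _]presented_piZ !chi_pi; exact: free_evalZ.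
Qed.

Lemma yokonuma_oner_neq0 : 1 != 0 :> yokonuma.
Proof.
have [c [c1 cD _]] := yokonuma_character.
apply/eqP=> e; have c0 : c 0 = 0 by apply: (addrI (c 0)); rewrite -cD !addr0.
by have /eqP := c1; rewrite e c0 eq_sym oner_eq0.
Qed.
HB.instance Definition _ :=
  GRing.PzSemiRing_isNonZero.Build yokonuma yokonuma_oner_neq0.
HB.instance Definition _ := GRing.Lmodule_isLalgebra.Build (laurent F) yokonuma
  (@presented_scalerAl _ _ rel).
HB.instance Definition _ := GRing.Lalgebra_isAlgebra.Build (laurent F) yokonuma
  (@presented_scalerAr _ _ rel).

End GenericYokonumaHecke.

(* {malg int[T]} is the free abelian group on T. *)
Section FreeAbelian.
Variable T : choiceType.
Implicit Type g : {malg int[T]}.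

Lemma zmonom_scale (z : int) (k : T) : << z *g k >> = << k >> *~ z.
Proof. by rewrite -(raddfMz (mkmalgU k)) intz. Qed.

Lemma zfree_ind (P : {malg int[T]} -> Prop) :
  P 0 -> (forall g1 g2, P g1 -> P g2 -> P (g1 - g2)) ->
  (forall k, P << k >>) -> forall g, P g.
Proof.
move=> P0 PB PU.
have PN g : P g -> P (- g) by rewrite -sub0r; apply: PB.
have PD g1 g2 : P g1 -> P g2 -> P (g1 + g2).
  by move=> P1 P2; rewrite -[g2]opprK; apply/PB/PN.
have PMn g m : P g -> P (g *+ m).
  by move=> Pg; elim: m => [|m IH]; rewrite ?mulr0n // mulrS; apply: PD.
move=> g; rewrite [g]monalgE; elim/big_ind: _ => // k _.
rewrite zmonom_scale; case: (g@_k) => m; first exact: PMn.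
by rewrite NegzE mulrNz; apply/PN/PMn.
Qed.

Lemma zfree_ext (V : zmodType) (f1 f2 : {additive {malg int[T]} -> V}) :
  (forall k, f1 << k >> = f2 << k >>) -> f1 =1 f2.
Proof.
move=> f12; elim/zfree_ind => [|g1 g2 e1 e2|//]; first by rewrite !raddf0.
by rewrite !raddfB e1 e2.
Qed.

Variables (V : zmodType) (h : T -> V).

Definition zlift g : V := \sum_(k <- msupp g) h k *~ g@_k.

Lemma zliftEw (E : {fset T}) g : fsubset (msupp g) E ->
  zlift g = \sum_(k <- E) h k *~ g@_k.
Proof.
by move=> le; rewrite [LHS](big_fset_incl _ le) => //= k _ /mcoeff_outdom ->.
Qed.

Lemma zlift_is_zmod_morphism : zmod_morphism zlift.
Proof.
move=> g1 g2; rewrite !(@zliftEw (fsetU (msupp g1) (msupp g2))) ?fsubsetUl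
  ?fsubsetUr ?msuppB_le // -sumrB.
by apply: eq_bigr => k _; rewrite mcoeffB mulrzBr.
Qed.
HB.instance Definition _ := GRing.isZmodMorphism.Build {malg int[T]} V zlift
  zlift_is_zmod_morphism.

Lemma zliftU k : zlift << k >> = h k.
Proof. by rewrite (zliftEw msuppU_le) big_seq_fset1 mcoeffUU. Qed.
End FreeAbelian.

(* Extension of scalars of an A-algebra Y along theta : A -> K: the tensor
   product K (x)_A Y is the free abelian group on K * Y modulo the subgroup
   generated by the bilinearity relators, with
   (c (x) y)(c' (x) y') = cc' (x) yy' and c' (c (x) y) = c'c (x) y. *)
Section Tensor.
Variables (A K : comNzRingType) (theta : {rmorphism A -> K}) (Y : algType A).

Definition tfree : Type := {malg int[(K * Y)%type]}.
HB.instance Definition _ := GRing.Zmodule.on tfree.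

Definition tgen (c : K) (y : Y) : tfree := << (c, y) >>.

Definition tmul (g1 g2 : tfree) : tfree :=
  zlift (fun k1 : K * Y =>
    zlift (fun k2 : K * Y => tgen (k1.1 * k2.1) (k1.2 * k2.2)) g2) g1.

Lemma tfree_ind (P : tfree -> Prop) :
  P 0 -> (forall g1 g2, P g1 -> P g2 -> P (g1 - g2)) ->
  (forall c y, P (tgen c y)) -> forall g, P g.
Proof. by move=> P0 PB PU; apply: zfree_ind => // -[c y]; apply: PU. Qed.

Lemma tmulBl g1 g2 g : tmul (g1 - g2) g = tmul g1 g - tmul g2 g.
Proof. exact: raddfB. Qed.
Lemma tmul0g g : tmul 0 g = 0.
Proof. exact: raddf0. Qed.
Lemma tmulBr g g1 g2 : tmul g (g1 - g2) = tmul g g1 - tmul g g2.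
Proof.
have tmulE x : tmul g x = \sum_(k1 <- msupp (g : {malg int[_]}))
    zlift (fun k2 : K * Y => tgen (k1.1 * k2.1) (k1.2 * k2.2)) x *~ mcoeff k1 g.
  by [].
by rewrite !tmulE -sumrB; apply: eq_bigr => k _; rewrite -mulrzBl raddfB.
Qed.
Lemma tmulg0 g : tmul g 0 = 0.
Proof. by have := tmulBr g 0 0; rewrite !subrr. Qed.
Lemma tmulUU c1 y1 c2 y2 :
  tmul (tgen c1 y1) (tgen c2 y2) = tgen (c1 * c2) (y1 * y2).
Proof. by rewrite /tmul !zliftU. Qed.

Lemma tmulDl : left_distributive tmul +%R.
Proof. by move=> g1 g2 g; rewrite -{1}[g2]opprK -[- g2]sub0r !tmulBl tmul0g sub0r opprK. Qed.
Lemma tmulDr : right_distributive tmul +%R.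
Proof. by move=> g g1 g2; rewrite -{1}[g2]opprK -[- g2]sub0r !tmulBr tmulg0 sub0r opprK. Qed.
Lemma tmulA : associative tmul.
Proof.
move=> g1 g2 g3; elim/tfree_ind: g1 => [|g g' e e'|c1 y1].
- by rewrite !tmul0g.
- by rewrite !tmulBl e e'.
elim/tfree_ind: g2 => [|g g' e e'|c2 y2].
- by rewrite ?(tmul0g, tmulg0).
- by rewrite !(tmulBl, tmulBr) e e'.
elim/tfree_ind: g3 => [|g g' e e'|c3 y3].
- by rewrite !tmulg0.
- by rewrite !tmulBr e e'.
by rewrite !tmulUU !mulrA.
Qed.
Lemma tmul1g : left_id (tgen 1 1) tmul.
Proof.
elim/tfree_ind => [|g g' e e'|c y]; first exact: tmulg0.
  by rewrite tmulBr e e'.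
by rewrite tmulUU !mul1r.
Qed.
Lemma tmulg1 : right_id (tgen 1 1) tmul.
Proof.
elim/tfree_ind => [|g g' e e'|c y]; first exact: tmul0g.
  by rewrite tmulBl e e'.
by rewrite tmulUU !mulr1.
Qed.
Lemma tfree1_neq0 : tgen 1 1 != 0.
Proof.
apply/eqP=> /(congr1 (zlift (fun=> 1 : int))); rewrite zliftU => /eqP.
by rewrite [zlift _ _]raddf0 oner_eq0.
Qed.
HB.instance Definition _ := GRing.Zmodule_isNzRing.Build tfree
  tmulA tmul1g tmulg1 tmulDl tmulDr tfree1_neq0.

Lemma tgenM c1 y1 c2 y2 :
  tgen c1 y1 * tgen c2 y2 = tgen (c1 * c2) (y1 * y2).
Proof. exact: tmulUU. Qed.

Inductive bilin_relator : tfree -> Prop :=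
| BilinDl c c' y : bilin_relator (tgen (c + c') y - tgen c y - tgen c' y)
| BilinDr c y y' : bilin_relator (tgen c (y + y') - tgen c y - tgen c y')
| BilinZ c a y : bilin_relator (tgen (c * theta a) y - tgen c (a *: y)).

Inductive bilin_subgroup : tfree -> Prop :=
| BilinGen x of bilin_relator x : bilin_subgroup x
| BilinZero : bilin_subgroup 0
| BilinSub x y of bilin_subgroup x & bilin_subgroup y : bilin_subgroup (x - y).

Definition bilinI : {pred tfree} := fun x => `[< bilin_subgroup x >].

Lemma bilinIP x : reflect (bilin_subgroup x) (x \in bilinI).
Proof. by rewrite unfold_in; apply: asboolP. Qed.

Lemma bilinI_zmod_closed : zmod_closed bilinI.
Proof.
split=> [|x y /bilinIP Ix /bilinIP Iy]; apply/bilinIP; first exact: BilinZero.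
exact: BilinSub.
Qed.
HB.instance Definition _ := GRing.isZmodClosed.Build tfree bilinI
  bilinI_zmod_closed.

Lemma bilin_mull (a x : tfree) : bilinI x -> bilinI (a * x).
Proof.
move/bilinIP=> Ix; apply/bilinIP; elim: Ix => {x}[x rx||x y _ Ix _ Iy].
- elim/tfree_ind: a => [|a b Ia Ib|k z].
  + by rewrite mul0r; apply: BilinZero.
  + by rewrite mulrBl; apply: BilinSub.
  apply: BilinGen; case: rx => [c c' y|c y y'|c b y];
    rewrite !mulrBr !tgenM ?mulrDr.
  + exact: BilinDl.
  + exact: BilinDr.
  + by rewrite mulrA -scalerAr; apply: BilinZ.
- by rewrite mulr0; apply: BilinZero.
- by rewrite mulrBr; apply: BilinSub.
Qed.
Lemma bilin_mulr (a x : tfree) : bilinI x -> bilinI (x * a).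
Proof.
move/bilinIP=> Ix; apply/bilinIP; elim: Ix => {x}[x rx||x y _ Ix _ Iy].
- elim/tfree_ind: a => [|a b Ia Ib|k z].
  + by rewrite mulr0; apply: BilinZero.
  + by rewrite mulrBr; apply: BilinSub.
  apply: BilinGen; case: rx => [c c' y|c y y'|c b y];
    rewrite !mulrBl !tgenM ?mulrDl.
  + exact: BilinDl.
  + exact: BilinDr.
  + by rewrite mulrAC -scalerAl; apply: BilinZ.
- by rewrite mul0r; apply: BilinZero.
- by rewrite mulrBl; apply: BilinSub.
Qed.
HB.instance Definition _ := isTwoSided.Build tfree bilinI bilin_mull bilin_mulr.

Definition tensor : Type := ring_quot bilinI.
HB.instance Definition _ := GRing.PzRing.on tensor.

Definition tensor_pi : tfree -> tensor := @ring_pi _ bilinI.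
HB.instance Definition _ := GRing.RMorphism.on tensor_pi.

Definition tens (c : K) (y : Y) : tensor := tensor_pi (tgen c y).

Lemma tensor_eq x y : tensor_pi x = tensor_pi y <-> bilin_subgroup (x - y).
Proof. by rewrite /tensor_pi ring_pi_eq; split=> /bilinIP. Qed.

Lemma tensor_ind (P : tensor -> Prop) :
  P 0 -> (forall u v, P u -> P v -> P (u - v)) ->
  (forall c y, P (tens c y)) -> forall u, P u.
Proof.
move=> P0 PB PU; apply: ring_piW; elim/tfree_ind => [|x y Px Py|//].
  by rewrite raddf0.
by rewrite raddfB; apply: PB.
Qed.

Lemma tensDl c c' y : tens (c + c') y = tens c y + tens c' y.
Proof.
rewrite /tens -raddfD; apply/tensor_eq.
by rewrite opprD addrA; apply/BilinGen/BilinDl.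
Qed.
Lemma tensDr c y y' : tens c (y + y') = tens c y + tens c y'.
Proof.
rewrite /tens -raddfD; apply/tensor_eq.
by rewrite opprD addrA; apply/BilinGen/BilinDr.
Qed.
Lemma tensZ c a y : tens (c * theta a) y = tens c (a *: y).
Proof. by apply/tensor_eq/BilinGen/BilinZ. Qed.
Lemma tensM c c' y y' : tens c y * tens c' y' = tens (c * c') (y * y').
Proof. by rewrite /tens -tgenM [RHS]rmorphM. Qed.
Lemma tens11 : tens 1 1 = 1.
Proof. exact: rmorph1 tensor_pi. Qed.

Definition tensor_scale (c : K) (u : tensor) : tensor := tens c 1 * u.

Lemma tensor_scalerA a b u :
  tensor_scale a (tensor_scale b u) = tensor_scale (a * b) u.
Proof. by rewrite /tensor_scale mulrA tensM mulr1. Qed.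
Lemma tensor_scale1r : left_id 1 tensor_scale.
Proof. by move=> u; rewrite /tensor_scale tens11 mul1r. Qed.
Lemma tensor_scalerDr : right_distributive tensor_scale +%R.
Proof. by move=> a u v; apply: mulrDr. Qed.
Lemma tensor_scalerDl u : {morph tensor_scale^~ u : a b / a + b}.
Proof. by move=> a b; rewrite /tensor_scale tensDl mulrDl. Qed.
HB.instance Definition _ := GRing.Zmodule_isLmodule.Build K tensor
  tensor_scalerA tensor_scale1r tensor_scalerDr tensor_scalerDl.

Lemma tensor_scaleE c c' y : c *: tens c' y = tens (c * c') y.
Proof. by rewrite [LHS]tensM mul1r. Qed.
Lemma tensor_scalerAl (c : K) (u v : tensor) : c *: (u * v) = (c *: u) * v.
Proof. exact: mulrA. Qed.
Lemma tensor_scalerAr (c : K) (u v : tensor) : c *: (u * v) = u * (c *: v).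
Proof.
have Cc w : tens c 1 * w = w * tens c 1.
  elim/tensor_ind: w => [|w w' e e'|c' y]; rewrite ?(mul0r, mulr0) //.
    by rewrite mulrBl mulrBr e e'.
  by rewrite !tensM mul1r mulr1 mulrC.
by rewrite -[LHS]/(tens c 1 * (u * v)) mulrA Cc -mulrA.
Qed.

Lemma tensor_oner_neq0 (chi : Y -> A) :
  chi 1 = 1 -> {morph chi : y y' / y + y'} ->
  (forall a y, chi (a *: y) = a * chi y) -> 1 != 0 :> tensor.
Proof.
move=> chi1 chiD chiZ.
pose f := zlift (fun k : K * Y => k.1 * theta (chi k.2)).
have fB (x y : tfree) : f (x - y) = f x - f y by apply: raddfB.
have f0 x : bilin_subgroup x -> f x = 0.
  elim=> {x}[x rx||x y _ x0 _ y0]; last by rewrite fB x0 y0 subr0.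
    case: rx => [c c' y|c y y'|c a y]; rewrite !fB /f !zliftU /=.
    - by rewrite mulrDl addrAC addrK subrr.
    - by rewrite chiD rmorphD mulrDr addrAC addrK subrr.
    - by rewrite chiZ rmorphM mulrA subrr.
  exact: raddf0.
rewrite -tens11 -[0](raddf0 tensor_pi); apply/eqP => /tensor_eq /f0.
by rewrite subr0 /f zliftU /= chi1 rmorph1 mulr1 => /eqP; rewrite oner_eq0.
Qed.

End Tensor.

Section SpecialisedYokonumaHecke.
Variables (F : fieldType) (K : comNzRingType).
Variables (theta : {rmorphism laurent F -> K}) (d n : nat).

Definition yokonuma_spec : Type := tensor theta (yokonuma F d n).
HB.instance Definition _ := GRing.PzRing.on yokonuma_spec.
HB.instance Definition _ := GRing.Lmodule.on yokonuma_spec.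

Lemma yokonuma_spec_oner_neq0 : 1 != 0 :> yokonuma_spec.
Proof.
have [chi [chi1 chiD chiZ]] := yokonuma_character F d n.
exact: tensor_oner_neq0 chi1 chiD chiZ.
Qed.
HB.instance Definition _ :=
  GRing.PzSemiRing_isNonZero.Build yokonuma_spec yokonuma_spec_oner_neq0.
HB.instance Definition _ := GRing.Lmodule_isLalgebra.Build K yokonuma_spec
  (@tensor_scalerAl _ _ theta (yokonuma F d n)).
HB.instance Definition _ := GRing.Lalgebra_isAlgebra.Build K yokonuma_spec
  (@tensor_scalerAr _ _ theta (yokonuma F d n)).

End SpecialisedYokonumaHecke.

Section Semisimplicity.
Variables (K : fieldType) (B : algType K).

Definition zero_sub (V : lmodType B) (S : {pred V}) : Prop :=
  forall v, v \in S -> v = 0.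

Definition simple_sub (V : lmodType B) (S : {pred V}) : Prop :=
  [/\ submod_closed S, ~ zero_sub S &
      forall T : {pred V}, submod_closed T -> {subset T <= S} ->
        zero_sub T \/ {subset S <= T}].

Definition simple_module (V : lmodType B) : Prop := simple_sub (predT : {pred V}).

(* V is the sum of its simple submodules. *)
Definition semisimple_module (V : lmodType B) : Prop :=
  forall v : V, exists s : seq V,
    v = \sum_(u <- s) u /\
    forall u, u \in s -> exists2 S : {pred V}, simple_sub S & u \in S.

Definition semisimple_algebra : Prop := semisimple_module (B^o : lmodType B).

(* End_B(V) = K for every simple B-module V. *)
Definition split_algebra : Prop :=
  forall V : lmodType B, simple_module V ->
    forall f : {linear V -> V}, exists c : K, forall v, f v = c%:A *: v.

Definition split_semisimple : Prop := semisimple_algebra /\ split_algebra.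

End Semisimplicity.

Definition poincare_poly (F : fieldType) (n : nat) : laurent F :=
  \prod_(1 <= m < n.+1) \sum_(0 <= k < m) laurentq F ^+ (2 * k).

(* Main.v *)
Require Import Defs.
From HB Require Import structures.
From mathcomp Require Import all_boot all_order all_algebra all_fingroup.
From mathcomp Require Import separable cyclotomic.
From mathcomp Require Import zify ring boolp functions reals complex.
From mathcomp Require Import ring_quotient generic_quotient finmap monalg.

(** The argument runs on Jucys--Murphy elements: L_0 = 0 and
    L_(k+1) = g_k L_k g_k + e_k g_k. Together with the t_j they commute, and
    g_k exchanges L_k and L_(k+1) up to a correction that appears only when the
    eigenvalues of t_k and t_(k+1) (the colours) agree.

    Assume first that theta(P) is non-zero, so that every quantum integer up to
    n is non-zero. The expected eigenvalues of the L_k are the contents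
    kappa(c) of the boxes of multipartitions, where
    kappa(c) = q + q^3 + ... + q^(2c-1) for c >= 0, and the hypothesis makes
    kappa injective on contents at distance at most n ([content_inj]). A joint
    eigenvector of the t_j and L_j has a weight: a sequence of letters
    (colour, content). A sequence is valid when it adds boxes one after the
    other to a multipartition, one component per colour; a component is
    encoded by its Maya diagram, in which adding a box of content
    c moves a particle from c - 1 to c. The main step ([jm_splits]) shows, by
    strong induction on k, that on a vector of valid weight of length k the
    element L_k is annihilated by a product of distinct factors
    L_k - kappa(c), with c addable. The intertwiner g_k - rho exchanges two
    letters of a weight; it turns the polynomial identity for L_k into one for
    L_(k+1), up to a kernel on which L_(k+1) satisfies an explicit cubic, and
    the roots that would give an invalid sequence are excluded by the braid
    relation. Hence every vector of every module is a sum of vectors of valid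
    weight ([wt_split]).

    A weight has multiplicity one in the submodule generated by a vector v of
    that weight ([generated_multiplicity]): this submodule is filtered by the
    spans of v under g_0, ..., g_(k-1), and vectors whose weights differ in a
    letter are independent. The intertwiners between letters of different
    colours, or of contents that are neither equal nor on neighbouring
    diagonals, are invertible, and the vectors they produce from v span the
    generated submodule; so a submodule of it contains,
    with any non-zero vector, the vector v itself ([generated_simple]).
    Therefore weight vectors generate simple modules, the algebra is a sum of
    such left ideals, and an endomorphism of a simple module preserves a weight
    space of dimension one, whence it is a scalar.

    For the converse, the symmetriser X, the sum of the q^(length w) g_w times
    the projection on the trivial character of the t_j, satisfies
    g_i X = q X and t_j X = X, hence X X = theta(P) X, and it spans a left
    ideal. If theta(P) = 0 and the algebra is semisimple, this nilpotent left
    ideal vanishes ([semisimple_no_nilpotent]). But X is non-zero: the algebra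
    acts on functions of words by sorting operators, and X sends the indicator
    function of the increasing word to a function with value 1 there
    ([symmetriser_delta]).

    The link with the presented algebra is its universal property, obtained by
    letting words in the free algebra act on a vector and passing to the
    quotient and to the tensor product ([orbit_map]). *)

Set Implicit Arguments.
Unset Strict Implicit.
Unset Printing Implicit Defensive.

Import Order.TTheory GRing.Theory Num.Theory.
Local Open Scope ring_scope.

(** * Sums of eigenvectors *)

Section LinearCombinations.
Variables (K : fieldType) (V : lmodType K) (u v w : V).

Definition lin3 (x : V) (a b c : K) := x = a *: u + b *: v + c *: w.

Lemma lin3_1 : lin3 u 1 0 0.
Proof. by rewrite /lin3 scale1r !scale0r !addr0. Qed.
Lemma lin3_2 : lin3 v 0 1 0.
Proof. by rewrite /lin3 scale1r !scale0r add0r addr0. Qed.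
Lemma lin3_3 : lin3 w 0 0 1.
Proof. by rewrite /lin3 scale1r !scale0r !add0r. Qed.
Lemma lin3_0 : lin3 0 0 0 0.
Proof. by rewrite /lin3 !scale0r !addr0. Qed.
Lemma lin3D x y a b c a' b' c' :
  lin3 x a b c -> lin3 y a' b' c' -> lin3 (x + y) (a + a') (b + b') (c + c').
Proof. by move=> -> ->; rewrite /lin3 !scalerDl addrACA; congr (_ + _); rewrite addrACA. Qed.
Lemma lin3N x a b c : lin3 x a b c -> lin3 (- x) (- a) (- b) (- c).
Proof. by move=> ->; rewrite /lin3 !scaleNr !opprD. Qed.
Lemma lin3Z k x a b c : lin3 x a b c -> lin3 (k *: x) (k * a) (k * b) (k * c).
Proof. by move=> ->; rewrite /lin3 !scalerDr !scalerA. Qed.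
Lemma lin3_eq x y a b c a' b' c' : lin3 x a b c -> lin3 y a' b' c' ->
  a = a' -> b = b' -> c = c' -> x = y.
Proof. by move=> -> -> -> -> ->. Qed.

End LinearCombinations.

(** [lincomb u v w] reduces an equality between linear combinations of [u], [v]
    and [w] to the three equalities of their coefficients. *)
Ltac lin3_collect := repeat first
  [ exact: lin3_1 | exact: lin3_2 | exact: lin3_3 | exact: lin3_0
  | apply: lin3D | apply: lin3N | apply: lin3Z ].
Ltac lincomb u v w := apply: (@lin3_eq _ _ u v w); [lin3_collect | lin3_collect | | | ].

Section Subspaces.
Variables (K : fieldType) (V : lmodType K).
Implicit Types (N Q : V -> Prop) (f : {linear V -> V}).

Definition subspace N := N 0 /\ forall a u v, N u -> N v -> N (a *: u + v).

Lemma subspaceZ N a u : subspace N -> N u -> N (a *: u).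
Proof. by case=> N0 NP Nu; rewrite -[_ *: _]addr0; apply: NP. Qed.
Lemma subspaceD N u v : subspace N -> N u -> N v -> N (u + v).
Proof. by case=> N0 NP Nu Nv; rewrite -[u]scale1r; apply: NP. Qed.
Lemma subspaceB N u v : subspace N -> N u -> N v -> N (u - v).
Proof. by case=> N0 NP Nu Nv; rewrite addrC -scaleN1r; apply: NP. Qed.
Lemma subspaceI N Q : subspace N -> subspace Q -> subspace (fun v => N v /\ Q v).
Proof.
by case=> N0 NP [Q0 QP]; split=> // a u v [Nu Qu] [Nv Qv]; split; auto.
Qed.
Lemma subspace_sum N (I : eqType) (s : seq I) (F : I -> V) :
  subspace N -> (forall i, i \in s -> N (F i)) -> N (\sum_(i <- s) F i).
Proof.
move=> sN NF; rewrite big_seq; elim/big_ind: _ => //; first by case: sN.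
by move=> u v; apply: subspaceD.
Qed.
Lemma subspace_eigen f a : subspace (fun v => f v = a *: v).
Proof.
split=> [|b u v fu fv]; first by rewrite linear0 scaler0.
by rewrite linearP fu fv scalerDr !scalerA mulrC.
Qed.

Inductive sums Q : V -> Prop :=
| Sums0 : sums Q 0
| SumsD u v of Q u & sums Q v : sums Q (u + v).

Lemma sums1 Q u : Q u -> sums Q u.
Proof. by move=> Qu; rewrite -[u]addr0; apply: SumsD => //; apply: Sums0. Qed.
Lemma sums_add Q u v : sums Q u -> sums Q v -> sums Q (u + v).
Proof.
by move=> Su Sv; elim: Su => [|x y Qx _ IH]; rewrite ?add0r // -addrA; apply: SumsD.
Qed.
Lemma sums_bind Q Q' v : sums Q v -> (forall u, Q u -> sums Q' u) -> sums Q' v.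
Proof.
by move=> Sv QQ'; elim: Sv => [|x y /QQ' Qx _ IH]; [apply: Sums0|apply: sums_add].
Qed.
Lemma sums_seq Q v : sums Q v ->
  exists s : seq V, v = \sum_(u <- s) u /\ forall u, u \in s -> Q u.
Proof.
elim=> [|x y Qx _ [s [-> Qs]]]; first by exists [::]; rewrite big_nil.
exists (x :: s); rewrite big_cons; split=> // u; rewrite inE => /predU1P[->//|].
exact: Qs.
Qed.

End Subspaces.

Section PolynomialAction.
Variables (K : fieldType) (V : lmodType K) (f : {linear V -> V}).
Implicit Types (p r : {poly K}) (v : V).

Definition pact p v : V := \sum_(i < size p) p`_i *: iter i f v.

Lemma pactEw N p v : (size p <= N)%N -> pact p v = \sum_(i < N) p`_i *: iter i f v.
Proof.
move=> le_pN; rewrite /pact (big_ord_widen N (fun i => p`_i *: iter i f v)) // big_mkcond.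
by apply: eq_bigr => i _; case: ltnP => // le_pi; rewrite nth_default // scale0r.
Qed.
Lemma pactDl p r v : pact (p + r) v = pact p v + pact r v.
Proof.
rewrite !(@pactEw (maxn (size p) (size r))) ?leq_maxl ?leq_maxr ?size_polyD //.
by rewrite -big_split; apply: eq_bigr => i _; rewrite coefD scalerDl.
Qed.
Lemma pactC c v : pact c%:P v = c *: v.
Proof. by rewrite (@pactEw 1) ?size_polyC_leq1 // big_ord1 coefC. Qed.
Lemma pactXM p v : pact (p * 'X) v = f (pact p v).
Proof.
rewrite (@pactEw (size p).+1); last first.
  by rewrite (leq_trans (size_polyMleq _ _)) // size_polyX addn2.
rewrite big_ord_recl coefMX scale0r add0r linear_sum.
by apply: eq_bigr => i _; rewrite coefMX linearZ.
Qed.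
Lemma pact_is_linear p : linear (pact p).
Proof.
elim/poly_ind: p => [|p c IH] a u v.
  by rewrite -polyC0 !pactC !scale0r scaler0 addr0.
rewrite !pactDl !pactXM !pactC IH linearP !scalerDr !scalerA [c * a]mulrC.
by rewrite addrACA.
Qed.
HB.instance Definition _ p := GRing.isLinear.Build K V V _ (pact p) (pact_is_linear p).

Lemma pactZl c p v : pact (c *: p) v = c *: pact p v.
Proof.
rewrite !(@pactEw (size p)) ?size_scale_leq // scaler_sumr.
by apply: eq_bigr => i _; rewrite coefZ scalerA.
Qed.
Lemma pactX v : pact 'X v = f v.
Proof. by rewrite -['X]mul1r pactXM pactC scale1r. Qed.
Lemma pactM p r v : pact (p * r) v = pact p (pact r v).
Proof.
elim/poly_ind: p => [|p c IH]; first by rewrite mul0r -polyC0 !pactC !scale0r.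
by rewrite mulrDl !pactDl pactXM mulrAC pactXM IH mul_polyC pactZl pactC.
Qed.
Lemma pactXsubC c v : pact ('X - c%:P) v = f v - c *: v.
Proof. by rewrite pactDl -polyCN pactX pactC scaleNr. Qed.
Lemma pact_eigen c p v : f v = c *: v -> pact p v = p.[c] *: v.
Proof.
move=> fv; elim/poly_ind: p => [|p a IH].
  by rewrite -polyC0 pactC hornerC.
by rewrite pactDl pactXM IH pactC linearZ /= fv scalerA -scalerDl !hornerE.
Qed.
Lemma pact_stable (N : V -> Prop) p v : subspace N -> (forall u, N u -> N (f u)) ->
  N v -> N (pact p v).
Proof.
move=> sN fN Nv; elim/poly_ind: p => [|p c IH].
  by rewrite -polyC0 pactC; apply: subspaceZ.
rewrite pactDl pactXM pactC; apply: subspaceD => //; first exact: fN.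
exact: subspaceZ.
Qed.

(** Lagrange interpolation, one root at a time: when [f v - c v] is a sum of
    eigenvectors for other eigenvalues [a], dividing each of them by [a - c]
    gives [w] such that [v - w] is an eigenvector for [c]. *)
Lemma eigen_split (s : seq K) (N : V -> Prop) v : uniq s -> subspace N ->
  (forall u, N u -> N (f u)) -> N v -> pact (\prod_(c <- s) ('X - c%:P)) v = 0 ->
  sums (fun u => N u /\ exists2 c, c \in s & f u = c *: u) v.
Proof.
elim: s v => [|c s IH] v /=.
  by rewrite big_nil => _ _ _ _; rewrite pactC scale1r => ->; apply: Sums0.
case/andP=> cs us sN fN Nv; rewrite big_cons mulrC pactM pactXsubC => p0.
have {}IH := IH _ us sN fN (subspaceB sN (fN v Nv) (subspaceZ c sN Nv)) p0.
have [w [w0 Sw fw]] : exists w, [/\ N w,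
    sums (fun u => N u /\ exists2 c, c \in s & f u = c *: u) w
    & f w - c *: w = f v - c *: v].
  elim: IH => [|x y [Nx [a a_s fx]] _ [w [Nw Sw fw]]].
    by exists 0; split; [case: sN|apply: Sums0|rewrite linear0 scaler0 subrr].
  have ac : a - c != 0 by rewrite subr_eq0; apply: contraNneq cs => <-.
  exists ((a - c)^-1 *: x + w); split.
  - by apply: subspaceD => //; apply: subspaceZ.
  - apply: SumsD => //; split; first exact: subspaceZ.
    by exists a; rewrite // linearZ /= fx !scalerA mulrC.
  - by rewrite linearD linearZ /= fx -fw; lincomb x w (f w); field.
rewrite -[v](subrK w); apply: SumsD.
  split; first exact: subspaceB.
  have fv : f v = f w - c *: w + c *: v by rewrite fw subrK.
  by exists c; rewrite ?mem_head // linearB fv; lincomb v w (f w); ring.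
apply: sums_bind Sw _ => u [Nu [a a_s fu]]; apply: sums1; split=> //.
by exists a; rewrite // inE a_s orbT.
Qed.
End PolynomialAction.

Section PolynomialActionTheory.
Variables (K : fieldType) (V : lmodType K).
Implicit Types (f h : {linear V -> V}).

Lemma pact_prod_cons (I : Type) (lam : I -> K) f i (s : seq I) v :
  pact f (\prod_(j <- i :: s) ('X - (lam j)%:P)) v =
  pact f (\prod_(j <- s) ('X - (lam j)%:P)) (f v - lam i *: v).
Proof. by rewrite big_cons mulrC pactM pactXsubC. Qed.

(** On [N], the operator [f - lam i] is injective when [lam i] is not an
    eigenvalue there, so its factor can be cancelled. *)
Lemma pact_prod_filter (I : eqType) (lam : I -> K) f (a : pred I) (s : seq I)
    (N : V -> Prop) v : subspace N ->
  (forall u, N u -> N (f u)) -> N v ->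
  pact f (\prod_(i <- s) ('X - (lam i)%:P)) v = 0 ->
  (forall i u, i \in s -> ~~ a i -> N u -> f u = lam i *: u -> u = 0) ->
  pact f (\prod_(i <- filter a s) ('X - (lam i)%:P)) v = 0.
Proof.
move=> sN fN; elim: s v => [|i s IH] v //= Nv.
have stab p u : N u -> N (pact f p u) by move=> Nu; apply: pact_stable.
move=> p0 noc; have noc' j u : j \in s -> ~~ a j -> N u -> f u = lam j *: u -> u = 0.
  by move=> js; apply: noc; rewrite inE js orbT.
case: ifP => ai.
  move: p0; rewrite !pact_prod_cons => p0; apply: IH => //.
  exact: subspaceB (fN _ Nv) (subspaceZ _ sN Nv).
apply: IH => //; apply: noc (mem_head _ _) (negbT ai) (stab _ _ Nv) _.
by apply/eqP; rewrite -subr_eq0 -pactXsubC -pactM; move: p0; rewrite big_cons => ->.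
Qed.

(** The product of the [f i - c], one for each term of the sum, kills the sum
    but multiplies [u] by a non-zero scalar. *)
Lemma eigen_independent (I : Type) (f : I -> {linear V -> V}) (lam : I -> K) u v :
  (forall i j w, f i (f j w) = f j (f i w)) -> (forall i, f i u = lam i *: u) ->
  sums (fun w => exists i c, c != lam i /\ f i w = c *: w) v -> u = v -> u = 0.
Proof.
move=> fC fu Sv uv; suff [h [c c0 [hu [hv _]]]] : exists h : {linear V -> V},
    exists2 c, c != 0 & h u = c *: u /\ h v = 0 /\ forall i w, f i (h w) = h (f i w).
  apply/eqP; rewrite -[_ == 0]orFb -(negbTE c0) -scaler_eq0 -hu uv hv eqxx //.
elim: Sv {uv} => [|x y [i [a [ai fx]]] _ [h [c c0 [hu [hy hC]]]]].
  by exists idfun, 1; rewrite ?oner_eq0 ?scale1r.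
exists (pact (f i) ('X - a%:P) \o h), (c * (lam i - a)).
  by rewrite mulf_neq0 // subr_eq0 eq_sym.
split; [|split] => /=.
- by rewrite hu pactXsubC linearZ /= fu; lincomb u u u; ring.
- by rewrite linearD hy addr0 pactXsubC hC fx linearZ /= subrr.
- by move=> j w; rewrite !pactXsubC linearB linearZ /= fC hC.
Qed.

End PolynomialActionTheory.

(** * Contents and Maya diagrams *)

Section Contents.
Variables (K : fieldType) (q : K).
Hypothesis q0 : q != 0.

(** The [q]-analogue of [c] that [jm] has as an eigenvalue; it is defined at
    [q^2 = 1] as well, where it is [q * c]. *)
Definition content (c : int) : K :=
  match c with
  | Posz m => \sum_(k < m) q ^+ (2 * k).+1
  | Negz m => - \sum_(k < m.+1) q ^- (2 * k).+1
  end.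

Lemma content0 : content 0 = 0.
Proof. by rewrite /= big_ord0. Qed.

Lemma contentS c : content (c + 1) = content c + q * q ^ (2 * c).
Proof.
have qE m : q ^ (2 * m%:Z) = q ^+ (2 * m) by rewrite -PoszM exprnP.
case: c => [m|[|m]].
- by rewrite -PoszD addn1 /= big_ord_recr qE -exprS.
- rewrite /= big_ord0 big_ord1 /= muln0 [q ^ _](_ : _ = q^-1 * q^-1) -?invfM //.
  by field.
have -> : Negz m.+1 + 1 = Negz m by lia.
rewrite /= [in RHS]big_ord_recr /=.
have -> : 2 * Negz m.+1 = - (2 * m.+2)%:Z by lia.
rewrite -exprnN.
rewrite opprD -addrA [X in _ + X](_ : _ = 0) ?addr0 //.
have -> : (2 * m.+2 = (2 * m.+1).+2)%N by lia.
by rewrite !exprS; field; rewrite expf_neq0.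
Qed.

Lemma content_prev c : content (c - 1) = content c - q^-1 * q ^ (2 * c).
Proof.
rewrite -[c](subrK 1); move: (c - 1) => b; rewrite addrK contentS.
rewrite mulrDr expfzDr // mulr1 [q ^ 2](_ : _ = q * q) //.
by field.
Qed.

(** Up to an affine change of variable, contents are the powers [q^(2c)] met in
    the usual normalisation of Jucys--Murphy elements. *)
Lemma content_affine c : 1 + (q - q^-1) * content c = q ^ (2 * c).
Proof.
elim/int_rect: c => [|m IH|m IH].
- by rewrite content0 mulr0 addr0 mulr0.
- rewrite intS [1 + m%:Z]addrC contentS mulrDr addrA IH mulrDr expfzDr // mulr1.
  by rewrite [q ^ 2](_ : _ = q * q) //; field.
- rewrite intS opprD [- 1 - _]addrC content_prev mulrBr addrA IH mulrBr expfzDr // mulr1.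
  by rewrite [q ^ -2](_ : _ = q^-1 * q^-1) -?invfM //; field.
Qed.

Lemma content_shift c m :
  content (c + m%:Z) = content c + q * q ^ (2 * c) * \sum_(0 <= k < m) q ^+ (2 * k).
Proof.
elim: m => [|m IH]; first by rewrite big_geq // mulr0 !addr0.
rewrite intS [1 + _]addrC addrA contentS IH big_nat_recr //= [in RHS]mulrDr addrA.
by congr (_ + _); rewrite mulrDr expfzDr // -mulrA; congr (_ * _).
Qed.

Variable n : nat.
Hypothesis qint_neq0 : forall m, (0 < m <= n)%N -> \sum_(0 <= k < m) q ^+ (2 * k) != 0.

Lemma content_inj c c' : `|c - c'| <= n%:Z -> content c = content c' -> c = c'.
Proof.
wlog le_cc' : c c' / c <= c'.
  move=> H; have [|/ltW] := leP c c'; first exact: H.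
  by move=> le cc' e; apply/esym/H; rewrite // distrC.
move=> le_n; have -> : c' = c + `|c' - c|%N%:Z by lia.
rewrite content_shift => /eqP; rewrite -subr_eq0 opprD addNKr oppr_eq0.
case: (posnP `|c' - c|%N) => [->|lt0]; first by rewrite addr0.
rewrite !mulf_eq0 (negbTE q0) expfz_eq0 (negbTE q0) andbF /=.
by rewrite (negbTE (qint_neq0 _)) //; lia.
Qed.
End Contents.

(** A multipartition is encoded by a particle configuration on the integers for
    each colour: the empty partition occupies the negative sites, and adding a
    box of content [c] moves a particle from [c - 1] to [c]. *)
Section MayaDiagrams.
Variable C : eqType.
Implicit Types (D : C -> int -> bool) (l : C * int) (s r : seq (C * int)).

Definition vacuum : C -> int -> bool := fun _ x => x < 0.
Definition jump D l : C -> int -> bool := fun z x =>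
  if z == l.1 then (x == l.2) || (x != l.2 - 1) && D z x else D z x.
Definition addable D l : bool := D l.1 (l.2 - 1) && ~~ D l.1 l.2.
Definition maya s := foldl jump vacuum s.
Fixpoint valid_from D s : bool :=
  if s is l :: s' then addable D l && valid_from (jump D l) s' else true.
Definition valid s := valid_from vacuum s.

Lemma maya_rcons s l : maya (rcons s l) = jump (maya s) l.
Proof. by rewrite /maya foldl_rcons. Qed.

Lemma valid_rcons s l : valid (rcons s l) = valid s && addable (maya s) l.
Proof.
rewrite /valid /maya; elim: s vacuum => [|k s IH] D /=; first by rewrite andbT.
by rewrite IH andbA.
Qed.

Lemma valid_cat s r : valid (s ++ r) -> valid s.
Proof.
elim/last_ind: r => [|r l IH]; first by rewrite cats0.
by rewrite -rcons_cat valid_rcons => /andP[/IH].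
Qed.

Lemma jump_other D l z x : (z != l.1) || (x != l.2) && (x != l.2 - 1) ->
  jump D l z x = D z x.
Proof. by rewrite /jump; case: eqP => //= _ /andP[/negbTE-> ->]. Qed.

(** Two addable corners of a partition are never on neighbouring diagonals. *)
Lemma addable_next D z c (e : int) : e \in [:: 1; -1] ->
  addable D (z, c) -> ~~ addable D (z, c + e).
Proof.
rewrite /addable /= !inE => /orP[]/eqP->; last by case/andP=> -> _; rewrite andbF.
by rewrite addrK => /andP[_ /negbTE->].
Qed.

Lemma addable_jump_same D z c : ~~ addable (jump D (z, c)) (z, c).
Proof. by rewrite /addable /jump /= !eqxx /= andbF. Qed.

(** Letters whose jumps involve disjoint sites, so that the boxes can be added
    in either order. *)
Definition apart (l k : C * int) : bool :=
  (l.1 != k.1) || [&& k.2 != l.2, k.2 != l.2 - 1 & k.2 != l.2 + 1].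

Lemma apart_sym l k : apart l k = apart k l.
Proof. by rewrite /apart eq_sym; case: eqP => //= _; lia. Qed.

Lemma addable_jump_other D l k : apart l k ->
  addable (jump D l) k = addable D k.
Proof.
rewrite /apart /addable => H; rewrite !jump_other //; move: H; rewrite eq_sym;
by case: (k.1 != l.1) => //=; lia.
Qed.

(** An occupied site can be beyond an empty one only by as many steps as
    particles have jumped. *)
Lemma maya_spread s z x y : valid s -> maya s z x -> ~~ maya s z y -> x - y <= (size s)%:Z.
Proof.
elim/last_ind: s x y => [|s l IH] x y.
  by rewrite /maya /= /vacuum => _; lia.
rewrite valid_rcons maya_rcons size_rcons /addable /jump.
case: l => w c /= /andP[vs /andP[c1 c0]].
case: eqP => [zw|_]; last by move=> Dx Dy; have := IH _ _ vs Dx Dy; lia.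
move: c1 c0; rewrite -zw negb_or negb_and negbK => c1 c0.
have IHs x' y' : maya s z x' -> ~~ maya s z y' -> x' - y' <= (size s)%:Z by exact: IH.
case: (eqVneq x c) => [->|xc] /=.
  move=> _ /andP[yc]; case: (eqVneq y (c - 1)) => [->|_] /=; first by lia.
  by move=> Dy; have := IHs _ _ c1 Dy; lia.
case/andP=> xc1 Dx /andP[yc]; case: (eqVneq y (c - 1)) => [->|_] /=.
  by move=> _; have := IHs _ _ Dx c0; lia.
by move=> Dy; have := IHs _ _ Dx Dy; lia.
Qed.

Lemma addable_spread s z c c' : valid s -> addable (maya s) (z, c) ->
  addable (maya s) (z, c') -> `|c - c'| <= (size s).+1%:Z.
Proof.
move=> vs /andP[/= c1 c0] /andP[/= c1' c0'].
by have := maya_spread vs c1 c0'; have := maya_spread vs c1' c0; lia.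
Qed.

Lemma jump_ext D D' l : D =2 D' -> jump D l =2 jump D' l.
Proof. by move=> e z x; rewrite /jump !e. Qed.
Lemma addable_ext D D' l : D =2 D' -> addable D l = addable D' l.
Proof. by move=> e; rewrite /addable !e. Qed.
Lemma valid_from_ext D D' s : D =2 D' -> valid_from D s = valid_from D' s.
Proof.
elim: s D D' => //= l s IH D D' e; rewrite (addable_ext _ e); congr andb.
exact/IH/jump_ext.
Qed.
Lemma jump_comm D l k : apart l k -> jump (jump D l) k =2 jump (jump D k) l.
Proof.
case: l k => [z c] [w b] H x y; move: H; rewrite /apart /jump /=.
have [<-|zw] /= := eqVneq z w.
  by case: (x == z) => // H; case: (D x y); rewrite ?andbT ?andbF; lia.
by move=> _; have [->|_] := eqVneq x z; rewrite ?(negbTE zw) //.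
Qed.

Lemma valid_from_cat D s r :
  valid_from D (s ++ r) = valid_from D s && valid_from (foldl jump D s) r.
Proof. by elim: s D => //= l s IH D; rewrite IH andbA. Qed.

Lemma valid_swap r l k s : apart l k ->
  valid (r ++ [:: l, k & s]) -> valid (r ++ [:: k, l & s]).
Proof.
rewrite /valid !valid_from_cat => H /andP[-> /=].
set D := foldl _ _ _ => /and3P[Dl Dk vs].
have Dk' : addable D k by rewrite -(addable_jump_other _ H).
rewrite Dk' -(valid_from_ext _ (jump_comm _ H)) vs andbT /=.
by rewrite addable_jump_other // apart_sym.
Qed.

(** The second box is next to the first one or was addable before it. *)
Lemma consecutive_spread s z c c' : valid s -> addable (maya s) (z, c) ->
  addable (jump (maya s) (z, c)) (z, c') -> c != c' /\ `|c - c'| <= (size s).+1%:Z.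
Proof.
move=> vs ac ac'; have vsc : valid (rcons s (z, c)) by rewrite valid_rcons vs.
have cc' : c != c' by apply: contraTneq ac' => <-; apply: addable_jump_same.
split=> //; move: ac ac'; rewrite /addable /jump /= eqxx => /andP[c1 c0] /andP[].
case: (eqVneq (c' - 1) c) => /= [|_]; first by lia.
case: (eqVneq (c' - 1) (c - 1)) => /= [|_]; first by lia.
rewrite eq_sym in cc'; rewrite (negbTE cc') /= => c1'.
case: (eqVneq c' (c - 1)) => /= [|_ c0']; first by lia.
by have := maya_spread vs c1 c0'; have := maya_spread vs c1' c0; lia.
Qed.

Lemma valid_adjacent r x y m : valid (r ++ [:: x, y & m]) -> x.1 = y.1 ->
  x.2 != y.2 /\ `|x.2 - y.2| <= (size r).+1%:Z.
Proof.
rewrite -2!cat_rcons => /valid_cat; rewrite !valid_rcons maya_rcons.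
case: x y => z c [w c'] /andP[/andP[vr ac] ac'] /= zw; rewrite -zw in ac'.
exact: consecutive_spread vr ac ac'.
Qed.

(** The particle on [a] came there by a jump of content [a]. Since [a - 1] is
    empty and the particle still sits on [a] at the end, no later jump of its
    colour has involved these two sites. *)
Lemma removable_decomposition s z a : valid s ->
  ~~ maya s z (a - 1) -> maya s z a ->
  exists r m, s = r ++ (z, a) :: m /\
    forall x, (z, x) \in m -> [&& x != a, x != a - 1 & x != a + 1].
Proof.
elim/last_ind: s => [|s [w b] IH]; first by rewrite /maya /= /vacuum; lia.
rewrite valid_rcons maya_rcons => /andP[vs _]; rewrite /jump /=.
have [<-{w}|zw] := eqVneq z w; last first.
  move=> D1 D0; have [r [m [-> Hm]]] := IH vs D1 D0.
  exists r, (rcons m (w, b)); rewrite rcons_cat; split=> // x.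
  by rewrite mem_rcons inE xpair_eqE (negbTE zw) /=; apply: Hm.
have [->|ab] := eqVneq a b.
  by move=> _ _; exists s, [::]; rewrite cats1.
rewrite negb_or negb_and negbK /= => /andP[a1b H1] /andP[ab1 Da].
have ne : [&& b != a, b != a - 1 & b != a + 1].
  by rewrite eq_sym ab eq_sym a1b /=; apply: contraNneq ab1 => ->; rewrite addrK.
have Da1 : ~~ maya s z (a - 1) by case/orP: H1 => // /eqP; lia.
have [r [m [-> Hm]]] := IH vs Da1 Da.
exists r, (rcons m (z, b)); rewrite rcons_cat; split=> // x.
by rewrite mem_rcons inE xpair_eqE eqxx /= => /predU1P[->//|]; apply: Hm.
Qed.

(** A corner on the diagonal [c] has, on each neighbouring diagonal, either a
    removable corner or a site that the new box makes addable. *)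
Lemma blocked_removable D z c (e : int) : e \in [:: 1; -1] -> addable D (z, c) ->
  ~~ addable (jump D (z, c)) (z, c + e) ->
  ~~ D z (c + e - 1) /\ D z (c + e).
Proof.
rewrite !inE /addable /jump /= eqxx => /orP[]/eqP-> /andP[c1 c0].
  rewrite addrK eqxx /= negbK => /orP[/eqP|/andP[_ ->]]; first by lia.
  by [].
rewrite !negb_and negbK c1 => H; split=> //; apply/negP => D2; move: H.
have -> : (c - 1 - 1 == c - 1) = false by lia.
have -> : (c - 1 == c) = false by lia.
by rewrite D2 eqxx orbT.
Qed.
End MayaDiagrams.

(** * Jucys--Murphy elements *)

Section Iterates.
Variables (K : fieldType) (V : lmodType K).

Lemma iter_is_linear (f : {linear V -> V}) m : linear (iter m f).
Proof. by move=> a u v; elim: m => //= m ->; rewrite linearP. Qed.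
HB.instance Definition _ (f : {linear V -> V}) m :=
  GRing.isLinear.Build K V V _ (iter m f) (iter_is_linear f m).

Lemma iter_eigen (f : {linear V -> V}) c m (v : V) :
  f v = c *: v -> iter m f v = c ^+ m *: v.
Proof.
move=> fv; elim: m => [|m IH]; first by rewrite scale1r.
by rewrite iterS IH linearZ /= fv scalerA exprSr.
Qed.
End Iterates.

Definition swap_pos (i j : nat) : nat :=
  if j == i then i.+1 else if j == i.+1 then i else j.

Lemma swap_posK i : involutive (swap_pos i).
Proof. by move=> j; rewrite /swap_pos; do ![case: eqP => //=]; lia. Qed.
Lemma swap_pos_lt i j n : (i.+1 < n)%N -> (j < n)%N -> (swap_pos i j < n)%N.
Proof. by rewrite /swap_pos; do ![case: eqP => //=]; lia. Qed.

Definition colour_idem (K : fieldType) (V : lmodType K) (d : nat)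
    (t : nat -> {linear V -> V}) (i j : nat) (v : V) : V :=
  d%:R^-1 *: \sum_(0 <= s < d) iter s (t i) (iter (d - s) (t j) v).

(** Operators rather than elements of an algebra: the results below are used on
    every module and on the representation on words. *)
Record yh_operators (K : fieldType) (V : lmodType K) (q : K) (d n : nat)
    (g t : nat -> {linear V -> V}) : Prop := YHOperators {
  yh_far i j v : (i.+1 < j)%N -> (j.+1 < n)%N -> g i (g j v) = g j (g i v);
  yh_braid i v : (i.+2 < n)%N -> g i (g i.+1 (g i v)) = g i.+1 (g i (g i.+1 v));
  yh_tt i j v : (i < n)%N -> (j < n)%N -> t i (t j v) = t j (t i v);
  yh_tg i j v : (i.+1 < n)%N -> (j < n)%N -> t j (g i v) = g i (t (swap_pos i j) v);
  yh_order j v : (j < n)%N -> iter d (t j) v = v;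
  yh_quad i v : (i.+1 < n)%N ->
    g i (g i v) = v + (q - q^-1) *: colour_idem d t i i.+1 (g i v)
}.

Section JucysMurphy.
Variables (K : fieldType) (V : lmodType K) (q : K) (d n : nat).
Variables (g t : nat -> {linear V -> V}).
Hypothesis yh : yh_operators q d n g t.
Hypothesis d0 : d%:R != 0 :> K.

Local Notation idem := (colour_idem d t).
Local Notation delta := (q - q^-1).

Lemma idem_is_linear i j : linear (idem i j).
Proof.
move=> a u v; rewrite /colour_idem scalerA mulrC -scalerA -scalerDr; congr (_ *: _).
rewrite scaler_sumr -big_split; apply: eq_bigr => s _ /=.
by rewrite !iter_is_linear.
Qed.
HB.instance Definition _ i j :=
  GRing.isLinear.Build K V V _ (idem i j) (idem_is_linear i j).

(** A geometric sum of the [d]-th root of unity [a / b]. *)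
Lemma idem_eigen i j v a b : (i < n)%N -> (j < n)%N ->
  t i v = a *: v -> t j v = b *: v -> idem i j v = (a == b)%:R *: v.
Proof.
move=> lt_in lt_jn ti tj; have [->|v0] := eqVneq v 0.
  by rewrite linear0 scaler0.
have root k c : (k < n)%N -> t k v = c *: v -> c ^+ d = 1.
  move=> lt_kn tk; have := yh_order yh v lt_kn.
  rewrite (iter_eigen _ tk) => /eqP; rewrite -subr_eq0 -[X in _ - X]scale1r.
  by rewrite -scalerBl scaler_eq0 (negbTE v0) orbF subr_eq0 => /eqP.
have ad := root i a lt_in ti; have bd := root j b lt_jn tj.
have -> : idem i j v = d%:R^-1 *: ((\sum_(0 <= s < d) a ^+ s * b ^+ (d - s)) *: v).
  rewrite /colour_idem scaler_suml; congr (_ *: _); apply: eq_bigr => s _.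
  by rewrite (iter_eigen _ tj) linearZ /= (iter_eigen _ ti) scalerA mulrC.
rewrite scalerA; congr (_ *: _); have [->|ab] := eqVneq a b.
  rewrite (eq_big_nat _ _ (F2 := fun=> 1)) => [|s /andP[_ lt_sd]].
    by rewrite sumr_const_nat subn0 mulVf.
  by rewrite -exprD subnKC // ltnW.
apply/eqP; rewrite mulf_eq0 invr_eq0 (negbTE d0) /=.
have := subrXX b a d; rewrite ad bd subrr => /esym/eqP.
rewrite mulf_eq0 subr_eq0 eq_sym (negbTE ab) /= => /eqP S0.
suff -> : \sum_(0 <= s < d) a ^+ s * b ^+ (d - s) =
    b * \sum_(s < d) b ^+ (d.-1 - s) * a ^+ s by rewrite S0 mulr0.
rewrite big_mkord mulr_sumr; apply: eq_bigr => -[s lt_sd] _ /=.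
by rewrite mulrA -exprS mulrC; congr (_ ^+ _ * _); lia.
Qed.

Definition colour_vector (col : nat -> K) (v : V) :=
  forall j, (j < n)%N -> t j v = col j *: v.

Lemma colour_vector_g i col v : (i.+1 < n)%N -> colour_vector col v ->
  colour_vector (col \o swap_pos i) (g i v).
Proof.
move=> lt_i Cv j lt_j; rewrite (yh_tg yh) // Cv ?swap_pos_lt //.
by rewrite linearZ.
Qed.

Lemma colour_vector_idem i j col v : (i < n)%N -> (j < n)%N -> colour_vector col v ->
  idem i j v = (col i == col j)%:R *: v.
Proof. by move=> lt_i lt_j Cv; apply: idem_eigen; rewrite ?Cv. Qed.

Lemma colour_vectorD col u v :
  colour_vector col u -> colour_vector col v -> colour_vector col (u + v).
Proof. by move=> Cu Cv j lt_j; rewrite linearD Cu // Cv // scalerDr. Qed.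
Lemma colour_vectorZ col a v : colour_vector col v -> colour_vector col (a *: v).
Proof. by move=> Cv j lt_j; rewrite linearZ /= Cv // !scalerA mulrC. Qed.
Lemma eq_colour_vector col col' v : (forall j, (j < n)%N -> col j = col' j) ->
  colour_vector col v -> colour_vector col' v.
Proof. by move=> e Cv j lt_j; rewrite -e // Cv. Qed.

Lemma g_square_colour i col v : (i.+1 < n)%N -> colour_vector col v ->
  g i (g i v) = v + (delta * (col i == col i.+1)%:R) *: g i v.
Proof.
move=> lt_i Cv; rewrite (yh_quad yh) //.
rewrite (colour_vector_idem _ _ (colour_vector_g lt_i Cv)) ?(ltnW lt_i) //=.
by rewrite /swap_pos eqxx -[i.+1 == i]/(i.+1 == i) gtn_eqF // eqxx scalerA eq_sym.
Qed.

(** Jucys--Murphy elements. For [q - q^-1 != 0] they are affine images of the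
    products [g_(k-1) ... g_0 g_0 ... g_(k-1)]; in this form they also
    degenerate correctly at [q^2 = 1]. *)
Fixpoint jm_fun (k : nat) (v : V) : V :=
  if k is k'.+1 then g k' (jm_fun k' (g k' v)) + idem k' k'.+1 (g k' v) else 0.
Lemma jm_is_linear k : linear (jm_fun k).
Proof.
elim: k => [|k IH] a u v /=; first by rewrite scaler0 addr0.
by rewrite !linearP IH !linearP scalerDr addrACA.
Qed.
HB.instance Definition _ k :=
  GRing.isLinear.Build K V V _ (jm_fun k) (jm_is_linear k).
Definition jm : nat -> {linear V -> V} := locked (fun k => jm_fun k : {linear V -> V}).

Lemma jm0 v : jm 0 v = 0.
Proof. by rewrite /jm -lock. Qed.
Lemma jmS k v : jm k.+1 v = g k (jm k (g k v)) + idem k k.+1 (g k v).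
Proof. by rewrite /jm -lock. Qed.

Lemma jmS_colour k col v : (k.+1 < n)%N -> colour_vector col v ->
  jm k.+1 v = g k (jm k (g k v)) + (col k == col k.+1)%:R *: g k v.
Proof.
move=> lt_k Cv; rewrite jmS.
rewrite (colour_vector_idem _ _ (colour_vector_g lt_k Cv)) ?(ltnW lt_k) //=.
by rewrite /swap_pos eqxx gtn_eqF // eqxx eq_sym.
Qed.

Lemma colour_vector_jm k col v : (k < n)%N -> colour_vector col v ->
  colour_vector col (jm k v).
Proof.
elim: k col v => [|k IH] col v lt_k Cv.
  by move=> j _; rewrite jm0 linear0 scaler0.
rewrite (jmS_colour lt_k Cv); have Cg := colour_vector_g lt_k Cv.
apply: colour_vectorD.
  apply: eq_colour_vector (colour_vector_g lt_k (IH _ _ (ltnW lt_k) Cg)) => j lt_j.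
  by rewrite /= swap_posK.
case: eqP => [e|_]; last by move=> j _; rewrite scale0r linear0 scaler0.
apply/colour_vectorZ/(eq_colour_vector _ Cg) => j _.
by rewrite /= /swap_pos; do ![case: eqP => [->|_]].
Qed.

(** The roots of unity of order dividing [d]. *)
Variable Z : seq K.
Hypothesis uniq_Z : uniq Z.
Hypothesis prod_Z : \prod_(z <- Z) ('X - z%:P) = 'X^d - 1.

Lemma t_split (N : V -> Prop) j v : (j < n)%N -> subspace N ->
  (forall u, N u -> N (t j u)) -> N v ->
  sums (fun u => N u /\ exists c, t j u = c *: u) v.
Proof.
move=> lt_j sN tN Nv; have := eigen_split uniq_Z sN tN Nv.
have pactXn m : pact (t j) 'X^m v = iter m (t j) v.
  elim: m => [|m IH]; first by rewrite pactC scale1r.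
  by rewrite exprSr pactXM IH.
rewrite prod_Z -polyC1 -polyCN pactDl pactC pactXn (yh_order yh) // scaleN1r subrr.
move=> /(_ erefl) S; apply: sums_bind S _ => u [Nu [c _ tu]].
by apply: sums1; split=> //; exists c.
Qed.

Lemma colour_split (N : V -> Prop) v : subspace N ->
  (forall j u, (j < n)%N -> N u -> N (t j u)) -> N v ->
  sums (fun u => N u /\ exists col, colour_vector col u) v.
Proof.
move=> sN tN Nv; suff /(_ n (leqnn n)) S : forall m, (m <= n)%N ->
    sums (fun u => N u /\ exists col : nat -> K,
      forall j, (j < m)%N -> t j u = col j *: u) v by [].
elim=> [|m IH] lt_m; first by apply: sums1; split=> //; exists (fun=> 0).
apply: sums_bind (IH (ltnW lt_m)) _ => u [Nu [col Cu]].
pose N' w := N w /\ forall j, (j < m)%N -> t j w = col j *: w.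
have sN' : subspace N'.
  apply: subspaceI => //; split=> [j _|a x y Nx Ny j lt_j].
    by rewrite linear0 scaler0.
  by rewrite linearP Nx // Ny // scalerDr !scalerA mulrC.
have tN' w : N' w -> N' (t m w).
  case=> Nw Cw; split=> [|j lt_j]; first exact: tN.
  by rewrite (yh_tt yh) ?(ltn_trans lt_j) // Cw // linearZ.
apply: sums_bind (t_split lt_m sN' tN' (conj Nu Cu)) _ => w [[Nw Cw] [c tw]].
apply: sums1; split=> //; exists (fun j => if j == m then c else col j) => j.
by rewrite ltnS leq_eqVlt; case: eqP => [-> _|_ /= lt_j]; [|apply: Cw].
Qed.

(** Linear identities may be checked on colour vectors, where the idempotents
    are scalars. *)
Lemma colour_ind (P : V -> Prop) : P 0 -> (forall u v, P u -> P v -> P (u + v)) ->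
  (forall u col, colour_vector col u -> P u) -> forall v, P v.
Proof.
move=> P0 PD PC v; have sT : subspace (fun _ : V => True) by [].
elim: (@colour_split (fun=> True) v sT (fun _ _ _ _ => I) I) => // u w [_ [col Cu]] _ Pw.
exact/PD/Pw/(PC _ col).
Qed.

Lemma jm_t k j v : (k < n)%N -> (j < n)%N -> t j (jm k v) = jm k (t j v).
Proof.
move=> lt_k lt_j; elim/colour_ind: v => [|u v eu ev|u col Cu].
- by rewrite !linear0.
- by rewrite !linearD eu ev.
- by rewrite Cu // (colour_vector_jm lt_k Cu) // linearZ.
Qed.

(** Only [g_i] with [L_(i+2)] needs more than commutations: there the braid
    relation moves [g_i] through [g_(i+1) g_i L_i g_i g_(i+1)], and the remaining
    terms agree for each possible coincidence of the three colours involved. *)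
Lemma jm_g_far k i v : (k < n)%N -> (i.+1 < n)%N -> (k < i)%N || (i.+1 < k)%N ->
  g i (jm k v) = jm k (g i v).
Proof.
elim/ltn_ind: k i v => -[|k] IH i v lt_k lt_i lt_ik; first by rewrite !jm0 linear0.
elim/colour_ind: v => [|u v eu ev|u col Cu].
- by rewrite !linear0.
- by rewrite !linearD eu ev.
have Ci := colour_vector_g lt_i Cu.
have [eki|nki] := eqVneq k i.+1; last first.
  have far w : g i (g k w) = g k (g i w).
    by case/orP: lt_ik => ?; [rewrite [RHS](yh_far yh)|rewrite (yh_far yh)] => //; lia.
  rewrite (jmS_colour lt_k Cu) (jmS_colour lt_k Ci) linearD linearZ /= !far.
  rewrite (IH k) ?far //; [|by lia..]; congr (_ + (_ == _)%:R *: _).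
    by rewrite /swap_pos; do ![case: eqP => //=]; lia.
  by rewrite /swap_pos; do ![case: eqP => //=]; lia.
move: lt_k {lt_ik} IH; rewrite eki => {eki k} lt_k IH.
have Ck := colour_vector_g lt_k Cu.
have Cik := colour_vector_g lt_i Ck.
have Cki := colour_vector_g lt_k Ci.
have s1 : swap_pos i i = i.+1 by rewrite /swap_pos eqxx.
have s2 : swap_pos i i.+1 = i by rewrite /swap_pos eqxx gtn_eqF.
have s3 : swap_pos i i.+2 = i.+2 by rewrite /swap_pos !gtn_eqF.
have s4 : swap_pos i.+1 i = i by rewrite /swap_pos !ltn_eqF.
have s5 : swap_pos i.+1 i.+1 = i.+2 by rewrite /swap_pos eqxx.
have s6 : swap_pos i.+1 i.+2 = i.+1 by rewrite /swap_pos eqxx gtn_eqF.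
have B w : g i.+1 (g i (g i.+1 w)) = g i (g i.+1 (g i w)) by rewrite (yh_braid yh).
rewrite (jmS_colour lt_k Cu) (jmS_colour lt_k Ci) (jmS_colour lt_i Ck) (jmS_colour lt_i Cki) /=.
rewrite !(s1, s2, s3, s4, s5, s6) /=.
have sq1 := g_square_colour lt_i Cu.
have := g_square_colour lt_i Cki; rewrite /= !(s1, s2, s3, s4, s5, s6) => sq2.
have comJ w : jm i (g i.+1 w) = g i.+1 (jm i w).
  by rewrite IH ?ltnSn ?orbT //; lia.
have main : g i.+1 (g i (jm i (g i (g i.+1 (g i u))))) =
            g i (g i.+1 (g i (jm i (g i (g i.+1 u))))).
  by rewrite -!B comJ B.
rewrite !(linearD, linearZ) /= main (B u) (B (g i u)) sq1 sq2.
rewrite !(linearD, linearZ) /=.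
set X := g i _; set Y := g i.+1 (g i u); set Y' := g i (g i.+1 u).
set W := g i (g i.+1 (g i u)).
rewrite -!addrA; congr (X + _).
have [e|ne] := eqVneq (col i) (col i.+2).
  by rewrite e (eq_sym (col i.+2)); case: eqP => _ /=; lincomb Y Y' W; ring.
have [e'|_] /= := eqVneq (col i.+1) (col i.+2); last by lincomb Y Y' W; ring.
by rewrite e' (negbTE ne) /=; lincomb Y Y' W; ring.
Qed.

Lemma idem_jm_comm i j k v : (i < n)%N -> (j < n)%N -> (k < n)%N ->
  idem i j (jm k v) = jm k (idem i j v).
Proof.
move=> lt_i lt_j lt_k; elim/colour_ind: v => [|u v eu ev|u col Cu].
- by rewrite !linear0.
- by rewrite !linearD /= eu ev.
rewrite (colour_vector_idem _ _ Cu) // (colour_vector_idem _ _ (colour_vector_jm lt_k Cu)) //.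
by rewrite linearZ.
Qed.

Lemma jm_comm j k v : (j < n)%N -> (k < n)%N -> jm j (jm k v) = jm k (jm j v).
Proof.
wlog lt_jk : j k v / (j < k)%N.
  move=> H lt_j lt_k; case: (ltngtP j k) => [jk|kj|->//]; first exact: H.
  by rewrite [RHS]H.
elim: j v lt_jk => [|j IH] v lt_jk lt_j lt_k; first by rewrite !jm0 linear0.
have far w : g j (jm k w) = jm k (g j w) by rewrite jm_g_far //; lia.
by rewrite !jmS linearD far IH ?far -?idem_jm_comm //; lia.
Qed.

Section TwoColours.
Variables (k : nat) (v : V) (a b : K).
Hypotheses (lt_k : (k.+1 < n)%N) (tka : t k v = a *: v) (tkb : t k.+1 v = b *: v).

Let lt_k' : (k < n)%N := ltnW lt_k.

Lemma t_g_left : t k (g k v) = b *: g k v.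
Proof. by rewrite (yh_tg yh _ lt_k lt_k') /swap_pos eqxx tkb linearZ. Qed.
Lemma t_g_right : t k.+1 (g k v) = a *: g k v.
Proof. by rewrite (yh_tg yh _ lt_k lt_k) /swap_pos eqxx gtn_eqF // tka linearZ. Qed.
Lemma idem_g_two : idem k k.+1 (g k v) = (a == b)%:R *: g k v.
Proof. by rewrite eq_sym (idem_eigen lt_k' lt_k t_g_left t_g_right). Qed.
Lemma g_square : g k (g k v) = v + (delta * (a == b)%:R) *: g k v.
Proof. by rewrite (yh_quad yh) // idem_g_two scalerA. Qed.
Lemma jmS_two : jm k.+1 v = g k (jm k (g k v)) + (a == b)%:R *: g k v.
Proof. by rewrite jmS idem_g_two. Qed.

End TwoColours.

(** The relations of an affine Hecke algebra, with a correction seen only by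
    equal colours. *)
Lemma jmS_g k v a b : (k.+1 < n)%N -> t k v = a *: v -> t k.+1 v = b *: v ->
  jm k.+1 (g k v) = g k (jm k v) + (a == b)%:R *: (v + delta *: jm k.+1 v).
Proof.
move=> lt_k tka tkb; rewrite (jmS_two lt_k (t_g_left lt_k tkb) (t_g_right lt_k tka)).
rewrite (jmS_two lt_k tka tkb) (g_square lt_k tka tkb) eq_sym !(linearD, linearZ) /=.
have [_|_] /= := eqVneq a b; last by rewrite !(mulr0, scale0r, scaler0, addr0).
rewrite -!addrA; congr (_ + _).
by lincomb v (g k (jm k (g k v))) (g k v); ring.
Qed.

Lemma g_jmS k v a b : (k.+1 < n)%N -> t k v = a *: v -> t k.+1 v = b *: v ->
  g k (jm k.+1 v) = jm k (g k v) + (a == b)%:R *: (v + delta *: jm k.+1 v).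
Proof.
move=> lt_k tka tkb; have lt_k' := ltnW lt_k.
have tl := t_g_left lt_k tkb; have tr := t_g_right lt_k tka.
have jl : t k (jm k (g k v)) = b *: jm k (g k v) by rewrite jm_t // tl linearZ.
have jr : t k.+1 (jm k (g k v)) = a *: jm k (g k v) by rewrite jm_t // tr linearZ.
rewrite (jmS_two lt_k tka tkb) !(linearD, linearZ) /= (g_square lt_k tka tkb).
rewrite (g_square lt_k jl jr) eq_sym.
have [_|_] /= := eqVneq a b; last by rewrite !(mulr0, scale0r, scaler0, addr0).
rewrite -!addrA; congr (_ + _).
by lincomb v (g k (jm k (g k v))) (g k v); ring.
Qed.

End JucysMurphy.

(** * Diagonalisation of the Jucys--Murphy elements *)

Section Weights.
Variables (K : fieldType) (V : lmodType K) (q : K) (d n : nat).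
Variables (g t : nat -> {linear V -> V}).
Hypothesis yh : yh_operators q d n g t.
Hypothesis d0 : d%:R != 0 :> K.
Variable Z : seq K.
Hypothesis uniq_Z : uniq Z.
Hypothesis prod_Z : \prod_(z <- Z) ('X - z%:P) = 'X^d - 1.
Hypothesis q0 : q != 0.
Hypothesis qint_neq0 : forall m, (0 < m <= n)%N -> \sum_(0 <= k < m) q ^+ (2 * k) != 0.

Local Notation content := (content q).
Local Notation jm := (jm d g t).
Local Notation letter := (K * int)%type.
Implicit Types (s r m : seq letter) (x y : letter).

Definition wt s v := forall i, (i < size s)%N ->
  t i v = (nth (0, 0) s i).1 *: v /\ jm i v = content (nth (0, 0) s i).2 *: v.

Lemma wt_rcons s x v : wt (rcons s x) v <->
  [/\ wt s v, t (size s) v = x.1 *: v & jm (size s) v = content x.2 *: v].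
Proof.
split=> [w|[w tv jv] i]; last first.
  rewrite size_rcons ltnS leq_eqVlt nth_rcons => /predU1P[->|lt_i].
    by rewrite ltnn eqxx.
  by rewrite lt_i; apply: w.
have := w (size s); rewrite size_rcons nth_rcons ltnn eqxx => /(_ (leqnn _))[-> ->].
split=> // i lt_i; have := w i; rewrite size_rcons nth_rcons lt_i.
by apply; apply: ltnW.
Qed.

Lemma wt_cat s r v : wt (s ++ r) v -> wt s v.
Proof.
move=> w i lt_i; have := w i; rewrite size_cat nth_cat lt_i; apply.
exact: ltn_addr.
Qed.

Lemma wt_nth s r x v : wt (s ++ x :: r) v ->
  t (size s) v = x.1 *: v /\ jm (size s) v = content x.2 *: v.
Proof.
by move/(_ (size s)); rewrite size_cat nth_cat ltnn subnn addnS ltnS leq_addr => /(_ isT).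
Qed.

Lemma wt_subspace s : subspace (wt s).
Proof.
split=> [i _|a u v wu wv i lt_i]; first by rewrite !linear0 ?scaler0.
have [tu ju] := wu i lt_i; have [tv jv] := wv i lt_i.
by rewrite !linearP tu tv ju jv; split; lincomb u v v; ring.
Qed.

Lemma wt_map s v (h : {linear V -> V}) :
  (forall i u, (i < size s)%N -> t i (h u) = h (t i u) /\ jm i (h u) = h (jm i u)) ->
  wt s v -> wt s (h v).
Proof.
move=> hC w i lt_i; have [th jh] := hC i v lt_i; have [tv jv] := w i lt_i.
by rewrite th jh tv jv !linearZ.
Qed.

Lemma wt_t k s v : (k < n)%N -> (size s <= n)%N -> wt s v -> wt s (t k v).
Proof.
move=> lt_k le_s; apply: wt_map => i u lt_i; have lt_in := leq_trans lt_i le_s.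
by rewrite (yh_tt yh) // (jm_t yh d0 uniq_Z prod_Z).
Qed.
Lemma wt_jm k s v : (k < n)%N -> (size s <= n)%N -> wt s v -> wt s (jm k v).
Proof.
move=> lt_k le_s; apply: wt_map => i u lt_i; have lt_in := leq_trans lt_i le_s.
by rewrite (jm_t yh d0 uniq_Z prod_Z) // (jm_comm yh d0 uniq_Z prod_Z _ lt_in).
Qed.
Lemma wt_g k s v : (k.+1 < n)%N -> (size s <= k)%N -> wt s v -> wt s (g k v).
Proof.
move=> lt_k le_s; apply: wt_map => i u lt_i.
have lt_ik : (i < k)%N := leq_trans lt_i le_s.
rewrite (yh_tg yh) ?(jm_g_far yh d0 uniq_Z prod_Z) ?lt_ik //; try lia.
by rewrite /swap_pos !ltn_eqF //; lia.
Qed.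

(** [rho] is the diagonal coefficient of [g_i] in Young's seminormal form;
    subtracting it from [g_i] leaves the operator that exchanges two letters of
    a weight. *)
Definition rho x y : K :=
  if x.1 == y.1 then q ^ (2 * y.2) / (content y.2 - content x.2) else 0.
Definition inter i x y v : V := g i v - rho x y *: v.

Lemma wt_inter r x y m v : (size r + size m + 2 <= n)%N ->
  (x.1 = y.1 -> content x.2 != content y.2) ->
  wt (r ++ [:: x, y & m]) v -> wt (r ++ [:: y, x & m]) (inter (size r) x y v).
Proof.
move=> le_n xy w; set i := size r; have lt_i : (i.+1 < n)%N by lia.
have [tx jx] := wt_nth w.
have [ty jy] : t i.+1 v = y.1 *: v /\ jm i.+1 v = content y.2 *: v.
  by move: w; rewrite -cat_rcons => /wt_nth; rewrite size_rcons.
have jj := jmS_g yh d0 lt_i tx ty.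
have jj' := g_jmS yh d0 uniq_Z prod_Z lt_i tx ty.
have eqy : v + (q - q^-1) *: jm i.+1 v = q ^ (2 * y.2) *: v.
  by rewrite jy -(content_affine q0); lincomb v v v; ring.
rewrite eqy in jj jj'.
have rhoE : (x.1 == y.1)%:R * q ^ (2 * y.2) = rho x y * (content y.2 - content x.2).
  rewrite /rho; case: eqP => [/xy ne|_]; last by rewrite !mul0r.
  by rewrite mul1r mulfVK // subr_eq0 eq_sym.
move=> j; rewrite size_cat /= => lt_j; rewrite nth_cat.
case: ltnP => [lt_ji|le_ij].
  have [tj jj0] := w j ltac:(by rewrite size_cat ltn_addr).
  rewrite nth_cat lt_ji in tj jj0.
  have sr := wt_subspace r; have wrv : wt r v := wt_cat w.
  suff: wt r (inter i x y v) by exact.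
  apply: (subspaceB sr); last exact: subspaceZ sr wrv.
  exact: wt_g.
have tl := t_g_left yh lt_i ty; have tr := t_g_right yh lt_i tx.
have rc : rho x y * x.1 = rho x y * y.1.
  by rewrite /rho; case: eqP => [->|_]; rewrite ?mul0r.
have [->|nji] := eqVneq j i.
  rewrite subnn /= /inter !linearB !linearZ /= tl tx jx.
  have -> : jm i (g i v) = content y.2 *: g i v - (rho x y * (content y.2 - content x.2)) *: v.
    by rewrite -rhoE -scalerA -[_ *: g i v]linearZ /= -jy jj' addrK.
  by split; lincomb v v (g i v); ring: rc.
have [->|njSi] := eqVneq j i.+1.
  rewrite subSnn /= /inter !linearB !linearZ /= tr ty jy.
  have -> : jm i.+1 (g i v) = content x.2 *: g i v + (rho x y * (content y.2 - content x.2)) *: v.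
    by rewrite jj -rhoE scalerA jx linearZ.
  by split; lincomb v v (g i v); ring: rc.
have lt_ij : (i.+1 < j)%N by lia.
have [tj jj0] := w j ltac:(by rewrite size_cat).
rewrite nth_cat ltnNge le_ij /= in tj jj0.
have lt_jn : (j < n)%N by lia.
have gt : t j (g i v) = g i (t j v).
  by rewrite (yh_tg yh) // /swap_pos !gtn_eqF // ltnW.
have gj : jm j (g i v) = g i (jm j v).
  by rewrite (jm_g_far yh d0 uniq_Z prod_Z) // lt_ij orbT.
rewrite /inter !linearB gt gj !linearZ /= tj jj0 !linearZ /=.
have -> : (j - size r)%N = (j - size r).-2.+2 by rewrite -/i; lia.
by split; lincomb v v (g i v); ring.
Qed.

(** A vanishing intertwiner means that [g] acts by [rho], which must then be a
    root of the quadratic relation. *)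
Lemma inter0_square r x y m v : (size r + 2 <= n)%N ->
  wt (r ++ [:: x, y & m]) v -> v != 0 -> inter (size r) x y v = 0 ->
  x.1 = y.1 /\ (rho x y = q \/ rho x y = - q^-1).
Proof.
move=> le_n w v0 /eqP; rewrite subr_eq0 => /eqP gv; set i := size r in gv *.
have lt_i : (i.+1 < n)%N by lia.
have [tx jx] := wt_nth w.
have [ty jy] : t i.+1 v = y.1 *: v /\ jm i.+1 v = content y.2 *: v.
  by move: w; rewrite -cat_rcons => /wt_nth; rewrite size_rcons.
have := g_square yh d0 lt_i tx ty; rewrite gv linearZ /= gv => /eqP.
rewrite -[X in _ == X + _]scale1r scalerA -scalerA !scalerA -scalerDl.
rewrite -subr_eq0 -scalerBl scaler_eq0 (negbTE v0) orbF subr_eq0.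
have [xy|nxy] := eqVneq x.1 y.1; last first.
  by rewrite /rho (negbTE nxy) !(mulr0, mul0r) addr0 eq_sym oner_eq0.
rewrite mulr1 => /eqP E; split=> //.
have /eqP : (rho x y - q) * (rho x y + q^-1) = 0.
  have -> : (rho x y - q) * (rho x y + q^-1) =
    rho x y * rho x y - 1 - (q - q^-1) * rho x y by field.
  by rewrite E; ring.
by rewrite mulf_eq0 subr_eq0 addr_eq0 => /orP[]/eqP->; [left|right].
Qed.

(** The values [q] and [- q^-1] of [rho] occur only for contents that differ by
    one. *)
Lemma inter_neq0 r x y m v : (size r + 2 <= n)%N -> valid (r ++ [:: x; y]) -> apart x y ->
  wt (r ++ [:: x, y & m]) v -> v != 0 -> inter (size r) x y v != 0.
Proof.
move=> le_n vs xy w v0; apply/eqP => /(inter0_square le_n w v0)[e].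
have [_] : _ /\ `|x.2 - y.2| <= (size r).+1%:Z := valid_adjacent vs e; move=> lt_xy.
rewrite /rho e eqxx; move: xy; rewrite /apart e eqxx /= => /and3P[yx yx1 yx2].
have D0 : content y.2 - content x.2 != 0.
  rewrite subr_eq0; apply: contraNneq yx => /(content_inj q0 qint_neq0) -> //.
  by lia.
move=> E; case: E => [/(canRL (mulfVK D0))|/(canRL (mulfVK D0))] E.
  case/negP: yx2; apply/eqP; suff -> : x.2 = y.2 - 1 by rewrite subrK.
  apply: (content_inj q0 qint_neq0); first by lia.
  by rewrite content_prev // E; field.
case/negP: yx1; apply/eqP; suff -> : x.2 = y.2 + 1 by rewrite addrK.
apply: (content_inj q0 qint_neq0); first by lia.
by rewrite contentS // E; field.
Qed.

(** The statement proved by induction: only contents of addable boxes occur as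
    eigenvalues of [jm k], without Jordan blocks. The colour is fixed first,
    because contents distinguish the addable boxes of one colour only. *)
Definition splits k := forall s v z, size s = k -> valid s -> wt s v ->
  t k v = z *: v -> exists S : seq int, [/\ uniq S,
    forall c, c \in S -> addable (maya s) (z, c) &
    pact (jm k) (\prod_(c <- S) ('X - (content c)%:P)) v = 0].

Lemma splits_eigen s v z a : splits (size s) -> valid s -> wt s v -> v != 0 ->
  t (size s) v = z *: v -> jm (size s) v = a *: v ->
  exists2 c, addable (maya s) (z, c) & a = content c.
Proof.
move=> sp vs w v0 tv jv; have [S [_ addS]] := sp s v z erefl vs w tv.
rewrite (pact_eigen _ jv) => /eqP; rewrite scaler_eq0 (negbTE v0) orbF horner_prod.
rewrite prodf_seq_eq0 => /hasP[c cS /=]; rewrite hornerXsubC subr_eq0 => /eqP ac.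
by exists c => //; apply: addS.
Qed.

(** Two boxes of the same colour on adjacent diagonals cannot be added in both
    orders, so the intertwiner vanishes there. *)
Lemma inter_eq0 r z c (e : int) m v : (size r + size m + 2 <= n)%N ->
  e \in [:: 1; -1] -> splits (size r) -> valid (rcons r (z, c)) ->
  wt (r ++ [:: (z, c), (z, c + e) & m]) v -> inter (size r) (z, c) (z, c + e) v = 0.
Proof.
move=> le_n e1 sp; rewrite valid_rcons => /andP[vr ac] w.
have en : `|e| <= 1 by move: e1; rewrite !inE => /orP[]/eqP->.
have e0 : e != 0 by move: e1; rewrite !inE => /orP[]/eqP->.
apply/eqP/negPn/negP => u0.
have w' := wt_inter le_n _ w; have {}w' := w' _.
have {}w' : wt (r ++ [:: (z, c + e), (z, c) & m]) (inter (size r) (z, c) (z, c + e) v).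
  apply: w' => _; apply: contraNneq e0 => /(content_inj q0 qint_neq0) /= cc.
  by have := cc ltac:(lia); lia.
have [tu ju] := wt_nth w'.
have [c' ac' ce] := splits_eigen sp vr (wt_cat w') u0 tu ju.
have cc' : `|c - c'| <= (size r).+1%:Z := addable_spread vr ac ac'.
have c'E : c' = c + e by apply: esym; apply: (content_inj q0 qint_neq0); [lia|].
by move: ac'; rewrite c'E (negbTE (addable_next e1 ac)).
Qed.

Lemma rho_adjacent z c :
  rho (z, c) (z, c + 1) = q /\ rho (z, c) (z, c - 1) = - q^-1.
Proof.
have qz (j : int) : q ^ j != 0 by rewrite expfz_neq0.
have q2 (j : int) : q ^ (j + 2) = q ^ j * (q * q) by rewrite expfzDr.
rewrite /rho /= eqxx contentS // content_prev //.
have -> : 2 * (c - 1) = 2 * c - 2 by ring.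
have q2' : q ^ (2 * c - 2) = q ^ (2 * c) / (q * q).
  by have := q2 (2 * c - 2); rewrite subrK => ->; field.
have -> : 2 * (c + 1) = 2 * c + 2 by ring.
rewrite q2 q2' [content c + _ - _]addrAC [content c - _ - _]addrAC !subrr !add0r.
by split; field; rewrite ?oppr_eq0 ?qz ?q0.
Qed.

(** The pattern [c, c + e, c] does not occur: both [g]'s would act by scalars,
    different ones, against the braid relation. *)
Lemma braid_exclusion r z c (e : int) v : (size r + 3 <= n)%N -> e \in [:: 1; -1] ->
  splits (size r) -> splits (size r).+1 -> valid (rcons r (z, c)) ->
  wt (r ++ [:: (z, c); (z, c + e); (z, c)]) v -> v = 0.
Proof.
move=> le_n e1 sp sp1 vrc w; apply/eqP/negPn/negP => v0.
have gv : g (size r) v = rho (z, c) (z, c + e) *: v.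
  by apply/eqP; rewrite -subr_eq0; apply/eqP/(inter_eq0 _ e1 sp vrc w); rewrite /=; lia.
have w2 : wt (rcons r (z, c) ++ [:: (z, c + e); (z, c)]) v by rewrite cat_rcons.
have gv2 : g (size r).+1 v = rho (z, c + e) (z, c) *: v.
  apply/eqP; rewrite -subr_eq0 -[(size r).+1](size_rcons r (z, c)).
  apply/negPn/negP => u0.
  have w2' := wt_inter _ _ w2; have {}w2' := w2' _ _.
  have {}w2' : wt (rcons r (z, c) ++ [:: (z, c); (z, c + e)])
      (inter (size (rcons r (z, c))) (z, c + e) (z, c) v).
    apply: w2' => [|_]; first by rewrite size_rcons /=; lia.
    move: e1; rewrite !inE => e1; apply/eqP => /(content_inj q0 qint_neq0) /= cc.
    by have := cc ltac:(lia); case/orP: e1 => /eqP; lia.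
  have [tu ju] := wt_nth w2'; move: sp1; rewrite -(size_rcons r (z, c)) => sp1.
  have [c' ac' ce] := splits_eigen sp1 vrc (wt_cat w2') u0 tu ju.
  move: vrc ac'; rewrite valid_rcons maya_rcons => /andP[vr ac] ac'.
  have [cc' le_cc'] : c != c' /\ `|c - c'| <= (size r).+1%:Z := consecutive_spread vr ac ac'.
  by case/eqP: cc'; apply: (content_inj q0 qint_neq0); [lia|].
have := yh_braid yh v (i := size r) ltac:(lia).
rewrite !(gv, gv2, linearZ) /= => /eqP; rewrite -subr_eq0 !scalerA -scalerBl.
rewrite scaler_eq0 (negbTE v0) orbF.
have [r1 r2] := rho_adjacent z c; have qq : q ^+ 2 + 1 != 0.
  have := qint_neq0 (m := 2); rewrite /= big_nat_recr //= big_nat1 expr0 addrC.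
  by apply; lia.
move: e1; rewrite !inE => /orP[]/eqP e1; rewrite e1.
  have [_] := rho_adjacent z (c + 1); rewrite addrK r1 => ->.
  have -> : q * - q^-1 * q - - q^-1 * q * - q^-1 = - (q ^+ 2 + 1) / q by field.
  by rewrite mulf_eq0 oppr_eq0 (negbTE qq) invr_eq0 (negbTE q0).
have [] := rho_adjacent z (c - 1); rewrite subrK r2 => -> _.
have -> : - q^-1 * q * - q^-1 - q * - q^-1 * q = (q ^+ 2 + 1) / q by field.
by rewrite mulf_eq0 (negbTE qq) invr_eq0 (negbTE q0).
Qed.

Lemma wt_inter_valid r x y m v : (size r + size m + 2 <= n)%N ->
  valid (r ++ [:: x; y]) -> wt (r ++ [:: x, y & m]) v ->
  wt (r ++ [:: y, x & m]) (inter (size r) x y v).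
Proof.
move=> le_n vs w; apply: (wt_inter le_n) w => xy.
have [xy2 le_xy] : x.2 != y.2 /\ `|x.2 - y.2| <= (size r).+1%:Z := valid_adjacent vs xy.
by apply: contraNneq xy2 => /(content_inj q0 qint_neq0) -> //; lia.
Qed.

(** By moving [c] to the right through letters it commutes with, a forbidden
    pattern [c ... c + e, c] becomes consecutive. *)
Lemma separated_exclusion (s : seq letter) r z c (e : int) v :
  (size r + size s + 3 <= n)%N -> e \in [:: 1; -1] ->
  (forall j, (j <= size r + size s + 1)%N -> splits j) ->
  valid (r ++ (z, c) :: s) ->
  (forall a, (z, a) \in s -> [&& a != c, a != c - 1 & a != c + 1]) ->
  wt (r ++ (z, c) :: s ++ [:: (z, c + e); (z, c)]) v -> v = 0.
Proof.
elim: s r v => [|x s IH] r v /= le_n e1 sp vs far w.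
  move: vs; rewrite cats1 => vs; apply: (braid_exclusion _ e1 _ _ vs w); first by lia.
    by apply: sp; lia.
  by apply: sp; lia.
apply/eqP/negPn/negP => v0.
have ap : apart (z, c) x.
  rewrite /apart /=; have [zx|//] := eqVneq z x.1; apply: far.
  by rewrite zx -surjective_pairing mem_head.
have vs2 : valid (r ++ [:: (z, c); x]).
  by apply: (valid_cat (r := s)); rewrite -catA.
have le2 : (size r + 2 <= n)%N by lia.
have u0 := inter_neq0 le2 vs2 ap w v0.
have le3 : (size r + size (s ++ [:: (z, c + e)%R; (z, c)]) + 2 <= n)%N.
  by rewrite size_cat /=; lia.
have := wt_inter_valid le3 vs2 w; rewrite -cat_rcons => /IH u00.
case/eqP: u0; apply: u00 => //.
- by rewrite size_rcons; lia.
- by move=> j; rewrite size_rcons => le_j; apply: sp; lia.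
- by rewrite cat_rcons; apply: valid_swap vs.
- by move=> a a_s; apply: far; rewrite inE a_s orbT.
Qed.

Section SplitsStep.
Variables (k : nat) (s : seq letter) (z : K) (c : int) (v : V).
Hypotheses (lt_k : (k.+1 < n)%N) (sp : forall j, (j <= k)%N -> splits j).
Hypotheses (size_s : size s = k) (vs : valid (rcons s (z, c))).

(** [N] collects the vectors on which [jm k.+1] has to be diagonalised. *)
Let N z' w := wt (rcons s (z, c)) w /\ t k.+1 w = z' *: w.
Let sN z' : subspace (N z').
Proof. exact: subspaceI (wt_subspace _) (subspace_eigen _ _). Qed.
Let jmN z' w : N z' w -> N z' (jm k.+1 w).
Proof.
case=> w1 w2; split; first by apply: wt_jm; rewrite // size_rcons size_s ltnW.
by rewrite (jm_t yh d0 uniq_Z prod_Z) // w2 linearZ.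
Qed.

Let tk w z' : N z' w -> t k w = z *: w.
Proof. by case=> /wt_rcons[_]; rewrite size_s. Qed.
Let jk w z' : N z' w -> jm k w = content c *: w.
Proof. by case=> /wt_rcons[_ _]; rewrite size_s. Qed.
Let vs' : valid s.
Proof. by move: vs; rewrite valid_rcons => /andP[]. Qed.
Let addc : addable (maya s) (z, c).
Proof. by move: vs; rewrite valid_rcons => /andP[]. Qed.

(** For different colours, [g_k] is invertible and conjugates [L_(k+1)] to
    [L_k]. *)
Lemma splits_step_other z' : z' != z -> N z' v -> exists S : seq int, [/\ uniq S,
    forall a, a \in S -> addable (maya (rcons s (z, c))) (z', a) &
    pact (jm k.+1) (\prod_(a <- S) ('X - (content a)%:P)) v = 0].
Proof.
move=> zz' Nv; have [wv tv] := Nv; have wsv : wt s v by case/wt_rcons: wv.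
have wg : wt s (g k v) by apply: wt_g; rewrite ?size_s.
have tg := t_g_left yh lt_k tv.
have [S [uS addS pS]] := sp (leqnn k) size_s vs' wg tg.
exists S; split=> // [a /addS|].
  by rewrite maya_rcons addable_jump_other // /apart /= eq_sym zz'.
pose N0 w := t k w = z' *: w /\ t k.+1 w = z *: w.
have sub0 : subspace N0 by apply: subspaceI; apply: subspace_eigen.
have jg w : N0 w -> jm k.+1 (g k w) = g k (jm k w).
  by case=> w1 w2; rewrite (jmS_g yh d0 lt_k w1 w2) (negbTE zz') scale0r addr0.
have jN0 w : N0 w -> N0 (jm k w).
  case=> w1 w2; rewrite /N0 !(jm_t yh d0 uniq_Z prod_Z) ?w1 ?w2 ?linearZ //; exact: ltnW.
have pact_g S' w : N0 w -> pact (jm k.+1) (\prod_(a <- S') ('X - (content a)%:P)) (g k w)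
    = g k (pact (jm k) (\prod_(a <- S') ('X - (content a)%:P)) w).
  elim: S' w => [|a S' IH] w Nw; first by rewrite !big_nil !pactC !scale1r.
  rewrite !pact_prod_cons jg // -linearZ -linearB IH //.
  exact: (subspaceB sub0 (jN0 _ Nw) (subspaceZ _ sub0 Nw)).
have -> : v = g k (g k v).
  by rewrite (g_square yh d0 lt_k (tk Nv) tv) eq_sym (negbTE zz') mulr0 scale0r addr0.
rewrite pact_g ?pS ?linear0 //; split=> //.
exact: (t_g_right yh lt_k (tk Nv)).
Qed.

Local Notation x := (jm k.+1).
Local Notation delta := (q - q^-1).

Let rel1 w : N z w -> jm k (g k w) = g k (x w) - (w + delta *: x w).
Proof.
move=> Nw; have [_ t1] := Nw.
by rewrite (g_jmS yh d0 uniq_Z prod_Z lt_k (tk Nw) t1) eqxx scale1r addrK.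
Qed.
Let rel2 w : N z w -> x (g k w) = content c *: g k w + (w + delta *: x w).
Proof.
move=> Nw; have [_ t1] := Nw.
by rewrite (jmS_g yh d0 lt_k (tk Nw) t1) eqxx scale1r (jk Nw) linearZ.
Qed.

(** The intertwining operator on [N]: it turns [jm k.+1] into [jm k]. *)
Let Phi : {linear V -> V} :=
  (g k \o (x \- content c \*: idfun)) \- (idfun \+ delta \*: x).
Let PhiE w : Phi w = g k (x w - content c *: w) - (w + delta *: x w).
Proof. by []. Qed.
Let Phi_x w : N z w -> jm k (Phi w) = Phi (x w).
Proof.
move=> Nw; have Nxw := jmN Nw.
have Nu := subspaceB (sN z) Nxw (subspaceZ (content c) (sN z) Nw).
have jl : jm k (w + delta *: x w) = content c *: w + delta *: (content c *: x w).
  by rewrite linearD linearZ /= (jk Nw) (jk Nxw).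
rewrite !PhiE [LHS]linearB /= jl (rel1 Nu) !(linearB, linearZ) /=.
rewrite -!addrA; do 2 congr (_ + _).
by lincomb w (x w) (x (x w)); ring.
Qed.
Let Phi_jm w : N z w -> jm k (g k w) - content c *: g k w = Phi w.
Proof. move=> Nw; have gZ : g k (content c *: w) = content c *: g k w by rewrite linearZ.
by rewrite rel1 // PhiE (linearB (g k)) /= gZ addrAC. Qed.

Let pact_Phi S w : N z w -> pact (jm k) (\prod_(a <- S) ('X - (content a)%:P)) (Phi w)
    = Phi (pact x (\prod_(a <- S) ('X - (content a)%:P)) w).
Proof.
elim: S w => [|a S IH] w Nw; first by rewrite !big_nil !pactC !scale1r.
rewrite !pact_prod_cons Phi_x // -linearZ -linearB IH //.
exact: (subspaceB (sN z) (jmN Nw) (subspaceZ _ (sN z) Nw)).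
Qed.

(* The root [c] is divided out: on [Phi w] the factor [jm k - c] is already
   present, because [Phi w = (jm k - c) (g k w)]. *)
Let split_Phi w : N z w -> exists S : seq int, [/\ uniq S, c \notin S,
    forall a, a \in S -> addable (maya s) (z, a) &
    Phi (pact x (\prod_(a <- S) ('X - (content a)%:P)) w) = 0].
Proof.
move=> Nw; have [ww tw] := Nw; have wsw : wt s w by case/wt_rcons: ww.
have wg : wt s (g k w) by apply: wt_g; rewrite ?size_s.
have tg := t_g_left yh lt_k tw.
have [S [uS addS pS]] := sp (leqnn k) size_s vs' wg tg.
exists (filter (predC1 c) S); split.
- by rewrite filter_uniq.
- by rewrite mem_filter /= eqxx.
- by move=> a; rewrite mem_filter => /andP[_ /addS].
rewrite -pact_Phi // -Phi_jm // -pact_prod_cons.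
have [cS|ncS] := boolP (c \in S).
  rewrite -rem_filter // -(perm_big _ (perm_to_rem cS)); exact: pS.
rewrite (_ : filter _ _ = S); last first.
  by apply/all_filterP/allP => a aS /=; apply: contraNneq ncS => <-.
by rewrite big_cons pactM pS linear0.
Qed.

(** On a vector with the letter [c] repeated, [Phi] is a non-zero scalar, while
    [c] is not among the roots of the polynomial whose value it kills. *)
Lemma repeat_exclusion w : N z w -> x w = content c *: w -> w = 0.
Proof.
move=> Nw xw; have [S [uS cS addS pS]] := split_Phi Nw.
move: pS; rewrite (pact_eigen _ xw) linearZ PhiE xw subrr linear0 sub0r /=.
rewrite scalerA -[X in X + _]scale1r -scalerDl content_affine // => /eqP.
rewrite scaler_eq0 oppr_eq0 scaler_eq0 expfz_eq0 (negbTE q0) andbF /=.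
case/orP=> [|/eqP//]; rewrite horner_prod prodf_seq_eq0 => /hasP[a aS /=].
rewrite hornerXsubC subr_eq0 => /eqP ca; case/negP: cS.
have dist : `|c - a| <= (size s).+1%:Z := addable_spread vs' addc (addS _ aS).
by rewrite (content_inj q0 qint_neq0 _ ca) //; lia.
Qed.

(** If [c + e] is not addable after [c], it was removable before, so the weight
    would end in [c + e], letters that commute with it, [c], [c + e]. *)
Lemma blocked_exclusion (e : int) w : e \in [:: 1; -1] -> N z w ->
  x w = content (c + e) *: w -> ~~ addable (maya (rcons s (z, c))) (z, c + e) -> w = 0.
Proof.
move=> e1 [ww tw] xw; rewrite maya_rcons => blk.
have [D1 D0] := blocked_removable e1 addc blk.
have [r [m [sE far]]] : exists r m : seq letter, s = r ++ (z, c + e) :: m /\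
    forall a, (z, a) \in m -> [&& a != c + e, a != c + e - 1 & a != c + e + 1].
  exact: removable_decomposition vs' D1 D0.
have sizeE : (size r + size m + 1 = k)%N by rewrite -size_s sE size_cat /= addn1 addnS.
have e1' : - e \in [:: 1; -1] by move: e1; rewrite !inE => /orP[]/eqP->.
apply: (@separated_exclusion m r z (c + e) (- e)) => //.
- by move: lt_k; rewrite -sizeE addn1 addn3.
- by move=> j; rewrite sizeE; apply: sp.
- by rewrite -sE.
have -> : r ++ (z, c + e) :: m ++ [:: (z, c + e - e); (z, c + e)] =
    rcons (rcons s (z, c)) (z, c + e).
  by rewrite addrK sE -!cats1 -!catA.
by apply/wt_rcons; rewrite size_rcons size_s.
Qed.

(** On the kernel of [Phi], the vectors [y], [z0 = (L_(k+1) - c) y] and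
    [h = g_k z0] span a space stable under [L_(k+1)], which has there the
    eigenvalues of contents [c], [c - 1] and [c + 1]. Those that are not addable
    are then discarded. *)
Lemma splits_step_same : N z v -> exists S : seq int, [/\ uniq S,
    forall a, a \in S -> addable (maya (rcons s (z, c))) (z, a) &
    pact x (\prod_(a <- S) ('X - (content a)%:P)) v = 0].
Proof.
move=> Nv; have [S [uS cS addS pS]] := split_Phi Nv.
set y := pact _ _ _ in pS.
have Ny : N z y := pact_stable _ (sN z) (@jmN z) Nv.
pose z0 := x y - content c *: y; pose h := y + delta *: x y.
have Nz0 : N z z0 := subspaceB (sN z) (jmN Ny) (subspaceZ _ (sN z) Ny).
have Nh : N z h := subspaceD (sN z) Ny (subspaceZ _ (sN z) (jmN Ny)).
have gz0 : g k z0 = h by apply/eqP; rewrite -subr_eq0 -pS PhiE.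
have z0E : x y - content c *: y = z0 by [].
clearbody z0 h.
have gh : g k h = z0 + delta *: h.
  have [_ tz] := Nz0.
  by rewrite -gz0 (g_square yh d0 lt_k (tk Nz0) tz) eqxx mulr1.
have xh := rel2 Nz0; rewrite gz0 in xh.
have xz0 := rel2 Nh; rewrite gh linearD linearZ /= xh in xz0.
have {xz0} xz0 : x z0 = content c *: z0 + q ^ (2 * c) *: h.
  rewrite -(content_affine q0) -[LHS](addrK (delta *: (content c *: h + (z0 + delta *: x z0)))).
  by rewrite xz0; lincomb z0 h (x z0); ring.
pose S2 := [:: c; c - 1; c + 1].
have pS2 : pact x (\prod_(a <- S2) ('X - (content a)%:P)) y = 0.
  rewrite !pact_prod_cons big_nil pactC scale1r z0E !(linearB, linearZ) /= xz0.
  rewrite !(linearD, linearZ) /= xh xz0 contentS // content_prev // -(content_affine q0).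
  by lincomb z0 h h; field.
pose good a := addable (maya (rcons s (z, c))) (z, a).
exists (filter good (S2 ++ S)); split.
- rewrite filter_uniq // cat_uniq uS /= !inE.
  have cn (e : int) : e \in [:: 1; -1] -> c + e \notin S.
    by move=> e1; apply/negP => /addS; rewrite (negbTE (addable_next e1 addc)).
  rewrite !andbT; apply/andP; split; first by lia.
  apply/hasPn => a aS; rewrite !inE !negb_or; apply/and3P; split.
  + by apply: contraNneq cS => <-.
  + by apply: contraTneq aS => ->; apply: (cn (- 1)).
  + by apply: contraTneq aS => ->; apply: (cn 1).
- by move=> a; rewrite mem_filter => /andP[].
apply: (pact_prod_filter (sN z) (@jmN z) Nv) => [|a w].
  by rewrite big_cat /= pactM.
rewrite mem_cat !inE => aS na Nw xw.
case/orP: aS => [/or3P[]/eqP aE|aS].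
- by move: xw; rewrite aE; apply: repeat_exclusion.
- by rewrite aE in na xw; apply: blocked_exclusion xw na.
- by rewrite aE in na xw; apply: blocked_exclusion xw na.
case/negP: na; rewrite /good maya_rcons addable_jump_other; first exact: addS.
rewrite /apart /= eqxx /=; apply/and3P; split.
- by apply: contraNneq cS => <-.
- apply: contraTneq aS => ->; apply/negP => /addS.
  by rewrite (negbTE (@addable_next _ _ _ _ (- 1) _ addc)).
- apply: contraTneq aS => ->; apply/negP => /addS.
  by rewrite (negbTE (@addable_next _ _ _ _ 1 _ addc)).
Qed.
End SplitsStep.

(** Each step compares the last letter of the weight with the colour to split. *)
Theorem jm_splits k : (k < n)%N -> splits k.
Proof.
elim/ltn_ind: k => -[|k] IH lt_k s v z size_s vs w tv.
  exists [:: 0]; split=> // [a|].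
    by rewrite inE => /eqP->; rewrite (size0nil size_s).
  by rewrite big_seq1 pactXsubC jm0 content0 scale0r subrr.
case/lastP: s size_s vs w => // s [z' c]; rewrite size_rcons => -[size_s] vs w.
have sp j : (j <= k)%N -> splits j by move=> le_j; apply: IH; lia.
have [e|ne] := eqVneq z z'; last exact: (splits_step_other lt_k sp size_s vs ne).
by move: tv; rewrite e => tv; apply: (splits_step_same lt_k sp size_s vs).
Qed.

End Weights.

(** * Simplicity of the modules generated by weight vectors *)

(** [chain g j m] is the product [g_j g_(j+1) ... g_(j+m-1)]; these are the
    coset representatives of one symmetric group modulo the next smaller one. *)
Fixpoint chain (V : Type) (g : nat -> V -> V) (j m : nat) (u : V) : V :=
  if m is m'.+1 then g j (chain g j.+1 m' u) else u.

Section Chains.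
Variables (K : fieldType) (V : lmodType K) (q : K) (d n : nat).
Variables (g t : nat -> {linear V -> V}).
Hypothesis yh : yh_operators q d n g t.

Local Notation chain := (chain (fun i => g i)).

Lemma chain_is_linear j m : linear (chain j m).
Proof. by move=> a u v; elim: m j => //= m IH j; rewrite IH linearP. Qed.
HB.instance Definition _ j m :=
  GRing.isLinear.Build K V V _ (chain j m) (chain_is_linear j m).

Lemma chainSr j m u : chain j m.+1 u = chain j m (g (j + m) u).
Proof. by elim: m j => [|m IH] j; rewrite ?addn0 //= addnS -addSn -IH. Qed.

Lemma chain_comm (h : V -> V) j m u :
  (forall i w, (j <= i < j + m)%N -> h (g i w) = g i (h w)) ->
  h (chain j m u) = chain j m (h u).
Proof.
elim: m j => [|m IH] j //= hg; rewrite hg; last by lia.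
by rewrite IH // => i w le_i; apply: hg; lia.
Qed.

Lemma g_chain_far i j m u : (i.+1 < j)%N -> (j + m < n)%N ->
  g i (chain j m u) = chain j m (g i u).
Proof. by move=> lt_ij lt_n; apply: chain_comm => k w le_k; apply: (yh_far yh); lia. Qed.

(** Conjugation by a cycle shifts the generators, by the braid relation. *)
Lemma g_chain_shift i j m u : (j <= i)%N -> (i.+1 < j + m)%N -> (j + m < n)%N ->
  g i.+1 (chain j m u) = chain j m (g i u).
Proof.
elim: m j => [|m IH] j le_ji lt_i lt_n; first by lia.
have [eij|nij] := eqVneq i j; last first.
  have far := yh_far yh (i := j) (j := i.+1).
  by rewrite /= -far; [rewrite IH //|..]; lia.
case: m lt_i lt_n {IH} => [|m] lt_i lt_n; first by lia.
have far := g_chain_far (i := j) (j := j.+2) (m := m) u.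
by rewrite /= eij -(yh_braid yh) ?far //; lia.
Qed.

Lemma t_chain l j m u : (l < n)%N -> (j + m < n)%N ->
  exists2 l', (l' < n)%N & t l (chain j m u) = chain j m (t l' u).
Proof.
elim: m l j => [|m IH] l j lt_l lt_n /=; first by exists l.
have lt_j : (j.+1 < n)%N by lia.
have [|l' lt_l' e] := IH (swap_pos j l) j.+1 (swap_pos_lt lt_j lt_l); first by lia.
by exists l'; rewrite // (yh_tg yh) // e.
Qed.

End Chains.

Lemma swap_pos_gt i j : (i.+1 < j)%N -> swap_pos i j = j.
Proof. by move=> lt_ij; rewrite /swap_pos !gtn_eqF // ltnW. Qed.

Section Simplicity.
Variables (K : fieldType) (V : lmodType K) (q : K) (d n : nat).
Variables (g t : nat -> {linear V -> V}).
Hypothesis yh : yh_operators q d n g t.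
Hypothesis d0 : d%:R != 0 :> K.
Variable Z : seq K.
Hypothesis uniq_Z : uniq Z.
Hypothesis prod_Z : \prod_(z <- Z) ('X - z%:P) = 'X^d - 1.
Hypothesis q0 : q != 0.
Hypothesis qint_neq0 : forall m, (0 < m <= n)%N -> \sum_(0 <= k < m) q ^+ (2 * k) != 0.

Local Notation content := (content q).
Local Notation jm := (jm d g t).
Local Notation idem := (colour_idem d t).
Local Notation wt := (wt q d g t).
Local Notation letter := (K * int)%type.
Local Notation chain := (chain (fun i => g i)).
Implicit Types (s r : seq letter) (x y : letter) (N : V -> Prop).

Definition stable_t N := forall j v, (j < n)%N -> N v -> N (t j v).
Definition stable_g k N := forall i v, (i < k)%N -> N v -> N (g i v).

Lemma stable_idem N i j v : subspace N -> stable_t N -> (i < n)%N -> (j < n)%N ->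
  N v -> N (idem i j v).
Proof.
move=> sN tN lt_i lt_j Nv; apply: (subspaceZ _ sN); apply: (subspace_sum sN) => a _.
have itN l b u : (l < n)%N -> N u -> N (iter b (t l) u).
  by move=> lt_l Nu; elim: b => //= b IH; apply: tN.
exact/itN/itN.
Qed.

Lemma stable_jm N k j v : subspace N -> stable_t N -> stable_g k N -> (k < n)%N ->
  (j <= k)%N -> N v -> N (jm j v).
Proof.
move=> sN tN gN lt_k; elim: j v => [|j IH] v le_j Nv; first by rewrite jm0; case: sN.
rewrite jmS; apply: subspaceD => //; first last.
  by apply: (stable_idem sN tN); [lia|lia|apply: gN].
by apply: (gN) => //; apply: IH; [lia|apply: (gN)].
Qed.

Lemma wt_split N m v : subspace N -> stable_t N ->
  (forall j u, (j < m)%N -> N u -> N (jm j u)) -> (m <= n)%N -> N v ->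
  sums (fun u => N u /\ exists s, [/\ size s = m, valid s & wt s u]) v.
Proof.
move=> sN tN; elim: m v => [|m IH] v jN le_m Nv.
  by apply: sums1; split=> //; exists [::].
have jN' j u : (j < m)%N -> N u -> N (jm j u) by move=> lt_j; apply: jN; apply: ltnW.
apply: sums_bind (IH v jN' (ltnW le_m) Nv) _ => u [Nu [s [size_s vs wu]]].
pose N1 w := N w /\ wt s w.
have sN1 : subspace N1 := subspaceI sN (wt_subspace _ _ _ _ _).
have le_s : (size s <= n)%N by rewrite size_s ltnW.
have tN1 w : N1 w -> N1 (t m w).
  by case=> Nw ww; split; [apply: tN|apply: (wt_t yh d0 uniq_Z prod_Z)].
apply: sums_bind (t_split yh uniq_Z prod_Z le_m sN1 tN1 (conj Nu wu)) _ => w [N1w [z tw]].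
have [S [uS addS pS]] := jm_splits yh d0 uniq_Z prod_Z q0 qint_neq0 le_m size_s vs (proj2 N1w) tw.
pose N2 w := N1 w /\ t m w = z *: w.
have sN2 : subspace N2 := subspaceI sN1 (subspace_eigen _ _).
have jN2 w' : N2 w' -> N2 (jm m w').
  case=> -[Nw' ww'] tw'; split; last by rewrite (jm_t yh d0 uniq_Z prod_Z) // tw' linearZ.
  by split; [apply: jN|apply: (wt_jm yh d0 uniq_Z prod_Z)].
have umS : uniq (map content S).
  rewrite map_inj_in_uniq // => a b aS bS; apply: (content_inj q0 qint_neq0).
  have dist : `|a - b| <= (size s).+1%:Z := addable_spread vs (addS _ aS) (addS _ bS).
  by rewrite size_s in dist; clear -dist le_m; lia.
have := eigen_split umS sN2 jN2 (conj N1w tw); rewrite big_map => /(_ pS) Sw.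
apply: sums_bind Sw _ => w' [[[Nw' ww'] tw'] [c /mapP[a aS ->] jw']].
apply: sums1; split=> //; exists (rcons s (z, a)); rewrite size_rcons size_s; split=> //.
  by rewrite valid_rcons vs addS.
by apply/wt_rcons; rewrite size_s.
Qed.

Section WeightVector.
Variables (alpha : seq letter) (v : V).
Hypotheses (size_alpha : size alpha = n) (v_alpha : valid alpha) (wv : wt alpha v).

(** The span of [v] under [g_0, ..., g_(k-1)]: products of coset
    representatives are a basis of the Hecke algebra. *)
Fixpoint tower (k : nat) (u : V) : Prop :=
  if k is k'.+1 then exists z : nat -> V, (forall j, tower k' (z j)) /\
    u = \sum_(j < k'.+2) chain j (k'.+1 - j) (z j)
  else exists c, u = c *: v.

Lemma tower_subspace k : subspace (tower k).
Proof.
elim: k => [|k [T0 TP]].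
  split=> [|a u w [b ->] [c ->]]; first by exists 0; rewrite scale0r.
  by exists (a * b + c); rewrite scalerDl scalerA.
split=> [|a u w [x [Tx ->]] [y [Ty ->]]].
  by exists (fun=> 0); split=> //; rewrite big1 // => j _; rewrite linear0.
exists (fun j => a *: x j + y j); split=> [j|]; first exact: TP (Tx j) (Ty j).
by rewrite scaler_sumr -big_split; apply: eq_bigr => j _; rewrite linearP.
Qed.

Lemma tower_chain k j u : (j <= k.+1)%N -> tower k u -> tower k.+1 (chain j (k.+1 - j) u).
Proof.
move=> le_j Tu; exists (fun i => if i == j then u else 0); split=> [i|].
  by case: eqP => // _; case: (tower_subspace k).
rewrite (bigD1 (Ordinal (le_j : j < k.+2)%N)) //= eqxx big1 ?addr0 // => i ij.
by case: eqP => [e|_]; [case/eqP: ij; apply: val_inj|rewrite linear0].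
Qed.

Lemma tower_up k u : tower k u -> tower k.+1 u.
Proof. by move=> /(tower_chain (leqnn k.+1)) Tu; rewrite subnn in Tu; exact: Tu. Qed.

Lemma tower_ind k (P : V -> Prop) : subspace P ->
  (forall j u, (j <= k.+1)%N -> tower k u -> P (chain j (k.+1 - j) u)) ->
  forall u, tower k.+1 u -> P u.
Proof.
move=> sP PC u [z [Tz ->]]; apply: (subspace_sum sP) => -[j lt_j] _ /=.
exact: (PC j _ lt_j (Tz j)).
Qed.

Lemma tower_t k : (k < n)%N -> stable_t (tower k).
Proof.
elim: k => [|k IH] lt_k j u lt_j.
  case=> c ->; rewrite linearZ /=; have lt_ja : (j < size alpha)%N by rewrite size_alpha.
  by have [-> _] := wv lt_ja; rewrite scalerA; eexists.
elim/tower_ind => [|i w le_i Tw].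
  have sT := tower_subspace k.+1; split=> [|a x y]; first by rewrite linear0; case: sT.
  by rewrite linearP; case: sT => _; apply.
have [|j' lt_j' ->] := t_chain yh (j := i) (m := k.+1 - i) w lt_j; first by rewrite subnKC.
by apply/tower_chain/IH => //; apply: ltnW.
Qed.

(** Multiplying a coset representative by a generator gives another one, or
    shortens it by the quadratic relation, or moves the generator to its right. *)
Lemma tower_g k : (k < n)%N -> stable_g k (tower k).
Proof.
elim: k => [|k IH] lt_k i u lt_i //.
have sT := tower_subspace k.+1.
elim/tower_ind => [|j w le_j Tw].
  split=> [|a x y]; first by rewrite linear0; case: sT.
  by rewrite linearP; case: sT => _; apply.
have Tg l : (l < k)%N -> tower k (g l w) by move=> lt_l; apply: IH => //; apply: ltnW.
have lt_jn : (j + (k.+1 - j) < n)%N by rewrite subnKC.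
case: (ltngtP i j) => [lt_ij|lt_ji|eij].
- have [eij|nij] := eqVneq j i.+1; last first.
    have lt_ij' : (i.+1 < j)%N by rewrite ltn_neqAle eq_sym nij.
    have lt_ik : (i < k)%N := leq_trans lt_ij' le_j.
    rewrite (g_chain_far yh) //; apply: tower_chain => //; exact: Tg.
  rewrite eij subSS; have := tower_chain (ltnW (lt_i : i < k.+1)%N) Tw.
  by rewrite subSn.
- case: i lt_i lt_ji => [|i] lt_i lt_ji; first by [].
  by rewrite (g_chain_shift yh) ?subnKC //; apply: tower_chain => //; apply: Tg.
rewrite -eij in le_j *; rewrite subSn //=.
set W := chain i.+1 (k - i) w.
have TW : tower k.+1 W by have := tower_chain lt_i Tw; rewrite subSS.
have TgW : tower k.+1 (g i W) by have := tower_chain (ltnW (lt_i : i < k.+1)%N) Tw; rewrite subSn.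
have lt_in : (i.+1 < n)%N by apply: leq_ltn_trans lt_i _.
rewrite (yh_quad yh) //; apply: (subspaceD sT TW); apply: (subspaceZ _ sT).
by apply: stable_idem TgW => //; [exact: tower_t|exact: ltnW].
Qed.

Lemma tower_stable : (0 < n)%N -> [/\ subspace (tower n.-1), stable_t (tower n.-1),
  stable_g n.-1 (tower n.-1) & tower n.-1 v].
Proof.
move=> n0; have lt_n : (n.-1 < n)%N by rewrite prednK.
split; [exact: tower_subspace|exact: tower_t|exact: tower_g|].
by elim: n.-1 => [|k IH]; [exists 1; rewrite scale1r|apply: tower_up].
Qed.

(** The generators in [tower k] do not move the letters beyond position [k]. *)
Lemma tower_letter k l u : (k < l < n)%N -> tower k u ->
  t l u = (nth (0, 0) alpha l).1 *: u /\ jm l u = content (nth (0, 0) alpha l).2 *: u.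
Proof.
elim: k u => [|k IH] u /andP[lt_kl lt_l].
  have lt_la : (l < size alpha)%N by rewrite size_alpha.
  have [tv jv] := wv lt_la; case=> c ->.
  by rewrite !linearZ /= tv jv; split; lincomb v v v; ring.
elim/tower_ind => [|i w le_i Tw].
  exact: subspaceI (subspace_eigen _ _) (subspace_eigen _ _).
have [tw jw] := IH w ltac:(by rewrite ltnW) Tw.
have comm i' w' : (i <= i' < i + (k.+1 - i))%N ->
    t l (g i' w') = g i' (t l w') /\ jm l (g i' w') = g i' (jm l w').
  rewrite subnKC // => /andP[_ lt_i']; have lt_i'l : (i'.+1 < l)%N by apply: leq_trans lt_kl.
  have lt_i'n : (i'.+1 < n)%N := ltn_trans lt_i'l lt_l.
  rewrite (jm_g_far yh d0 uniq_Z prod_Z) ?lt_i'l ?orbT //.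
  by rewrite (yh_tg yh) // swap_pos_gt.
split.
  by rewrite (chain_comm (h := t l)) ?tw ?linearZ // => i' w' le_i'; case: (comm i' w' le_i').
by rewrite (chain_comm (h := jm l)) ?jw ?linearZ // => i' w' le_i'; case: (comm i' w' le_i').
Qed.

Definition other_letter l w := exists b : bool, exists c : K,
  c != (if b then (nth (0, 0) alpha l).1 else content (nth (0, 0) alpha l).2) /\
  (if b then t l else jm l) w = c *: w.

(** In [chain j m (g_k x)], write [g_k] as an intertwiner plus a scalar. The
    scalar term lies in [tower k]; the intertwiner brings the last letter of
    [x] to position [k + 1], where it differs from the letter of [alpha] because
    consecutive letters of a valid weight are different. *)
Lemma tower_letter_split k u : (k.+1 < n)%N -> tower k.+1 u ->
  exists2 y, tower k y & sums (other_letter k.+1) (u - y).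
Proof.
move=> lt_k; have sT := tower_subspace k.
have tT := tower_t (ltnW lt_k); have gT := tower_g (ltnW lt_k).
have chainT j m w : (j + m <= k)%N -> tower k w -> tower k (chain j m w).
  elim: m j => [|m IH] j //= le_k Tw; apply: (gT) => //; first by lia.
  by apply: IH => //; lia.
elim/tower_ind => [|j w le_j Tw].
  split=> [|a x y [x' Tx Sx] [y' Ty Sy]].
    by exists 0; [case: sT|rewrite subr0; apply: Sums0].
  exists (a *: x' + y'); first by case: sT => _; apply.
  rewrite opprD addrACA -scalerBr; apply: sums_add => //.
  elim: Sx => [|z w [b [c [cb fz]]] _ IH]; first by rewrite scaler0; apply: Sums0.
  rewrite scalerDr; apply: SumsD => //; exists b, c; split=> //.
  by case: b {cb} fz => fz; rewrite linearZ /= fz !scalerA mulrC.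
have [->|nj] := eqVneq j k.+1; first by exists w; rewrite // subnn /= subrr; apply: Sums0.
have {nj} le_jk : (j <= k)%N by rewrite -ltnS ltn_neqAle nj.
rewrite subSn // chainSr subnKC //.
have jT l u' : (l < k.+1)%N -> tower k u' -> tower k (jm l u').
  by move=> lt_l; apply: stable_jm tT gT _ _ => //; apply: ltnW.
have := wt_split sT tT jT (ltnW lt_k) Tw.
elim=> [|x y [Tx [s [size_s vs wx]]] _ [y' Ty' Sy']].
  by exists 0; [case: sT|rewrite !linear0 addr0; apply: Sums0].
have [->|x0] := eqVneq x 0; first by exists y' => //; rewrite add0r.
have lt_kk : (k < k.+1 < n)%N by rewrite ltnSn.
have [tx jx] := tower_letter lt_kk Tx.
set a := nth _ _ _ in tx jx.
case/lastP: s size_s vs wx => // s b; rewrite size_rcons => -[size_s] vs wx.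
have size_sb : size (rcons s b) = k.+1 by rewrite size_rcons size_s.
have sp := jm_splits yh d0 uniq_Z prod_Z q0 qint_neq0 lt_k; rewrite -size_sb in sp tx jx.
have [c addc ac] := splits_eigen sp vs wx x0 tx jx.
have wab : wt (s ++ [:: b; (a.1, c)]) x.
  by rewrite -cat_rcons cats1; apply/wt_rcons; rewrite /= -ac.
have vab : valid (s ++ [:: b; (a.1, c)]).
  by rewrite -cat_rcons cats1 valid_rcons vs.
have le_n : (size s + size (Nil letter) + 2 <= n)%N by rewrite size_s addn0 addn2.
have := wt_inter_valid yh d0 uniq_Z prod_Z q0 qint_neq0 le_n vab wab.
set u' := inter _ _ _ _ _ _; rewrite -cat_rcons cats1 => /wt_rcons[_].
rewrite size_rcons size_s => tu' ju'.
have gE : g k x = u' + rho q b (a.1, c) *: x by rewrite /u' /inter size_s subrK.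
exists (rho q b (a.1, c) *: chain j (k - j) x + y').
  by case: sT => _; apply => //; apply: chainT; rewrite // subnKC.
have -> : chain j (k - j) (g k (x + y)) = chain j (k - j) u' +
    rho q b (a.1, c) *: chain j (k - j) x + chain j (k - j) (g k y).
  by rewrite linearD linearD gE linearD linearZ.
have -> : forall A B C D : V, A + B + C - (B + D) = A + (C - D).
  by move=> A B C D; rewrite [A + B]addrC -[B + A + C]addrA opprD addrACA subrr add0r addrA.
apply: SumsD => //.
have comm i w' : (j <= i < j + (k - j))%N ->
    t k.+1 (g i w') = g i (t k.+1 w') /\ jm k.+1 (g i w') = g i (jm k.+1 w').
  rewrite subnKC // => /andP[_ lt_ik]; have lt_i : (i.+1 < n)%N by lia.
  have far : (k.+1 < i)%N || (i.+1 < k.+1)%N by apply/orP; right.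
  rewrite (jm_g_far yh d0 uniq_Z prod_Z) //.
  by rewrite (yh_tg yh) // swap_pos_gt.
have tc : t k.+1 (chain j (k - j) u') = b.1 *: chain j (k - j) u'.
  by rewrite (chain_comm (h := t k.+1)) ?tu' ?linearZ // => l w' le_l; case: (comm l w' le_l).
have jc : jm k.+1 (chain j (k - j) u') = content b.2 *: chain j (k - j) u'.
  by rewrite (chain_comm (h := jm k.+1)) ?ju' ?linearZ // => l w' le_l; case: (comm l w' le_l).
have [ba1|ba1] := eqVneq b.1 a.1; last by exists true, b.1.
exists false, (content b.2); split=> //.
have [bc le_bc] : b.2 != c /\ `|b.2 - c| <= (size s).+1%:Z := valid_adjacent vab ba1.
rewrite -/a ac; apply: contraNneq bc => /(content_inj q0 qint_neq0) -> //.
by rewrite size_s in le_bc; clear -le_bc lt_k; lia.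
Qed.

Lemma tower_multiplicity k u : (k < n)%N -> tower k u ->
  (forall j, (j <= k)%N -> t j u = (nth (0, 0) alpha j).1 *: u /\
     jm j u = content (nth (0, 0) alpha j).2 *: u) -> exists c, u = c *: v.
Proof.
elim: k u => [|k IH] u lt_k //= Tu wu.
have [y Ty Su] := tower_letter_split lt_k Tu.
have lt_kk : (k < k.+1 < n)%N by rewrite ltnSn.
have [ty jy] := tower_letter lt_kk Ty.
have [tu ju] := wu k.+1 (leqnn _).
pose f (b : bool) : {linear V -> V} := if b then t k.+1 else jm k.+1.
pose lam (b : bool) := if b then (nth (0, 0) alpha k.+1).1
                       else content (nth (0, 0) alpha k.+1).2.
have uy : u - y = 0.
  apply: (@eigen_independent _ _ _ f lam (u - y) (u - y)) => //.
  - by case=> -[] w //=; rewrite (jm_t yh d0 uniq_Z prod_Z).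
  - by case; rewrite /= linearB ?tu ?ty ?ju ?jy scalerBr.
have -> : u = y by apply/eqP; rewrite -subr_eq0 uy.
apply: IH (ltnW lt_k) Ty _ => j le_j.
have -> : y = u by apply/esym/eqP; rewrite -subr_eq0 uy.
exact/wu/leqW.
Qed.

Definition generated u := forall N, subspace N -> stable_t N -> stable_g n.-1 N -> N v -> N u.

(** The letters of [alpha] force a vector of the tower down one step at a time,
    until it is a multiple of [v]. *)
Lemma generated_multiplicity u : (0 < n)%N -> generated u -> wt alpha u ->
  exists c, u = c *: v.
Proof.
move=> n0 Gu wu; have [sT tT gT Tv] := tower_stable n0.
have lt_n : (n.-1 < n)%N by rewrite prednK.
apply: (tower_multiplicity lt_n (Gu _ sT tT gT Tv)) => j le_j.
by apply: wu; rewrite size_alpha; apply: leq_ltn_trans lt_n.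
Qed.

Hypothesis v0 : v != 0.

(** Only exchanges of letters that are apart are used, where the intertwiner is
    invertible. *)
Inductive reach : seq letter -> V -> Prop :=
| Reach0 : reach alpha v
| ReachS r x y s u of reach (r ++ [:: x, y & s]) u & apart x y :
    reach (r ++ [:: y, x & s]) (inter q g (size r) x y u).

Lemma valid_cat2 r x y s : valid (r ++ [:: x, y & s]) -> valid (r ++ [:: x; y]).
Proof. by move=> vs; apply: (valid_cat (r := s)); rewrite -catA. Qed.

Lemma reachP s u : reach s u -> [/\ size s = n, valid s, wt s u & u != 0].
Proof.
elim=> // r x y {}s {}u _ [size_s vs wu u0] xy.
have le_n : (size r + size s + 2 <= n)%N by rewrite -size_s size_cat /=; lia.
split; first by rewrite -size_s !size_cat.
- exact: valid_swap vs.
- exact: (wt_inter_valid yh d0 uniq_Z prod_Z q0 qint_neq0 le_n (valid_cat2 vs) wu).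
  have le_n2 : (size r + 2 <= n)%N by apply: leq_trans le_n; rewrite addnAC leq_addr.
  exact: (inter_neq0 yh d0 uniq_Z q0 qint_neq0 le_n2 (valid_cat2 vs) xy wu u0).
Qed.

Definition reach_span := sums (fun w => exists c s u, reach s u /\ w = c *: u).

Lemma reach_spanZ c u : reach_span u -> reach_span (c *: u).
Proof.
elim=> [|x y [a [s [w [Rw ->]]]] _ IH]; first by rewrite scaler0; apply: Sums0.
by rewrite scalerDr; apply: SumsD => //; exists (c * a), s, w; rewrite scalerA.
Qed.

Lemma reach_span_subspace : subspace reach_span.
Proof.
by split=> [|a u w Su Sw]; [apply: Sums0|apply: sums_add => //; apply: reach_spanZ].
Qed.

Lemma reach_span1 s u : reach s u -> reach_span u.
Proof. by move=> Ru; apply: sums1; exists 1, s, u; rewrite scale1r. Qed.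

Lemma reach_span_t : stable_t reach_span.
Proof.
move=> j u lt_j; elim=> [|x y [a [s [w [Rw ->]]]] _ IH].
  by rewrite linear0; apply: Sums0.
rewrite linearD; apply: sums_add => //; have [size_s _ ww _] := reachP Rw.
have [tw _] := ww j ltac:(by rewrite size_s); rewrite linearZ /= tw.
by do 2 apply: reach_spanZ; apply: reach_span1 Rw.
Qed.

(** Two consecutive letters either are apart, and the intertwiner reaches a new
    vector, or are on neighbouring diagonals, and it vanishes. *)
Lemma reach_span_g : stable_g n.-1 reach_span.
Proof.
move=> i u lt_i'; have lt_i : (i.+1 < n)%N by lia.
elim=> [|w y' [a [s [u' [Ru ->]]]] _ IH]; first by rewrite linear0; apply: Sums0.
rewrite linearD; apply: sums_add => //; rewrite linearZ; apply: reach_spanZ.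
have [size_s vs wu u0] := reachP Ru.
have sE : s = take i s ++ [:: nth (0, 0) s i, nth (0, 0) s i.+1 & drop i.+2 s].
  by rewrite -!drop_nth ?size_s ?cat_take_drop // ltnW.
have size_r : size (take i s) = i by rewrite size_takel // size_s; apply/ltnW/ltnW.
move: sE size_r; set r := take i s; set x := nth _ s i; set y := nth _ s i.+1.
set s' := drop _ _ => sE size_r; rewrite sE in vs wu Ru.
have gE : g i u' = inter q g (size r) x y u' + rho q x y *: u'.
  by rewrite /inter size_r subrK.
have Su' : reach_span (rho q x y *: u') := reach_spanZ _ (reach_span1 Ru).
rewrite gE; apply: sums_add => //.
have [xy|nxy] := boolP (apart x y); first exact: reach_span1 (ReachS Ru xy).
have x1 : x.1 = y.1 by apply/eqP; move: nxy; rewrite /apart negb_or negbK => /andP[].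
have [xy2 _] := valid_adjacent vs x1.
have [e e1 y2] : exists2 e : int, e \in [:: 1; -1] & y.2 = x.2 + e.
  move: nxy; rewrite /apart x1 eqxx /= eq_sym xy2 /= negb_and !negbK.
  by case/orP=> /eqP->; [exists (-1)|exists 1].
have yE : y = (x.1, x.2 + e) by rewrite -y2 x1 -surjective_pairing.
have le_n : (size r + size s' + 2 <= n)%N.
  by rewrite -size_s sE size_cat /=; clear; lia.
rewrite yE [x in inter _ _ _ x]surjective_pairing.
rewrite (inter_eq0 yh d0 uniq_Z prod_Z q0 qint_neq0 le_n e1); first exact: Sums0.
- by apply: (jm_splits yh d0 uniq_Z prod_Z q0 qint_neq0); rewrite size_r ltnW.
- by rewrite -surjective_pairing; apply: (valid_cat (r := y :: s')); rewrite cat_rcons.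
- by rewrite -surjective_pairing -yE.
Qed.

Definition eigenvalue_at s (i : 'I_n * bool) : K :=
  if i.2 then (nth (0, 0) s i.1).1 else content (nth (0, 0) s i.1).2.
Definition operator_at (i : 'I_n * bool) : {linear V -> V} :=
  if i.2 then t i.1 else jm i.1.

Lemma operator_at_wt s u i : size s = n -> wt s u -> operator_at i u = eigenvalue_at s i *: u.
Proof.
move=> size_s wu; have lt_i : (i.1 < size s)%N by rewrite size_s.
by have [tu ju] := wu _ lt_i; rewrite /operator_at /eigenvalue_at; case: i.2.
Qed.

Lemma operator_at_comm i j u :
  operator_at i (operator_at j u) = operator_at j (operator_at i u).
Proof.
rewrite /operator_at; case: i j => [i []] [j []] /=.
- exact: (yh_tt yh).
- by rewrite (jm_t yh d0 uniq_Z prod_Z).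
- by rewrite (jm_t yh d0 uniq_Z prod_Z).
- by rewrite (jm_comm yh d0 uniq_Z prod_Z).
Qed.

Lemma first_difference s r : size s = size r -> s != r -> exists p x y s' r',
  [/\ s = p ++ x :: s', r = p ++ y :: r' & x != y].
Proof.
elim: s r => [|x s IH] [|y r] //= [] size_sr ne.
have [exy|nxy] := eqVneq x y; last by exists [::], x, y, s, r.
have [|p [x' [y' [s' [r' [-> -> nxy]]]]]] := IH r size_sr.
  by apply: contraNneq ne => ->; rewrite exy.
by exists (x :: p), x', y', s', r'; rewrite exy.
Qed.

(** Distinct weights are separated by a single operator: where they differ
    first, both letters can be added to the same diagram. *)
Lemma weights_separated s r : size s = n -> size r = n -> valid s -> valid r -> s != r ->
  exists i, eigenvalue_at s i != eigenvalue_at r i.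
Proof.
move=> size_s size_r vs vr ne.
have [|p [x [y [s' [r' [sE rE nxy]]]]]] := first_difference _ ne; first by rewrite size_s.
have lt_p : (size p < n)%N by rewrite -size_s sE size_cat /= addnS ltnS leq_addr.
have [e1|n1] := eqVneq x.1 y.1; last first.
  by exists (Ordinal lt_p, true); rewrite /eigenvalue_at /= sE rE !nth_cat ltnn subnn.
exists (Ordinal lt_p, false); rewrite /eigenvalue_at /= sE rE !nth_cat ltnn subnn /=.
have vpx : valid (rcons p x) by apply: (valid_cat (r := s')); rewrite cat_rcons -sE.
have vpy : valid (rcons p y) by apply: (valid_cat (r := r')); rewrite cat_rcons -rE.
move: vpx vpy; rewrite !valid_rcons => /andP[vp ax] /andP[_ ay].
have {}ax : addable (maya p) (x.1, x.2) by rewrite -surjective_pairing.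
have {}ay : addable (maya p) (x.1, y.2) by rewrite e1 -surjective_pairing.
have dist : `|x.2 - y.2| <= (size p).+1%:Z := addable_spread vp ax ay.
apply: contraNneq nxy => /(content_inj q0 qint_neq0) xy2; apply/eqP.
rewrite [x]surjective_pairing [y]surjective_pairing e1 xy2 //.
by clear -dist lt_p; lia.
Qed.

(** An invertible intertwiner can be undone inside any submodule. *)
Lemma reach_back N s u w : subspace N -> stable_g n.-1 N -> reach s w ->
  N u -> u != 0 -> wt s u -> exists u', [/\ N u', u' != 0 & wt alpha u'].
Proof.
move=> sN gN R; elim: R u => [|r x y s' w' R IH xy] u Nu u0 wu; first by exists u.
have [size_s vs _ _] := reachP (ReachS R xy).
have yx : apart y x by rewrite apart_sym.
have le_n : (size r + size s' + 2 <= n)%N.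
  by rewrite -size_s size_cat /=; clear; lia.
have le_n2 : (size r + 2 <= n)%N by apply: leq_trans le_n; rewrite addnAC leq_addr.
apply: (IH (inter q g (size r) y x u)).
- apply: (subspaceB sN); last exact: subspaceZ.
  by apply: (gN) => //; clear -le_n2; lia.
- exact: (inter_neq0 yh d0 uniq_Z q0 qint_neq0 le_n2 (valid_cat2 vs) yx wu u0).
- exact: (wt_inter_valid yh d0 uniq_Z prod_Z q0 qint_neq0 le_n (valid_cat2 vs) wu).
Qed.

Lemma sums_neq0 (Q : V -> Prop) u : sums Q u -> u != 0 -> exists2 w, Q w & w != 0.
Proof.
elim=> [|x y Qx _ IH]; first by rewrite eqxx.
by have [->|x0] := eqVneq x 0; [rewrite add0r|exists x].
Qed.

(** A weight vector of [N] has, by independence, the weight of a reached vector;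
    undoing the intertwiners brings it to the weight of [v], hence to a multiple
    of [v] by multiplicity one. *)
Theorem generated_simple N u : (0 < n)%N -> subspace N -> stable_t N -> stable_g n.-1 N ->
  (forall w, N w -> generated w) -> N u -> u != 0 -> N v.
Proof.
move=> n0 sN tN gN genN Nu u0.
have lt_n : (n.-1 < n)%N by rewrite prednK.
have jN j w : (j < n)%N -> N w -> N (jm j w).
  by move=> lt_j; apply: stable_jm tN gN _ _ => //; rewrite -ltnS prednK.
have [w [Nw [s [size_s vs ww]]] w0] := sums_neq0 (wt_split sN tN jN (leqnn n) Nu) u0.
have Rw : reach_span w :=
  genN w Nw _ reach_span_subspace reach_span_t reach_span_g (reach_span1 Reach0).
have [w' Rw'] : exists w', reach s w'.
  apply: contrapT => noR; case/eqP: w0.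
  apply: (@eigen_independent _ _ _ operator_at (eigenvalue_at s) w w) => //.
  - exact: operator_at_comm.
  - by move=> i; apply: operator_at_wt.
  apply: sums_bind Rw _ => x [c [r [y [Ry ->]]]]; apply: sums1.
  have [size_r vr wy _] := reachP Ry.
  have ne : r != s by apply: contra_notN noR => /eqP <-; exists y.
  have [i ri] := weights_separated size_r size_s vr vs ne.
  exists i, (eigenvalue_at r i); split=> //.
  by rewrite linearZ /= (operator_at_wt _ size_r wy) !scalerA mulrC.
have [u' [Nu' u'0 wu']] := reach_back sN gN Rw' Nw w0 ww.
have [c u'E] := generated_multiplicity n0 (genN _ Nu') wu'.
have c0 : c != 0 by apply: contraNneq u'0 => c0; rewrite u'E c0 scale0r.
by rewrite -[v](scalerK c0) -u'E; apply: subspaceZ.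
Qed.

End WeightVector.
End Simplicity.

(** * The symmetriser and the action on words *)

Section Symmetriser.
Variables (K : fieldType) (V : lmodType K) (q : K) (d n : nat).
Variables (g t : nat -> {linear V -> V}).

Local Notation chain := (chain (fun i => g i)).

Definition colour_average j (v : V) : V := d%:R^-1 *: \sum_(0 <= s < d) iter s (t j) v.
Fixpoint colour_symmetriser k (v : V) : V :=
  if k is k'.+1 then colour_average k' (colour_symmetriser k' v) else v.
Definition coset_sum k (v : V) : V := \sum_(j < k.+1) q ^+ (k - j) *: chain j (k - j) v.

(** The sum of all [q^(length w) g_w], times the projection on the trivial
    character of the [t_j]. *)
Fixpoint symmetriser k (v : V) : V :=
  if k is k'.+1 then coset_sum k' (symmetriser k' v) else colour_symmetriser n v.

Definition t_invariant (v : V) := forall j, (j < n)%N -> t j v = v.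

Hypothesis yh : yh_operators q d n g t.
Hypothesis d0 : d%:R != 0 :> K.
Hypothesis q0 : q != 0.

Lemma t_average j v : (j < n)%N -> t j (colour_average j v) = colour_average j v.
Proof.
move=> lt_j; rewrite /colour_average linearZ linear_sum /=; congr (_ *: _).
apply: (addrI (iter 0 (t j) v)); rewrite -(big_nat_recl d 0 (fun s => iter s (t j) v)) //.
by rewrite big_nat_recr //= (yh_order yh) // addrC.
Qed.

Lemma t_average_comm i j v : (i < n)%N -> (j < n)%N ->
  t i (colour_average j v) = colour_average j (t i v).
Proof.
move=> lt_i lt_j; rewrite /colour_average linearZ linear_sum /=; congr (_ *: _).
apply: eq_bigr => s _; elim: s => //= s <-; exact: (yh_tt yh).
Qed.

Lemma colour_symmetriser_invariant v : t_invariant (colour_symmetriser n v).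
Proof.
suff inv k i : (k <= n)%N -> (i < k)%N -> t i (colour_symmetriser k v) = colour_symmetriser k v.
  by move=> j; apply: inv.
elim: k i => // k IH i lt_k; rewrite ltnS leq_eqVlt => /predU1P[->|lt_i] /=.
  exact: t_average.
by rewrite t_average_comm ?IH //; lia.
Qed.

Lemma t_invariant_chain j m v : (j + m < n)%N -> t_invariant v -> t_invariant (chain j m v).
Proof.
by move=> lt_n inv l lt_l; have [l' lt_l' ->] := t_chain yh v lt_l lt_n; rewrite inv.
Qed.

Lemma t_invariant_sum k v : (k < n)%N -> t_invariant v -> t_invariant (coset_sum k v).
Proof.
move=> lt_k inv l lt_l; rewrite /coset_sum linear_sum; apply: eq_bigr => -[j lt_j] _ /=.
by rewrite linearZ /= t_invariant_chain // subnKC.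
Qed.

(** The generator [g_i] exchanges the terms [i] and [i + 1] of the coset sum up
    to the quadratic relation, and moves to the right through the others. *)
Lemma g_coset_sum k i v : (k < n)%N -> t_invariant v ->
  (forall l, (l.+1 < k)%N -> g l v = q *: v) -> (i < k)%N ->
  g i (coset_sum k v) = q *: coset_sum k v.
Proof.
move=> lt_k inv gv lt_i; rewrite /coset_sum linear_sum scaler_sumr /=.
have lt_iS : (i < k.+1)%N := ltnW lt_i; have lt_in : (i.+1 < n)%N by lia.
pose a := Ordinal lt_iS; pose b := Ordinal (lt_i : i.+1 < k.+1)%N.
rewrite (bigD1 a) // (bigD1 b) /=; last by rewrite -val_eqE /= gtn_eqF.
rewrite [RHS](bigD1 a) // [in RHS](bigD1 b) /=; last by rewrite -val_eqE /= gtn_eqF.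
rewrite !addrA; congr (_ + _).
  set c := chain i.+1 (k - i.+1) v.
  have cE : chain i (k - i) v = g i c by rewrite -(subnSK lt_i).
  have tc l : (l < n)%N -> t l (g i c) = 1 *: g i c.
    by move=> lt_l; rewrite scale1r -cE t_invariant_chain // subnKC // ltnW.
  have qE : q ^+ (k - i) = q * q ^+ (k - i.+1) by rewrite -exprS subnSK ?lt_i.
  rewrite cE !linearZ /= (yh_quad yh) // (idem_eigen yh d0 _ _ (tc _ _) (tc _ _)) ?eqxx //; try lia.
  by rewrite qE /=; lincomb c (g i c) c; field.
apply: eq_bigr => -[j lt_j] /andP[]; rewrite -!val_eqE /= => ja jb.
rewrite linearZ /= scalerA mulrC -scalerA; congr (_ *: _).
case: (ltngtP i.+1 j) => [lt_ij|lt_ji|eij]; last by rewrite eij eqxx in jb.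
  rewrite (g_chain_far yh) ?subnKC // gv ?linearZ //; lia.
case: i lt_i lt_ji ja {jb lt_iS lt_in a b} => [|i] lt_i lt_ji ja; first by lia.
by rewrite (g_chain_shift yh) ?subnKC // ?gv ?linearZ //; lia.
Qed.

Lemma symmetriser_invariant k v : (k <= n)%N -> t_invariant (symmetriser k v) /\
  forall i, (i.+1 < k)%N -> g i (symmetriser k v) = q *: symmetriser k v.
Proof.
elim: k => [|k IH] lt_k; first by split=> //; apply: colour_symmetriser_invariant.
have [inv gk] := IH (ltnW lt_k); split; first exact: t_invariant_sum.
by move=> i lt_i; apply: g_coset_sum.
Qed.

(** Each product of [m] generators acts by [q^m], so the coset sum over [k + 1]
    cosets acts by a quantum integer. *)
Lemma symmetriser_eigen v : t_invariant v -> (forall i, (i.+1 < n)%N -> g i v = q *: v) ->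
  symmetriser n v = (\prod_(1 <= m < n.+1) \sum_(0 <= k < m) q ^+ (2 * k)) *: v.
Proof.
move=> inv gv.
have colour k : (k <= n)%N -> colour_symmetriser k v = v.
  elim: k => //= k IH lt_k; rewrite IH ?(ltnW lt_k) // /colour_average.
  have it s : iter s (t k) v = v by elim: s => //= s ->; apply: inv.
  rewrite (eq_bigr (fun=> v)) // sumr_const_nat subn0 -scaler_nat scalerA mulVf //.
  by rewrite scale1r.
have chainE j m : (j + m < n)%N -> chain j m v = q ^+ m *: v.
  elim: m j => [|m IH] j lt_n /=; first by rewrite scale1r.
  by rewrite IH ?linearZ /= ?gv ?scalerA -?exprSr //; lia.
suff /(_ n (leqnn n)) : forall k, (k <= n)%N -> symmetriser k v =
    (\prod_(1 <= m < k.+1) \sum_(0 <= l < m) q ^+ (2 * l)) *: v by [].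
elim=> [|k IH] lt_k; first by rewrite big_geq // scale1r; apply: colour.
rewrite /= IH ?(ltnW lt_k) //; set P := \prod_(1 <= m < k.+1) _.
have -> : \prod_(1 <= m < k.+2) \sum_(0 <= l < m) q ^+ (2 * l) =
    (\sum_(0 <= l < k.+1) q ^+ (2 * l)) * P by rewrite big_nat_recr //= mulrC.
rewrite /coset_sum -scalerA big_mkord scaler_suml (reindex_inj rev_ord_inj).
apply: eq_bigr => -[j lt_j] _ /=.
rewrite subSS subKn // linearZ /= chainE ?subnK //.
by rewrite mul2n -addnn exprD; lincomb v v v; ring.
Qed.

End Symmetriser.

Section SymmetriserMorphism.
Variables (K : fieldType) (V W : lmodType K) (q : K) (d n : nat).
Variables (g t : nat -> {linear V -> V}) (g' t' : nat -> {linear W -> W}).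
Variable phi : {linear V -> W}.
Hypothesis phi_g : forall i v, (i.+1 < n)%N -> phi (g i v) = g' i (phi v).
Hypothesis phi_t : forall j v, (j < n)%N -> phi (t j v) = t' j (phi v).

Lemma symmetriser_morph v :
  phi (symmetriser q d n g t n v) = symmetriser q d n g' t' n (phi v).
Proof.
have phi_c k u : (k <= n)%N ->
    phi (colour_symmetriser d t k u) = colour_symmetriser d t' k (phi u).
  elim: k => //= k IH lt_k; rewrite /colour_average linearZ linear_sum /= -IH 1?ltnW //.
  by congr (_ *: _); apply: eq_bigr => s _; elim: s => //= s <-; apply: phi_t.
have phi_chain j m u : (j + m < n)%N ->
    phi (chain (fun i => g i) j m u) = chain (fun i => g' i) j m (phi u).
  by elim: m j => //= m IH j lt_n; rewrite phi_g ?IH //; lia.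
suff: forall k, (k <= n)%N ->
    phi (symmetriser q d n g t k v) = symmetriser q d n g' t' k (phi v) by apply.
elim=> [|k IH] lt_k /=; first exact: phi_c.
rewrite /coset_sum linear_sum; apply: eq_bigr => -[j lt_j] _ /=.
by rewrite linearZ /= phi_chain ?subnKC // IH // ltnW.
Qed.
End SymmetriserMorphism.

(** The Hecke algebra acts on functions of words by sorting two neighbouring
    letters; with the [t_j] acting trivially this is a representation of the
    Yokonuma--Hecke algebra. It serves to see that the symmetriser is non-zero. *)
Section Words.
Variables (K : fieldType) (q : K) (d n : nat).
Hypothesis d0 : d%:R != 0 :> K.
Hypothesis q0 : q != 0.

Local Notation words := ((nat -> nat) -> K^o).
Implicit Types (f : words) (w : nat -> nat).

Definition word_swap i w : nat -> nat := fun p => w (swap_pos i p).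
Definition word_fun i f : words := fun w =>
  if w i == w i.+1 then q * f w
  else f (word_swap i w) + (if (w i < w i.+1)%N then 0 else (q - q^-1) * f w).

Lemma word_fun_is_linear i : linear (word_fun i).
Proof.
move=> a f h; apply/funext => w; rewrite /word_fun /= !fctE /GRing.scale /=.
by case: eqP => _; [ring|case: ltnP => _; ring].
Qed.
HB.instance Definition _ i :=
  GRing.isLinear.Build K words words _ (word_fun i) (word_fun_is_linear i).
Definition word_g i : {linear words -> words} := word_fun i.
Definition word_t (j : nat) : {linear words -> words} := idfun.

Lemma word_swap_id i w p : p != i -> p != i.+1 -> word_swap i w p = w p.
Proof. by rewrite /word_swap /swap_pos => /negbTE-> /negbTE->. Qed.
Lemma word_swap_l i w : word_swap i w i = w i.+1.
Proof. by rewrite /word_swap /swap_pos eqxx. Qed.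
Lemma word_swap_r i w : word_swap i w i.+1 = w i.
Proof. by rewrite /word_swap /swap_pos eqxx gtn_eqF. Qed.
Lemma word_swapK i w : word_swap i (word_swap i w) = w.
Proof. by apply/funext => p; rewrite /word_swap swap_posK. Qed.

Lemma word_gE i f w : word_g i f w = if w i == w i.+1 then q * f w
  else f (word_swap i w) + (if (w i < w i.+1)%N then 0 else (q - q^-1) * f w).
Proof. by []. Qed.

Lemma word_g_far i j f : (i.+1 < j)%N -> word_g i (word_g j f) = word_g j (word_g i f).
Proof.
move=> lt_ij; apply/funext => w; rewrite !word_gE.
rewrite !(word_swap_id (i := i)) ?(word_swap_id (i := j)); try lia.
have -> : word_swap j (word_swap i w) = word_swap i (word_swap j w).
  by apply/funext => p; rewrite /word_swap /swap_pos; do ![case: eqP => //=]; lia.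
by do ![case: ifP => _]; ring.
Qed.

Lemma word_g_square i f : word_g i (word_g i f) = f + (q - q^-1) *: word_g i f.
Proof.
apply/funext => w; rewrite !fctE !word_gE word_swap_l word_swap_r word_swapK.
by rewrite eq_sym /GRing.scale /=; case: ltngtP => _; field.
Qed.

(** The braid relation only involves three neighbouring letters, and is checked
    for each of their relative orders. *)
Definition set3 i w x y z : nat -> nat := fun p =>
  if p == i then x else if p == i.+1 then y else if p == i.+2 then z else w p.

Lemma word_g_set3l i f w x y z : word_g i f (set3 i w x y z) =
  if x == y then q * f (set3 i w x y z)
  else f (set3 i w y x z) + (if (x < y)%N then 0 else (q - q^-1) * f (set3 i w x y z)).
Proof.
have e1 : set3 i w x y z i = x by rewrite /set3 eqxx.
have e2 : set3 i w x y z i.+1 = y by rewrite /set3 gtn_eqF // eqxx.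
rewrite word_gE e1 e2; case: eqP => // _; congr (f _ + _).
by apply/funext => p; rewrite /word_swap /set3 /swap_pos; do !case: ifP; lia.
Qed.
Lemma word_g_set3r i f w x y z : word_g i.+1 f (set3 i w x y z) =
  if y == z then q * f (set3 i w x y z)
  else f (set3 i w x z y) + (if (y < z)%N then 0 else (q - q^-1) * f (set3 i w x y z)).
Proof.
have e1 : set3 i w x y z i.+1 = y by rewrite /set3 gtn_eqF // eqxx.
have e2 : set3 i w x y z i.+2 = z by rewrite /set3 eqxx; do !case: ifP; lia.
rewrite word_gE e1 e2; case: eqP => // _; congr (f _ + _).
by apply/funext => p; rewrite /word_swap /set3 /swap_pos; do !case: ifP; lia.
Qed.

Lemma word_g_braid i f :
  word_g i (word_g i.+1 (word_g i f)) = word_g i.+1 (word_g i (word_g i.+1 f)).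
Proof.
apply/funext => w; have -> : w = set3 i w (w i) (w i.+1) (w i.+2).
  apply/funext => p; rewrite /set3; have [->//|_] := eqVneq p i.
  by have [->//|_] := eqVneq p i.+1; have [->|] := eqVneq p i.+2.
move: (w i) (w i.+1) (w i.+2) => x y z.
rewrite !(word_g_set3l, word_g_set3r).
case: (ltngtP x y) => xy; case: (ltngtP y z) => yz; case: (ltngtP x z) => xz;
  first [by exfalso; lia | by subst; field].
Qed.

Lemma word_yh : yh_operators q d n word_g word_t.
Proof.
have iterE j m f : iter m (word_t j) f = f by elim: m => //= m ->.
split=> //.
- by move=> i j f lt_ij _; apply: word_g_far.
- by move=> i f _; apply: word_g_braid.
- move=> i f _; rewrite word_g_square; congr (_ + _ *: _); rewrite /colour_idem.
  rewrite (eq_bigr (fun=> word_g i f)) => [|s _]; last by rewrite !iterE.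
  by rewrite sumr_const_nat subn0 -scaler_nat scalerA mulVf // scale1r.
Qed.

Definition delta_word : words := fun w => if `[< w = id >] then 1 else 0.

Definition fixes_from k f := forall w p, (k <= p)%N -> w p != p -> f w = 0.

Lemma fixes_from_word_g k i f : (i.+1 < k)%N -> fixes_from k f -> fixes_from k (word_g i f).
Proof.
move=> lt_ik ff w p le_kp wp; rewrite word_gE (ff w p) // (ff (word_swap i w) p) //.
  by do ![case: ifP => _]; rewrite ?mulr0 ?addr0.
by rewrite word_swap_id //; lia.
Qed.

Lemma fixes_from_chain k j m f : (j + m < k)%N -> fixes_from k f ->
  fixes_from k (chain (fun i => word_g i) j m f).
Proof.
elim: m j => //= m IH j lt_k ff; apply: fixes_from_word_g; first by lia.
by apply: IH; rewrite // addSn -addnS.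
Qed.

(** Each sorting step of the chain moves the letter [w j] one position up, so
    that it ends in position [k], where words in the support of [f] have the
    letter [k]. *)
Lemma chain_vanish k m j f w : (j + m = k)%N -> fixes_from k f ->
  (forall p, (j < p <= k)%N -> (w j < w p)%N) -> w j != k ->
  chain (fun i => word_g i) j m f w = 0.
Proof.
elim: m j w => [|m IH] j w /= jm ff wj wk; first by apply: (ff w k); rewrite // -jm addn0 in wk *.
rewrite word_gE ltn_eqF ?wj ?addr0; [|lia..].
apply: IH => //; rewrite ?word_swap_r //; first by lia.
by move=> p lt_p; rewrite word_swap_id ?wj //; lia.
Qed.

(** In the sum over the cosets only the trivial one contributes to the value at
    the increasing word. *)
Lemma symmetriser_delta k : fixes_from k (symmetriser q d n word_g word_t k delta_word) /\
  symmetriser q d n word_g word_t k delta_word id = 1.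
Proof.
have tI l : colour_symmetriser d word_t l delta_word = delta_word.
  elim: l => //= l ->; rewrite /colour_average.
  rewrite (eq_bigr (fun=> delta_word)) => [|s _]; last by elim: s => //= s ->.
  by rewrite sumr_const_nat subn0 -scaler_nat scalerA mulVf // scale1r.
elim: k => [|k [ff f1]] /=.
  rewrite tI /delta_word; split; last by rewrite asboolT.
  by move=> w p _ wp; rewrite asboolF // => e; rewrite e eqxx in wp.
set f := symmetriser _ _ _ _ _ _ _ in ff f1 *; rewrite /coset_sum.
have cf (j : 'I_k.+1) : fixes_from k.+1 (chain (fun i => word_g i) j (k - j) f).
  apply: fixes_from_chain; first by rewrite subnKC // -ltnS.
  by move=> w p le_kp; apply: ff; apply: ltnW.
split=> [w p le_kp wp|].
  rewrite fct_sumE big1 // => j _; rewrite fctE.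
  by rewrite [X in _ *: X](cf j w p) // scaler0.
rewrite fct_sumE big_ord_recr /= subnn /= expr0 scale1r f1 big1 ?add0r // => -[j lt_j] _ /=.
rewrite fctE [X in _ *: X](@chain_vanish k) ?scaler0 //; try lia.
Qed.
End Words.

(** * Modules over the specialised algebra from its presentation *)

Section TensorLift.
Variables (A K : comNzRingType) (theta : {rmorphism A -> K}) (Y : algType A).
Variables (V : lmodType K) (f : Y -> V).
Hypothesis fD : forall y y', f (y + y') = f y + f y'.
Hypothesis fZ : forall a y, f (a *: y) = theta a *: f y.

Let free_lift (x : tfree K Y) : V := zlift (fun k : K * Y => k.1 *: f k.2) x.
Let free_liftB (x y : tfree K Y) : free_lift (x - y) = free_lift x - free_lift y.
Proof. exact: raddfB. Qed.
Let free_liftU c y : free_lift (tgen c y) = c *: f y.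
Proof. by rewrite /free_lift zliftU. Qed.

Let free_lift_relator (x : tfree K Y) : bilin_subgroup theta x -> free_lift x = 0.
Proof.
elim=> {x}[x rx||x y _ x0 _ y0]; last by rewrite free_liftB x0 y0 subr0.
  case: rx => [c c' y|c y y'|c a y]; rewrite !free_liftB !free_liftU.
  - by rewrite scalerDl addrAC addrK subrr.
  - by rewrite fD scalerDr addrAC addrK subrr.
  - by rewrite fZ scalerA subrr.
exact: raddf0.
Qed.

Definition tensor_lift (u : tensor theta Y) : V := free_lift (repr u).

Let tensor_lift_pi x : tensor_lift (tensor_pi theta x) = free_lift x.
Proof.
apply/eqP; rewrite -subr_eq0 /tensor_lift -free_liftB; apply/eqP.
by apply/free_lift_relator/tensor_eq; exact: reprK.
Qed.

Lemma tensor_lift_tens c y : tensor_lift (tens theta c y) = c *: f y.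
Proof. by rewrite tensor_lift_pi free_liftU. Qed.

Lemma tensor_lift_linear : linear tensor_lift.
Proof.
have lB u w : tensor_lift (u - w) = tensor_lift u - tensor_lift w.
  elim/ring_piW: u => x; elim/ring_piW: w => y.
  rewrite -[ring_pi _ x - ring_pi _ y](raddfB (@tensor_pi _ _ theta Y)).
  by rewrite tensor_lift_pi free_liftB -!tensor_lift_pi.
have l0 : tensor_lift 0 = 0 by rewrite -(subrr 0) lB subrr.
have lZ c u : tensor_lift (c *: u) = c *: tensor_lift u.
  elim/tensor_ind: u => [|u w e e'|c' y]; first by rewrite scaler0 l0 scaler0.
    by rewrite scalerBr !lB e e' scalerBr.
  by rewrite tensor_scaleE !tensor_lift_tens scalerA.
move=> c u w; rewrite -[w in LHS]opprK lB lZ -[- w]sub0r lB l0 sub0r opprK.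
by [].
Qed.
End TensorLift.

Section Presentation.
Variables (F K : fieldType) (theta : {rmorphism laurent F -> K}) (d n : nat).

Local Notation A := (laurent F).
Local Notation q := (theta (laurentq F)).
Local Notation Y := (yokonuma F d n).
Local Notation B := (yokonuma_spec theta d n).
Local Notation rel := (@yok_rel A (laurentq F) d n).
Local Notation free := {freealg A[ygen n]}.

Definition word_image (x : free) : B := tens theta 1 (presented_pi rel x : Y).

Lemma word_image_is_zmod_morphism : zmod_morphism word_image.
Proof.
move=> x y; apply/eqP; rewrite eq_sym subr_eq; apply/eqP.
rewrite /word_image -tensDr; congr (tens _ _ _).
by rewrite -(rmorphD (presented_pi rel)) subrK.
Qed.
Lemma word_image_is_monoid_morphism : monoid_morphism word_image.
Proof.
split=> [|x y]; first by rewrite /word_image rmorph1; exact: tens11.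
by rewrite /word_image [RHS]tensM mulr1 rmorphM.
Qed.
HB.instance Definition _ := GRing.isZmodMorphism.Build free B word_image
  word_image_is_zmod_morphism.
HB.instance Definition _ := GRing.isMonoidMorphism.Build free B word_image
  word_image_is_monoid_morphism.

Lemma word_imageD x y : word_image (x + y) = word_image x + word_image y.
Proof. exact: (rmorphD word_image). Qed.
Lemma word_image0 : word_image 0 = 0.
Proof. exact: (rmorph0 word_image). Qed.
Lemma word_imageM x y : word_image (x * y) = word_image x * word_image y.
Proof. exact: (rmorphM word_image). Qed.
Lemma word_image1 : word_image 1 = 1.
Proof. exact: (rmorph1 word_image). Qed.
Lemma word_imageZ a x : word_image (a *: x) = theta a *: word_image x.
Proof.
by rewrite /word_image presented_piZ -tensZ mul1r [RHS]tensor_scaleE mulr1.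
Qed.

Lemma word_image_rel x y : rel (x - y) -> word_image x = word_image y.
Proof.
by move=> rxy; rewrite /word_image; congr (tens _ _ _); apply/presented_eq/RelatorGen.
Qed.

Definition gB (i : 'I_n.-1) : B := word_image (freegen A (inl i : ygen n)).
Definition tB (j : 'I_n) : B := word_image (freegen A (inr j : ygen n)).

Lemma free_monomial (a : A) (m : {fmonom ygen n}) :
  << a *g m >> = a *: \prod_(x <- (m : seq _)) freegen A x.
Proof.
have UU (b c : A) (k l : {fmonom ygen n}) : << b *g k >> * << c *g l >> = << b * c *g mmul k l >>.
  by rewrite malgM_def fgmulUU.
rewrite -mul_malgC -[a in LHS]mulr1 -[m in LHS]mul1m -UU; congr (_ * _).
case: m => s /=; elim: s => [|x s IH]; first by rewrite big_nil -fmoneE.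
rewrite big_cons -IH /freegen UU mulr1; congr << _ *g _ >>.
by apply/eqP; rewrite fmP fmM fmU.
Qed.

Lemma free_ind (P : free -> Prop) : (forall x y, P x -> P y -> P (x + y)) -> P 0 ->
  (forall a (s : seq (ygen n)), P (a *: \prod_(x <- s) freegen A x)) -> forall x, P x.
Proof.
move=> PD P0 PM x; rewrite [x]monalgE; elim/big_ind: _ => // m _.
by rewrite free_monomial; apply: PM.
Qed.

(** The images of words and the scalars of [K] span the tensor product. *)
Lemma stable_under_generators (V : lmodType B) (S : V -> Prop) :
  S 0 -> (forall u v, S u -> S v -> S (u + v)) ->
  (forall c v, S v -> S ((c%:A : B) *: v)) ->
  (forall i v, S v -> S (gB i *: v)) -> (forall j v, S v -> S (tB j *: v)) ->
  forall b v, S v -> S (b *: v).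
Proof.
move=> S0 SD SZ Sg St b v Sv.
have SN u : S u -> S (- u).
  by move=> Su; have := SZ (-1) u Su; rewrite scaleN1r scaleNr scale1r.
have Sw x u : S u -> S (word_image x *: u).
  move=> Su; elim/free_ind: x => [x y Sx Sy||a s].
  - by rewrite word_imageD scalerDl; apply: SD.
  - by rewrite word_image0 scale0r.
  rewrite word_imageZ -[word_image _]mul1r scalerAl -scalerA; apply: (SZ).
  elim: s => [|[i|j] s IH]; first by rewrite big_nil word_image1 scale1r.
    by rewrite big_cons word_imageM -scalerA; apply: (Sg).
  by rewrite big_cons word_imageM -scalerA; apply: (St).
elim/tensor_ind: b => [|x y Sx Sy|c y]; first by rewrite scale0r.
  by rewrite scalerBl; apply: (SD) => //; apply: SN.
have -> : tens theta c y = (c%:A : B) * tens theta 1 y.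
  by rewrite -scalerAl mul1r [RHS]tensor_scaleE mulr1.
rewrite -scalerA; apply: (SZ); elim/presentedW: y => x; exact: Sw.
Qed.

Lemma swap_pos_tperm (i : 'I_n.-1) (j : 'I_n) :
  tperm (ord_left i) (ord_right i) j = swap_pos i j :> nat.
Proof.
rewrite /swap_pos; case: tpermP => [->|->|/eqP ji /eqP jSi] /=.
- by rewrite eqxx.
- by rewrite eqxx gtn_eqF.
- by rewrite (negbTE (ji : (j != i :> nat))) (negbTE (jSi : (j != i.+1 :> nat))).
Qed.

Section UniversalProperty.
Variables (V : lmodType K) (g t : nat -> {linear V -> V}).
Hypothesis yh : yh_operators q d n g t.
Hypothesis d0 : d%:R != 0 :> F.

Definition letter_op (x : ygen n) : {linear V -> V} :=
  match x with inl i => g i | inr j => t j end.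
Definition word_op (s : seq (ygen n)) (v : V) : V := foldr (fun x u => letter_op x u) v s.
(** A word acts by the composite of its letters, and this extends linearly along
    [theta]. *)
Definition free_op (x : free) (v : V) : V :=
  \sum_(m <- msupp x) theta x@_m *: word_op (m : {fmonom ygen n}) v.

Lemma free_opEw (E : {fset {fmonom ygen n}}) x v : fsubset (msupp x) E ->
  free_op x v = \sum_(m <- E) theta x@_m *: word_op m v.
Proof.
move=> le; rewrite [LHS](big_fset_incl _ le) => //= m _ /mcoeff_outdom ->.
by rewrite rmorph0 scale0r.
Qed.

Lemma free_opD x y v : free_op (x + y) v = free_op x v + free_op y v.
Proof.
rewrite !(@free_opEw (fsetU (msupp x) (msupp y))) ?fsubsetUl ?fsubsetUr ?msuppD_le //.
by rewrite -big_split; apply: eq_bigr => m _; rewrite mcoeffD rmorphD scalerDl.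
Qed.
Lemma free_op0 v : free_op 0 v = 0.
Proof. by apply: (addrI (free_op 0 v)); rewrite -free_opD !addr0. Qed.
Lemma free_opB x y v : free_op (x - y) v = free_op x v - free_op y v.
Proof. by apply: (addIr (free_op y v)); rewrite -free_opD !subrK. Qed.

Lemma word_op_is_linear s : linear (word_op s).
Proof. by move=> a u v; elim: s => //= x s ->; rewrite linearP. Qed.
HB.instance Definition _ s := GRing.isLinear.Build K V V _ (word_op s) (word_op_is_linear s).
Lemma free_op_is_linear x : linear (free_op x).
Proof.
move=> a u v; rewrite /free_op scaler_sumr -big_split; apply: eq_bigr => m _ /=.
by rewrite linearP scalerDr !scalerA mulrC.
Qed.
HB.instance Definition _ x := GRing.isLinear.Build K V V _ (free_op x) (free_op_is_linear x).

Lemma free_opU a (m : {fmonom ygen n}) v : free_op << a *g m >> v = theta a *: word_op m v.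
Proof. by rewrite (free_opEw _ msuppU_le) big_seq_fset1 mcoeffUU. Qed.

Lemma free_opM x y v : free_op (x * y) v = free_op x (free_op y v).
Proof.
rewrite [x]monalgE; elim/big_ind: _ => [|x1 x2 e1 e2|m _].
- by rewrite mul0r !free_op0.
- exact: etrans (congr1 (free_op^~ v) (mulrDl x1 x2 y)) (etrans (free_opD _ _ v)
    (etrans (congr2 +%R e1 e2) (esym (free_opD x1 x2 _)))).
rewrite [y]monalgE; elim/big_ind: _ => [|y1 y2 e1 e2|l _].
- by rewrite mulr0 !free_op0 linear0.
- exact: etrans (congr1 (free_op^~ v) (mulrDr _ y1 y2)) (etrans (free_opD _ _ v)
    (etrans (congr2 +%R e1 e2) (etrans (esym (linearD (free_op _) _ _))
    (congr1 (free_op _) (esym (free_opD y1 y2 v)))))).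
rewrite malgM_def fgmulUU !free_opU rmorphM linearZ scalerA mulrC; congr (_ *: _).
by rewrite fmM /word_op foldr_cat.
Qed.

(** A calculus of represented operators: a relator is evaluated by following
    its syntax. *)
Definition acts (x : free) (f : V -> V) := forall v, free_op x v = f v.

Lemma actsD x y f h : acts x f -> acts y h -> acts (x + y) (fun v => f v + h v).
Proof. by move=> xf yh' v; rewrite -xf -yh'; exact: free_opD. Qed.
Lemma actsM x y f h : acts x f -> acts y h -> acts (x * y) (fun v => f (h v)).
Proof. by move=> xf yh' v; rewrite -yh' -xf; exact: free_opM. Qed.
Lemma acts1 : acts 1 id.
Proof. by move=> v; rewrite free_opU fm1 rmorph1 scale1r. Qed.
Lemma actsZ a x f : acts x f -> acts (a *: x) (fun v => theta a *: f v).
Proof.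
move=> xf v; rewrite -xf -mul_malgC; apply: etrans (free_opM _ _ v) _.
by rewrite free_opU fm1.
Qed.
Lemma acts_gen x : acts (freegen A x) (letter_op x).
Proof. by move=> v; rewrite free_opU fmU rmorph1 scale1r. Qed.
Lemma actsX x f s : acts x f -> acts (x ^+ s) (iter s f).
Proof.
by move=> xf; elim: s => [|s IH] v; [exact: acts1|rewrite exprS iterS; exact: actsM].
Qed.
Lemma acts_sum (s : seq nat) (E : nat -> free) (f : nat -> V -> V) :
  (forall i, acts (E i) (f i)) -> acts (\sum_(i <- s) E i) (fun v => \sum_(i <- s) f i v).
Proof.
move=> Ef; elim: s => [|i s IH] v; first by rewrite !big_nil free_op0.
by rewrite !big_cons; exact: (actsD (Ef i) IH v).
Qed.
Lemma acts_eq x y f h : acts x f -> acts y h -> f =1 h -> forall v, free_op (x - y) v = 0.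
Proof. by move=> xf yh' fh v; rewrite free_opB xf yh' fh subrr. Qed.

Lemma ord_bound (i : 'I_n.-1) : (i.+1 < n)%N.
Proof. exact: ord_right_subproof. Qed.

Lemma theta_inv_nat : theta (d%:R^-1) = d%:R^-1.
Proof. by rewrite rmorphV ?laurent_nat_unit // rmorph_nat. Qed.
Lemma theta_inv_q : theta (laurentq F)^-1 = q^-1.
Proof. by rewrite rmorphV // laurentq_unit. Qed.

Lemma free_op_relator x v : relator_ideal rel x -> free_op x v = 0.
Proof.
move=> Rx; elim: Rx v => {x}[x rx||x y _ x0 _ y0|a x _ x0|a x _ x0] v; last first.
- by apply: etrans (free_opM _ _ v) _; rewrite x0.
- by apply: etrans (free_opM _ _ v) _; rewrite x0 linear0.
- by rewrite free_opD x0 y0 addr0.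
- by rewrite free_op0.
case: rx v => [i j ij|i j ij|i j|i j|j|i].
- apply: (acts_eq (actsM (acts_gen _) (acts_gen _)) (actsM (acts_gen _) (acts_gen _))) => v /=.
  have [lt_i lt_j] := (ord_bound i, ord_bound j).
  by case/orP: ij => ij; [apply: (yh_far yh)|apply/esym/(yh_far yh)].
- apply: (acts_eq (actsM (actsM (acts_gen _) (acts_gen _)) (acts_gen _))
    (actsM (actsM (acts_gen _) (acts_gen _)) (acts_gen _))) => v /=.
  by rewrite ij (yh_braid yh) // -ij ord_bound.
- apply: (acts_eq (actsM (acts_gen _) (acts_gen _)) (actsM (acts_gen _) (acts_gen _))) => v /=.
  exact: (yh_tt yh).
- apply: (acts_eq (actsM (acts_gen _) (acts_gen _)) (actsM (acts_gen _) (acts_gen _))) => v /=.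
  by rewrite (yh_tg yh) ?ord_bound // swap_pos_tperm.
- apply: (acts_eq (actsX _ (acts_gen _)) acts1) => v /=; exact: (yh_order yh).
apply: (acts_eq (actsX _ (acts_gen _)) (actsD acts1 (actsZ _ (actsM (actsZ _
  (acts_sum _ (fun s => actsM (actsX _ (acts_gen _)) (actsX _ (acts_gen _))))) (acts_gen _))))).
move=> v /=; rewrite (yh_quad yh) ?ord_bound // rmorphB theta_inv_q theta_inv_nat.
by [].
Qed.

Definition presented_op (y : Y) (v : V) : V := free_op (repr (y : presented rel)) v.

Lemma presented_op_pi x v : presented_op (presented_pi rel x) v = free_op x v.
Proof.
apply/eqP; rewrite -subr_eq0 -free_opB; apply/eqP/free_op_relator/presented_eq.
exact: reprK.
Qed.
Lemma presented_opD y y' v : presented_op (y + y') v = presented_op y v + presented_op y' v.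
Proof.
elim/presentedW: y => x; elim/presentedW: y' => x'.
by rewrite -(rmorphD (presented_pi rel)) !presented_op_pi; exact: free_opD.
Qed.
Lemma presented_opZ a y v : presented_op (a *: y) v = theta a *: presented_op y v.
Proof.
elim/presentedW: y => x; rewrite -[a *: _]presented_piZ !presented_op_pi.
exact: (actsZ _ (fun u => erefl _)).
Qed.
Lemma presented_op_gen l y v :
  presented_op (presented_pi rel (freegen A l) * y) v = letter_op l (presented_op y v).
Proof.
elim/presentedW: y => x; rewrite -(rmorphM (presented_pi rel)) !presented_op_pi.
by apply: etrans (free_opM _ _ v) _; rewrite (acts_gen l).
Qed.

Variable v : V.

(** The map [b |-> b v] of the algebra into a representation; it stands for the
    universal property. *)
Definition orbit_map : B -> V := @tensor_lift _ _ theta Y V (fun y : Y => presented_op y v).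

Lemma orbit_map_is_linear : linear orbit_map.
Proof.
apply: tensor_lift_linear => [y y'|a y]; [exact: presented_opD|exact: presented_opZ].
Qed.

Lemma orbit_map_tens c y : orbit_map (tens theta c y) = c *: presented_op y v.
Proof.
apply: tensor_lift_tens => [y1 y2|a y1]; [exact: presented_opD|exact: presented_opZ].
Qed.

HB.instance Definition _ := GRing.isLinear.Build K B V _ orbit_map orbit_map_is_linear.

Lemma orbit_map_gen l b : orbit_map (word_image (freegen A l) * b) = letter_op l (orbit_map b).
Proof.
elim/tensor_ind: b => [|b b' e e'|c y].
- by rewrite mulr0 !linear0.
- have lB b1 b2 : orbit_map (b1 - b2) = orbit_map b1 - orbit_map b2 by exact: linearB.
  by rewrite mulrBr !lB e e' linearB.
have tM : word_image (freegen A l) * tens theta c y =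
    tens theta c ((presented_pi rel (freegen A l) : Y) * y).
  by apply: etrans (tensM _ _ _ _ _) _; rewrite mul1r.
apply: etrans (congr1 orbit_map tM) (etrans (orbit_map_tens _ _) _).
apply: etrans (congr1 _ (presented_op_gen l y v)) _.
by apply: etrans (esym (linearZ _ _)) _; congr (letter_op l _); rewrite orbit_map_tens.
Qed.
Lemma orbit_map1 : orbit_map 1 = v.
Proof.
rewrite -[1](tens11 theta Y) orbit_map_tens scale1r -(rmorph1 (presented_pi rel)).
by rewrite presented_op_pi; exact: acts1.
Qed.

End UniversalProperty.

End Presentation.

(** * Semisimplicity *)

(** A module over a [K]-algebra as a vector space, on which the algebra acts by
    linear operators. *)
Section Restriction.
Variables (K : fieldType) (B : algType K) (V : lmodType B).

Definition restriction : Type := V.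
HB.instance Definition _ := GRing.Zmodule.on restriction.

Definition restriction_scale (c : K) (v : restriction) : restriction :=
  (c%:A : B) *: (v : V).

Lemma restriction_scalerA a b v :
  restriction_scale a (restriction_scale b v) = restriction_scale (a * b) v.
Proof. by rewrite /restriction_scale scalerA -scalerAl mul1r scalerA. Qed.
Lemma restriction_scale1r : left_id 1 restriction_scale.
Proof. by move=> v; rewrite /restriction_scale !scale1r. Qed.
Lemma restriction_scalerDr : right_distributive restriction_scale +%R.
Proof. by move=> a u v; rewrite /restriction_scale; exact: scalerDr. Qed.
Lemma restriction_scalerDl v : {morph restriction_scale^~ v : a b / a + b}.
Proof. by move=> a b; rewrite /restriction_scale !scalerDl. Qed.
HB.instance Definition _ := GRing.Zmodule_isLmodule.Build K restriction
  restriction_scalerA restriction_scale1r restriction_scalerDr restriction_scalerDl.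

Lemma restrictionE (c : K) (v : restriction) : c *: v = (c%:A : B) *: (v : V).
Proof. by []. Qed.

Definition action_fun (b : B) (v : restriction) : restriction := b *: (v : V).
Lemma action_is_linear b : linear (action_fun b).
Proof.
move=> c u v; rewrite !restrictionE /action_fun.
apply: (etrans (scalerDr b _ _)).
by congr (_ + _); rewrite !scalerA mulr_algl mulr_algr.
Qed.
HB.instance Definition _ b := GRing.isLinear.Build K restriction restriction _
  (action_fun b) (action_is_linear b).
Definition action b : {linear restriction -> restriction} := action_fun b.

Lemma actionE b v : action b v = b *: (v : V). Proof. by []. Qed.
End Restriction.

Record yh_elements (K : fieldType) (B : algType K) (q : K) (d n : nat) (g t : nat -> B) :
    Prop := YHElements {
  yhe_far i j : (i.+1 < j)%N -> (j.+1 < n)%N -> g i * g j = g j * g i;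
  yhe_braid i : (i.+2 < n)%N -> g i * g i.+1 * g i = g i.+1 * g i * g i.+1;
  yhe_tt i j : (i < n)%N -> (j < n)%N -> t i * t j = t j * t i;
  yhe_tg i j : (i.+1 < n)%N -> (j < n)%N -> t j * g i = g i * t (swap_pos i j);
  yhe_order j : (j < n)%N -> t j ^+ d = 1;
  yhe_quad i : (i.+1 < n)%N -> g i * g i =
    1 + (q - q^-1) *: ((d%:R^-1 *: \sum_(0 <= s < d) t i ^+ s * t i.+1 ^+ (d - s)) * g i)
}.

Section ActionOperators.
Variables (K : fieldType) (B : algType K) (q : K) (d n : nat) (g t : nat -> B).
Hypothesis yhe : yh_elements q d n g t.
Variable V : lmodType B.

Let act (b : B) := @action K B V b.

Lemma actionM (a b : B) v : act (a * b) v = act a (act b v).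
Proof. by rewrite !actionE scalerA. Qed.
Lemma actionX (b : B) s v : act (b ^+ s) v = iter s (act b) v.
Proof. by elim: s => [|s IH]; rewrite ?actionE ?scale1r // exprS -actionE actionM IH. Qed.
Lemma actionZ c (b : B) v : act (c *: b) v = c *: act b v.
Proof. by rewrite restrictionE !actionE scalerA mulr_algl. Qed.

Lemma action_sum (s : seq nat) (F : nat -> B) v :
  act (\sum_(i <- s) F i) v = \sum_(i <- s) act (F i) v.
Proof.
elim: s => [|i s IH]; first by rewrite !big_nil actionE; exact: (scale0r (v : V)).
rewrite !big_cons -IH actionE; exact: (scalerDl (v : V)).
Qed.

Lemma action_yh : yh_operators q d n (fun i => act (g i)) (fun j => act (t j)).
Proof.
split=> [i j v ij jn|i v lt_i|i j v lt_i lt_j|i j v lt_i lt_j|j v lt_j|i v lt_i].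
- by rewrite -!actionM (yhe_far yhe).
- by rewrite -!actionM ?mulrA (yhe_braid yhe).
- by rewrite -!actionM (yhe_tt yhe).
- by rewrite -!actionM (yhe_tg yhe).
- by rewrite -actionX (yhe_order yhe) // actionE scale1r.
rewrite -actionM (yhe_quad yhe) // actionE.
apply: (etrans (scalerDl (v : V) _ _)); rewrite scale1r; congr (_ + _).
apply: (etrans (actionZ _ _ v)); congr (_ *: _).
apply: (etrans (actionM _ (g i) v)); apply: (etrans (actionZ _ _ _)).
rewrite /colour_idem; congr (_ *: _).
apply: (etrans (action_sum _ _ _)); apply: eq_bigr => s _.
by apply: (etrans (actionM _ _ _)); rewrite !actionX.
Qed.
End ActionOperators.

Section RightMultiplication.
Variables (K : fieldType) (B : algType K) (y : B).
Let V := restriction (B^o : lmodType B).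

Definition right_mul (b : V) : V := (b : B) * y.
Lemma right_mul_is_linear : linear right_mul.
Proof.
move=> c a b; rewrite !restrictionE /right_mul.
by apply: (etrans (mulrDl (c%:A * (a : B)) (b : B) y)); rewrite -mulrA.
Qed.
HB.instance Definition _ := GRing.isLinear.Build K V V _ right_mul right_mul_is_linear.
End RightMultiplication.

(** If [u] lies in a simple submodule, [x u] spans a submodule of it. If [x u]
    were non-zero, [u] would be a multiple of [x u], so that [x u] would be a
    multiple of [x x u = 0]. *)
Lemma semisimple_no_nilpotent (K : fieldType) (B : algType K) (x : B) :
  semisimple_algebra B -> (forall b, exists c : K, b * x = c *: x) -> x * x = 0 -> x = 0.
Proof.
move=> ss bx xx; have [s [one_s ss_s]] := ss (1 : B^o).
apply: contrapT => x0; suff z u : u \in s -> x * u = 0.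
  apply: x0; rewrite -[x]mulr1 [1]one_s mulr_sumr big_seq big1 //.
move=> us; apply: contrapT => xu0; have [S [[S0 SP] _ Smin] uS] := ss_s u us.
have xuS : x * u \in S.
  by have := SP x u 0 uS S0; rewrite addr0.
pose T : {pred B^o} := fun y => `[< exists c : K, y = c *: (x * u) >].
have Tsub : submod_closed T.
  split=> [|b y y' /asboolP[c ->] /asboolP[c' ->]]; apply/asboolP.
    by exists 0; rewrite scale0r.
  have [a ba] := bx b; exists (c * a + c').
  rewrite scalerDl -scalerA; congr (_ + _).
  by rewrite -[LHS]/(b * (c *: (x * u))) -scalerAr mulrA ba -scalerAl.
have TS : {subset T <= S}.
  move=> y /asboolP[c ->]; have := SP c%:A (x * u) 0 xuS S0.
  by rewrite addr0 -[_ *: _]/(c%:A * (x * u)) mulr_algl.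
case: (Smin T Tsub TS) => [T0|ST].
  by apply: xu0; apply: T0; apply/asboolP; exists 1; rewrite scale1r.
have /asboolP[c uE] := ST u uS; apply: xu0.
by rewrite uE -scalerAr mulrA xx mul0r scaler0.
Qed.

Section SplitSemisimple.
Variables (K : fieldType) (B : algType K) (q : K) (d n : nat) (g t : nat -> B).
Hypothesis yhe : yh_elements q d n g t.
Hypothesis n0 : (0 < n)%N.
Hypothesis d0 : d%:R != 0 :> K.
Hypothesis q0 : q != 0.
Hypothesis generated_by : forall (V : lmodType B) (S : V -> Prop), S 0 ->
  (forall u v, S u -> S v -> S (u + v)) ->
  (forall (c : K) v, S v -> S ((c%:A : B) *: v)) ->
  (forall i v, (i.+1 < n)%N -> S v -> S (g i *: v)) ->
  (forall j v, (j < n)%N -> S v -> S (t j *: v)) ->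
  forall (b : B) v, S v -> S (b *: v).

Local Notation gop V := (fun i => @action K B V (g i)).
Local Notation top V := (fun j => @action K B V (t j)).
Local Notation poincare := (\prod_(1 <= m < n.+1) \sum_(0 <= k < m) q ^+ (2 * k)).

(** Otherwise the symmetriser [X] has square zero and vanishes, although its
    image under [phi] does not. *)
Lemma poincare_neq0_of_semisimple
  (phi : {linear restriction (B^o : lmodType B) -> ((nat -> nat) -> K^o)}) :
  (forall i b, (i.+1 < n)%N -> phi (g i * b) = word_g q i (phi b)) ->
  (forall j b, (j < n)%N -> phi (t j * b) = phi b) ->
  phi 1 = delta_word K -> semisimple_algebra B -> poincare != 0.
Proof.
move=> phig phit phi1 ss; apply/eqP => P0.
pose V := restriction (B^o : lmodType B).
pose X : V := symmetriser q d n (gop B^o) (top B^o) n (1 : B).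
have yh := action_yh yhe (B^o : lmodType B).
have [inv gX] := symmetriser_invariant yh d0 q0 (1 : V) (leqnn n).
rewrite -/X in inv gX.
have P_X : symmetriser q d n (gop B^o) (top B^o) n X = 0.
  by rewrite (symmetriser_eigen d0 q0 inv gX) P0 scale0r.
have XX : (X : B) * X = 0.
  rewrite -[RHS]P_X -[X in RHS](mul1r (X : B)).
  by apply: (@symmetriser_morph K V V q d n (gop B^o) (top B^o) (gop B^o) (top B^o)
    (right_mul (X : B) : {linear V -> V})) => [i b _|j b _]; exact/esym/mulrA.
have bX (b : B) : exists c : K, b * (X : B) = c *: (X : B).
  pose S (x : B^o) := exists c : K, x = c *: (X : B).
  apply: (generated_by (V := B^o) (S := S)).
  - by exists 0; rewrite scale0r.
  - by move=> u v [a ->] [c ->]; exists (a + c); rewrite scalerDl.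
  - move=> c v [a ->]; exists (c * a).
    by rewrite -[LHS]/(c%:A * (a *: (X : B))) mulr_algl scalerA.
  - move=> i v lt_i [a ->]; exists (a * q).
    rewrite -[LHS]/(g i * (a *: (X : B))) -scalerAr.
    have -> : g i * (X : B) = q *: (X : B).
      exact: (etrans (gX i lt_i) (mulr_algl q (X : B))).
    by rewrite scalerA.
  - move=> j v lt_j [a ->]; exists a.
    rewrite -[LHS]/(t j * (a *: (X : B))) -scalerAr.
    by have -> : t j * (X : B) = X by exact: (inv j lt_j).
  - by exists 1; rewrite scale1r.
have X0 := semisimple_no_nilpotent ss bX XX.
have [_] := symmetriser_delta (q := q) n d0 q0 n.
have phiX := @symmetriser_morph K V _ q d n (gop B^o) (top B^o) (word_g q) (word_t K)
  phi phig phit (1 : B).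
rewrite -phi1 -phiX -/X (_ : X = 0) // linear0 => /esym/eqP.
by rewrite oner_eq0.
Qed.

Section Converse.
Variable Z : seq K.
Hypothesis uniq_Z : uniq Z.
Hypothesis prod_Z : \prod_(z <- Z) ('X - z%:P) = 'X^d - 1.
Hypothesis qint_neq0 : forall m, (0 < m <= n)%N -> \sum_(0 <= k < m) q ^+ (2 * k) != 0.

Let lt_n : (n.-1 < n)%N. Proof. by rewrite prednK. Qed.

Section Module.
Variable V : lmodType B.
Let yh := action_yh yhe V.
Local Notation wtV := (wt q d (gop V) (top V)).

Definition cyclic_sub (u : V) : {pred V} := fun x => `[< exists b : B, x = b *: u >].

Lemma submod_subspace (T : {pred V}) : submod_closed T ->
  [/\ subspace (fun v : restriction V => v \in T),
      stable_t n (top V) (fun v : restriction V => v \in T) &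
      stable_g (gop V) n.-1 (fun v : restriction V => v \in T)].
Proof.
move=> [T0 TP]; have TZ (b : B) v : v \in T -> b *: v \in T.
  by move=> Tv; rewrite -[_ *: _]addr0; apply: TP.
split=> [|j v _|i v _]; [|exact: TZ|exact: TZ].
by split=> // c u v Tu Tv; apply: TP.
Qed.

Lemma cyclic_generated (w : restriction V) (b : B) :
  generated n (gop V) (top V) w (b *: (w : V)).
Proof.
move=> N [N0 NP] tN gN Nw; apply: (generated_by (V := V) (S := N)) => //.
- move=> u v Nu Nv; have := NP 1 u v Nu Nv; rewrite restrictionE.
  by rewrite scale1r (scale1r (u : V)).
- move=> c v Nv; have := NP c v 0 Nv N0.
  by rewrite [_ + 0]addr0.
- by move=> i v lt_i; apply: gN; rewrite -ltnS prednK.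
Qed.

Lemma cyclic_sub_simple (w : restriction V) alpha : size alpha = n -> valid alpha ->
  wtV alpha w -> w != 0 -> simple_sub (cyclic_sub w).
Proof.
move=> size_a va ww w0; have w_in : (w : V) \in cyclic_sub w.
  by apply/asboolP; exists 1; rewrite scale1r.
split.
- split=> [|b x y /asboolP[c ->] /asboolP[c' ->]]; apply/asboolP.
    by exists 0; rewrite scale0r.
  by exists (b * c + c'); rewrite scalerDl scalerA.
- by move=> z; case/eqP: w0; apply: z.
move=> T Tsub TS; have [sT tT gT] := submod_subspace Tsub.
have [z|nz] := pselect (zero_sub T); [by left|right].
have [x [xT x0]] : exists x, x \in T /\ x != 0.
  apply: contrapT => nx; apply: nz => v vT; apply: contrapT => v0.
  by apply: nx; exists v; split=> //; apply/eqP.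
have wT : (w : V) \in T.
  apply: (generated_simple yh d0 uniq_Z prod_Z q0 qint_neq0 size_a va ww w0 n0 sT tT gT _ xT x0).
  by move=> y yT; have /asboolP[b ->] := TS _ yT; apply: cyclic_generated.
move=> y /asboolP[b ->]; case: Tsub => T0 TP; rewrite -[_ *: _]addr0; exact: TP.
Qed.

Lemma weight_decomposition (v : restriction V) :
  sums (fun u => exists alpha, [/\ size alpha = n, valid alpha & wtV alpha u]) v.
Proof.
have sT : subspace (fun _ : restriction V => True) by [].
have tT : stable_t n (top V) (fun _ : restriction V => True) by [].
have := wt_split yh d0 uniq_Z prod_Z q0 qint_neq0 sT tT (fun _ _ _ _ => I) (leqnn n) I.
by move=> S; apply: sums_bind (S v) _ => u [_ Hu]; apply: sums1.
Qed.

(** An endomorphism commutes with the [t_j] and the Jucys--Murphy elements. *)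
Lemma weight_endomorphism (f : {linear V -> V}) alpha (w : restriction V) :
  (size alpha <= n)%N -> wtV alpha w -> wtV alpha (f w : restriction V).
Proof.
move=> size_a ww; pose h (u : restriction V) : restriction V := f u.
have hZ (c : K) u : h (c *: u) = c *: h u by rewrite restrictionE /h linearZ.
have hact (b : B) u : h (action V b u) = action V b (h u) by rewrite actionE /h linearZ.
have hD u u' : h (u + u') = h u + h u' by exact: linearD.
have h0 : h 0 = 0 by exact: linear0.
have hidem i j u : h (colour_idem d (top V) i j u) = colour_idem d (top V) i j (h u).
  rewrite /colour_idem hZ; congr (_ *: _); rewrite (big_morph h hD h0).
  have hit (b : B) s u' : h (iter s (action V b) u') = iter s (action V b) (h u').
    by elim: s => //= s <-; apply: hact.
  by apply: eq_bigr => s _; rewrite !hit.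
have hjm j u : h (jm d (gop V) (top V) j u) = jm d (gop V) (top V) j (h u).
  elim: j u => [|j IH] u; first by rewrite !jm0.
  by rewrite !jmS hD hact IH hact hidem hact.
move=> i lt_i; have [tw jw] := ww i lt_i; rewrite -/(h w).
by rewrite -hact tw -hjm jw !hZ.
Qed.

End Module.

Theorem semisimple_of_poincare : semisimple_algebra B.
Proof.
move=> v; have [s [-> Hs]] := sums_seq (weight_decomposition (v : restriction B^o)).
exists [seq u <- s | u != 0]; split.
  rewrite big_filter [LHS](bigID (fun u => u != 0)) /= [X in _ + X]big1 ?addr0 // => u.
  by rewrite negbK => /eqP.
move=> u; rewrite mem_filter => /andP[u0 us]; have [alpha [size_a va wu]] := Hs u us.
exists (cyclic_sub u); first exact: cyclic_sub_simple wu u0.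
by apply/asboolP; exists 1; rewrite scale1r.
Qed.

Theorem split_of_poincare : split_algebra B.
Proof.
move=> V [_ nz Vsimple] f.
have [v v0] : exists v : V, v != 0.
  apply: contrapT => nv; apply: nz => v _; apply: contrapT => v0.
  by apply: nv; exists v; apply/eqP.
have [w [alpha [size_a va ww]] w0] := sums_neq0 (weight_decomposition (v : restriction V)) v0.
have [[sub0 subP] nzw _] := cyclic_sub_simple size_a va ww w0.
have all_w (x : V) : exists b : B, x = b *: (w : V).
  have [z|all] := Vsimple (cyclic_sub w) (conj sub0 subP) (fun _ _ => isT); first by case: nzw.
  exact/asboolP/all.
have [b fw] := all_w (f w).
have gen_fw : generated n (gop V) (top V) w (f w : restriction V).
  by rewrite fw; apply: cyclic_generated.
have le_a : (size alpha <= n)%N by rewrite size_a.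
have [c fwc] := generated_multiplicity (action_yh yhe V) d0 uniq_Z prod_Z q0 qint_neq0
  size_a va ww n0 gen_fw (weight_endomorphism f le_a ww).
exists c => x; have [b' ->] := all_w x.
rewrite linearZ /= [f w]fwc restrictionE !scalerA; congr (_ *: _).
by rewrite mulr_algl mulr_algr.
Qed.
End Converse.
End SplitSemisimple.

(** * The Yokonuma--Hecke algebra *)

Section Specialised.
Variables (F K : fieldType) (theta : {rmorphism laurent F -> K}) (d n : nat).
Hypothesis d0 : d%:R != 0 :> F.

Local Notation A := (laurent F).
Local Notation q := (theta (laurentq F)).
Local Notation B := (yokonuma_spec theta d n).
Local Notation rel := (@yok_rel A (laurentq F) d n).
Local Notation image := (@word_image F K theta d n).

(** Zero outside the range of the presentation, so that the generators are
    sequences, as operators were above. *)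
Definition gN (i : nat) : B := if insub i is Some k then @gB F K theta d n k else 0.
Definition tN (j : nat) : B := if insub j is Some k then @tB F K theta d n k else 0.

Lemma gN_val (k : 'I_n.-1) : gN k = @gB F K theta d n k.
Proof. by rewrite /gN valK. Qed.
Lemma tN_val (k : 'I_n) : tN k = @tB F K theta d n k.
Proof. by rewrite /tN valK. Qed.

Lemma ord_of_bound (i : nat) : (i.+1 < n)%N -> exists k : 'I_n.-1, i = k :> nat.
Proof. by rewrite -ltn_predRL => lt_i; exists (Ordinal lt_i). Qed.
Lemma ord_of_lt (j : nat) : (j < n)%N -> exists k : 'I_n, j = k :> nat.
Proof. by move=> lt_j; exists (Ordinal lt_j). Qed.

Lemma word_imageX x s : image (x ^+ s) = image x ^+ s.
Proof. exact: (rmorphXn image). Qed.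
Lemma word_image_sum (s : seq nat) (E : nat -> {freealg A[ygen n]}) :
  image (\sum_(i <- s) E i) = \sum_(i <- s) image (E i).
Proof. exact: (rmorph_sum image). Qed.

Lemma specialised_yh_elements : yh_elements q d n gN tN.
Proof.
have relM a b c e : rel (a * b - c * e) -> image a * image b = image c * image e.
  move=> r; apply: (etrans (esym (word_imageM theta d a b))).
  exact: etrans (word_image_rel theta r) (word_imageM theta d c e).
have imM3 a b c : image (a * b * c) = image a * image b * image c.
  exact: etrans (word_imageM theta d (a * b) c) (congr1 ( *%R^~ _) (word_imageM theta d a b)).
split=> [i j ij jn|i lt_i|i j lt_i lt_j|i j lt_i lt_j|j lt_j|i lt_i].
- have [k ik] := ord_of_bound (ltn_trans ij (ltnW jn)); have [l jl] := ord_of_bound jn.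
  rewrite ik jl !gN_val; apply: relM; apply: YokComm; rewrite -ik -jl ij //.
- have [k ik] := ord_of_bound (ltnW lt_i); have [l jl] := ord_of_bound lt_i.
  rewrite jl ik !gN_val /gB; refine (etrans (esym (imM3 _ _ _)) (etrans _ (imM3 _ _ _))).
  by apply: word_image_rel; apply: YokBraid; rewrite -ik -jl.
- have [k ik] := ord_of_lt lt_i; have [l jl] := ord_of_lt lt_j.
  by rewrite ik jl !tN_val; apply: relM; apply: YokTT.
- have [k ik] := ord_of_bound lt_i; have [l jl] := ord_of_lt lt_j.
  by rewrite ik jl -swap_pos_tperm !tN_val gN_val; apply: relM; apply: YokTG.
- have [l jl] := ord_of_lt lt_j; rewrite jl tN_val /tB.
  refine (etrans (esym (word_imageX _ _)) (etrans _ (word_image1 theta d n))).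
  by apply: word_image_rel; apply: YokOrder.
have [k ik] := ord_of_bound lt_i; have kl : i = ord_left k by rewrite ik.
have kr : i.+1 = ord_right k by rewrite ik.
have eE : image (yok_e A d k) =
    d%:R^-1 *: \sum_(0 <= s < d) tN i ^+ s * tN i.+1 ^+ (d - s).
  apply: (etrans (word_imageZ _ _ _ _)); rewrite theta_inv_nat //; congr (_ *: _).
  apply: (etrans (word_image_sum _ _)); apply: eq_bigr => s _.
  apply: (etrans (word_imageM _ _ _ _)); rewrite kr kl !tN_val /tB.
  by congr (_ * _); apply: word_imageX.
have quad := word_image_rel theta (YokQuad (laurentq F) d k).
pose G : {freealg A[ygen n]} := freegen A (inl k : ygen n).
have imG2 : image (G ^+ 2) = gN i * gN i.
  by rewrite ik gN_val; exact: etrans (congr1 image (expr2 G)) (word_imageM theta d G G).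
have imZ : image ((laurentq F - (laurentq F)^-1) *: (yok_e A d k * G)) =
    (q - q^-1) *: (image (yok_e A d k) * gN i).
  apply: (etrans (word_imageZ theta d _ _)); rewrite rmorphB theta_inv_q ik gN_val.
  exact: congr1 (word_imageM theta d _ G).
have := etrans (esym imG2) (etrans quad (word_imageD theta d _ _)).
rewrite [image 1](word_image1 theta d n) imZ eE; exact.
Qed.

Lemma specialised_generated (V : lmodType B) (S : V -> Prop) : S 0 ->
  (forall u v, S u -> S v -> S (u + v)) ->
  (forall (c : K) v, S v -> S ((c%:A : B) *: v)) ->
  (forall i v, (i.+1 < n)%N -> S v -> S (gN i *: v)) ->
  (forall j v, (j < n)%N -> S v -> S (tN j *: v)) ->
  forall (b : B) v, S v -> S (b *: v).
Proof.
move=> S0 SD SZ Sg St; apply: stable_under_generators => // [i v|j v].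
  by rewrite -gN_val; apply: Sg; apply: ord_bound.
by rewrite -tN_val; apply: St.
Qed.

Lemma orbit_morphism (V : lmodType K) (g t : nat -> {linear V -> V}) (v : V) :
  yh_operators q d n g t ->
  exists phi : {linear restriction (B^o : lmodType B) -> V},
    [/\ forall i b, (i.+1 < n)%N -> phi (gN i * b : B) = g i (phi b),
        forall j b, (j < n)%N -> phi (tN j * b : B) = t j (phi b) &
        phi (1 : B) = v].
Proof.
move=> yh; pose f (b : restriction (B^o : lmodType B)) : V := orbit_map g t v (b : B).
have f_linear : linear f.
  move=> c a b; rewrite /f restrictionE -[_ *: _]/((c%:A : B) * (a : B)) mulr_algl.
  exact: (orbit_map_is_linear yh d0).
exists (HB.pack_for {linear restriction (B^o : lmodType B) -> V} f
  (GRing.isLinear.Build K _ V _ f f_linear)).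
split=> [i b lt_i|j b lt_j|] /=.
- by have [k ->] := ord_of_bound lt_i; rewrite gN_val; apply: (orbit_map_gen yh d0).
- by have [k ->] := ord_of_lt lt_j; rewrite tN_val; apply: (orbit_map_gen yh d0).
exact: (orbit_map1 yh d0).
Qed.

End Specialised.

(** The colours: in characteristic prime to [d] there are [d] of them. *)
Lemma roots_of_unity_split (K : closedFieldType) d : d%:R != 0 :> K ->
  exists2 Z : seq K, uniq Z & \prod_(z <- Z) ('X - z%:P) = 'X^d - 1.
Proof.
move=> d0; have d_gt0 : (0 < d)%N by case: d d0 => //; rewrite eqxx.
have [Z ZE] := closed_field_poly_normal ('X^d - 1 : {poly K}).
have {}ZE : \prod_(z <- Z) ('X - z%:P) = 'X^d - 1.
  have monic_d : ('X^d - 1 : {poly K}) \is monic by rewrite -polyC1; exact: monicXnsubC.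
  by rewrite [RHS]ZE (monicP monic_d) scale1r.
by exists Z => //; rewrite -separable_prod_XsubC ZE; apply: separable_Xn_sub_1.
Qed.

Theorem proposition9 (R : realType) (d n : nat) (hd : (1 <= d)%N) (hn : (1 <= n)%N)
    (theta : {rmorphism laurent R[i] -> R[i]}) (qbar : R[i])
    (theta_q : theta (laurentq R[i]) = qbar) (qbar_neq0 : qbar != 0) :
  split_semisimple (yokonuma_spec theta d n)
    <-> theta (poincare_poly R[i] n) != 0.
Proof.
have d0 : d%:R != 0 :> R[i] by rewrite pnatr_eq0 -lt0n.
have yhe := specialised_yh_elements theta n d0.
have gen := @specialised_generated R[i] R[i] theta d n.
rewrite theta_q in yhe.
have PE : theta (poincare_poly R[i] n) =
    \prod_(1 <= m < n.+1) \sum_(0 <= k < m) qbar ^+ (2 * k).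
  rewrite /poincare_poly rmorph_prod; apply: eq_bigr => m _.
  by rewrite rmorph_sum; apply: eq_bigr => k _; rewrite rmorphXn /= theta_q.
rewrite PE; split=> [[ss _]|P0].
  have yhw : yh_operators (theta (laurentq R[i])) d n (word_g qbar) (word_t R[i]).
    by rewrite theta_q; apply: word_yh.
  have [phi [phig phit phi1]] := orbit_morphism d0 (delta_word R[i]) yhw.
  exact: (poincare_neq0_of_semisimple yhe d0 qbar_neq0 gen phig phit phi1 ss).
have qint m : (0 < m <= n)%N -> \sum_(0 <= k < m) qbar ^+ (2 * k) != 0.
  case/andP=> m0 le_mn; apply: contraNneq P0 => qm0.
  by rewrite (bigD1_seq m) ?mem_index_iota ?iota_uniq ?m0 //= qm0 mul0r.
have [Z uZ ZE] := roots_of_unity_split d0.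
split.
  exact: (semisimple_of_poincare yhe hn d0 qbar_neq0 gen uZ ZE qint).
exact: (split_of_poincare yhe hn d0 qbar_neq0 gen uZ ZE qint).
Qed.
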